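(* Let $(G,d)$ be a homogeneous group with dilations $\{\delta_\lambda\}_{\lambda>0}$ relative to a grading $\mathfrak g=\bigoplus_{i>0}V_i$ of the Lie algebra $\mathfrak g$ of $G$. Let $\mathbb S_d=\{q\in G:d(0,q)=1\}$ and assume $p\in\mathbb S_d$ is such that $$\mathrm dL_p(V_1)+\mathrm dR_p(V_1)+\mathrm{span}\{\bar\delta(p)\}=T_pG .$$ Then, in some neighborhood of $p$, the sphere $\mathbb S_d$ is a Lipschitz graph and the distance $d_0:q\mapsto d(0,q)$ from the identity is Lipschitz with respect to any Riemannian metric $\rho$ on $G$.
   Context: A grading of a finite-dimensional real Lie algebra $\mathfrak g$ is a vector-space decomposition $\mathfrak g=\bigoplus_{i>0}V_i$, indexed by real numbers $i\in(0,\infty)$, with $[V_i,V_j]\subset V_{i+j}$ for all $i,j>0$. A graded group is a simply connected Lie group $G$ whose Lie algebra is graded; its neutral element is denoted $0$ and $\mathfrak g=T_0G$. The dilations relative to the grading are the Lie group automorphisms $\delta_\lambda:G\to G$, $\lambda>0$, with $(\delta_\lambda)_*(v)=\lambda^i v$ for all $v\in V_i$. A distance $d$ on $G$ is homogeneous if it is left-invariant and $d(\delta_\lambda x,\delta_\lambda y)=\lambda d(x,y)$ for all $\lambda>0$, $x,y\in G$; then $(G,d)$ is called a homogeneous group (with dilations relative to the grading). $L_p$ and $R_p$ denote left and right translation by $p$, and $\bar\delta(p)=\frac{d}{dt}\delta_t(p)\big|_{t=1}\in T_pG$. With $n=\dim G$: a set $S$ is a Lipschitz graph near $p\in S$ if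 there are a neighborhood $U$ of $p$ and a smooth chart on $U$ in which $S\cap U$ is the graph $\{x_n=\varphi(x_1,\dots,x_{n-1})\}$ of a Lipschitz function $\varphi$. *)

(* Defs.v *)
From HB Require Import structures.
From mathcomp Require Import all_boot all_order all_algebra.
From mathcomp Require Import all_classical all_reals all_analysis.

Set Implicit Arguments.
Unset Strict Implicit.
Unset Printing Implicit Defensive.

Import Order.TTheory GRing.Theory Num.Theory.
Import numFieldNormedType.Exports.

Local Open Scope classical_set_scope.
Local Open Scope ring_scope.

(* Only meaningful for open [D] and finite-dimensional [V]: all directional
   derivatives are then a coordinate-free substitute for the partial ones. *)
Fixpoint Ck (R : realType) (V W : normedModType R) (k : nat) (D : set V)
    (f : V -> W) : Prop :=
  if k is k'.+1 then
    (forall x, D x -> differentiable f x) /\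
    (forall v, Ck k' D (fun x => 'D_v f x))
  else forall x, D x -> {for x, continuous f}.

Definition Ck_at (R : realType) (V W : normedModType R) (k : nat)
    (f : V -> W) (x : V) : Prop :=
  exists D : set V, open_nbhs x D /\ Ck k D f.

Definition smooth_at (R : realType) (V W : normedModType R)
    (f : V -> W) (x : V) : Prop :=
  exists D : set V, open_nbhs x D /\ forall k, Ck k D f.

(* [cmap] and [cinv] are total functions whose values are only relevant on
   [cdom] and on [cmap @` cdom]. *)
Record chart (R : realType) (n : nat) (T : topologicalType) := Chart {
  cdom : set T;
  cmap : T -> 'rV[R]_n;
  cinv : 'rV[R]_n -> T;
  cdom_open : open cdom;
  cimage_open : open (cmap @` cdom);
  cmapK : forall q, cdom q -> cinv (cmap q) = q;
  cmap_continuous : forall q, cdom q -> {for q, continuous cmap};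
  cinv_continuous : forall q, cdom q -> {for cmap q, continuous cinv} }.

Definition smooth_transition (R : realType) (n : nat) (T : topologicalType)
    (c c' : chart R n T) : Prop :=
  forall q, cdom c q -> cdom c' q ->
    smooth_at (fun x => cmap c' (cinv c x)) (cmap c q).

(* The smooth structure is given by an atlas indexed by the points, with a
   preferred chart [chart_at p] around each [p]. The tangent space at [p] is
   identified with ['rV[R]_n] through [chart_at p]; all tangent vectors at [p]
   below are written in these coordinates. *)
HB.mixin Record isSmoothManifold (R : realType) (n : nat) T of Topological T := {
  mfd_hausdorff : hausdorff_space T;
  mfd_second_countable : @second_countable T;
  chart_at : T -> chart R n T;
  chart_at_dom : forall p, cdom (chart_at p) p;
  chart_at_transition : forall p q,
    smooth_transition (chart_at p) (chart_at q) }.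

#[short(type="smoothManifoldType")]
HB.structure Definition SmoothManifold (R : realType) (n : nat) :=
  { T of Topological T & isSmoothManifold R n T }.

(* membership in the maximal atlas *)
Definition smooth_chart (R : realType) (n : nat) (M : smoothManifoldType R n)
    (c : chart R n M) : Prop :=
  forall p : M, smooth_transition c (chart_at p) /\
                smooth_transition (chart_at p) c.

Definition mfd_smooth (R : realType) (m n : nat) (M : smoothManifoldType R m)
    (N : smoothManifoldType R n) (f : M -> N) : Prop :=
  forall p : M, {for p, continuous f} /\
    smooth_at (fun x => cmap (chart_at (f p)) (f (cinv (chart_at p) x)))
              (cmap (chart_at p) p).

(* the differential of [f] at [p], from T_p M to T_(f p) N *)
Definition mdiff (R : realType) (m n : nat) (M : smoothManifoldType R m)
    (N : smoothManifoldType R n) (f : M -> N) (p : M) :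
    {linear 'rV[R]_m -> 'rV[R]_n} :=
  'd (fun x => cmap (chart_at (f p)) (f (cinv (chart_at p) x)))
     (cmap (chart_at p) p).

Definition velocity (R : realType) (n : nat) (M : smoothManifoldType R n)
    (gamma : R -> M) (t : R) : 'rV[R]_n :=
  derive1 (fun s => cmap (chart_at (gamma t)) (gamma s)) t.

(* The product manifold is charted by the products of preferred charts, with
   values in ['rV[R]_(n + n)]. *)
HB.mixin Record isLieGroup (R : realType) (n : nat) G
    of Group G & SmoothManifold R n G := {
  mulg_continuous : continuous (fun xy : G * G => (xy.1 * xy.2)%g);
  mulg_smooth : forall x y : G,
    smooth_at (fun z : 'rV[R]_(n + n) =>
                 cmap (chart_at (x * y)%g)
                   (cinv (chart_at x) (lsubmx z) *
                    cinv (chart_at y) (rsubmx z))%g)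
              (row_mx (cmap (chart_at x) x) (cmap (chart_at y) y));
  invg_smooth : mfd_smooth (fun x : G => x^-1%g) }.

#[short(type="lieGroupType")]
HB.structure Definition LieGroup (R : realType) (n : nat) :=
  { G of Group G & SmoothManifold R n G & isLieGroup R n G }.

Definition simply_connected (R : realType) (T : topologicalType) : Prop :=
  (forall x y : T, exists gamma : R -> T,
     [/\ {within `[0, 1], continuous gamma}, gamma 0 = x & gamma 1 = y]) /\
  (forall gamma : R -> T, {within `[0, 1], continuous gamma} ->
     gamma 0 = gamma 1 ->
     exists H : R * R -> T,
       [/\ {within `[0, 1] `*` `[0, 1], continuous H},
           forall s, s \in `[0, 1] -> H (s, 0) = gamma s,
           forall s, s \in `[0, 1] -> H (s, 1) = gamma 0,
           forall t, t \in `[0, 1] -> H (0, t) = gamma 0 &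
           forall t, t \in `[0, 1] -> H (1, t) = gamma 0]).

Section LieAlgebra.
Context (R : realType) (n : nat) (G : lieGroupType R n).

Definition left_translation (p : G) : G -> G := fun q => (p * q)%g.
Definition right_translation (p : G) : G -> G := fun q => (q * p)%g.

(* the left-invariant vector field extending [u], read near the identity in
   the coordinates of the single chart [chart_at 1] *)
Definition left_invariant_field (u x : 'rV[R]_n) : 'rV[R]_n :=
  let c := chart_at (1%g : G) in
  'd (fun y => cmap c (left_translation (cinv c x) (cinv c y)))
     (cmap c 1%g) u.

(* the value at the identity of the commutator of the two vector fields *)
Definition lie_bracket (u v : 'rV[R]_n) : 'rV[R]_n :=
  let x0 := cmap (chart_at (1%g : G)) 1%g in
  let X := left_invariant_field u in
  let Y := left_invariant_field v in
  'D_(X x0) Y x0 - 'D_(Y x0) X x0.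

(* Only the values of [V] at positive reals are relevant; all but finitely
   many of them vanish. *)
Definition is_grading (V : R -> {vspace 'rV[R]_n}) : Prop :=
  (exists s : seq R,
     [/\ uniq s, all (fun i => 0 < i) s,
         forall i, 0 < i -> i \notin s -> V i = 0%VS,
         directv (\sum_(k < size s) V s`_k)%VS &
         (\sum_(k < size s) V s`_k)%VS = fullv]) /\
  (forall i j, 0 < i -> 0 < j -> forall u v,
     u \in V i -> v \in V j -> lie_bracket u v \in V (i + j)).

Definition lie_automorphism (f : G -> G) : Prop :=
  [/\ {morph f : x y / (x * y)%g}, mfd_smooth f &
      exists g : G -> G, [/\ cancel f g, cancel g f & mfd_smooth g]].

Definition is_dilation_family (V : R -> {vspace 'rV[R]_n})
    (delta : R -> G -> G) : Prop :=
  forall lambda, 0 < lambda ->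
    lie_automorphism (delta lambda) /\
    forall i, 0 < i -> forall v, v \in V i ->
      mdiff (delta lambda) 1%g v = (lambda `^ i) *: v.

(* [delta 1] is the identity, so that this is a vector of T_p G *)
Definition delta_bar (delta : R -> G -> G) (p : G) : 'rV[R]_n :=
  derive1 (fun t => cmap (chart_at p) (delta t p)) 1.

Definition is_distance (d : G -> G -> R) : Prop :=
  [/\ forall x y, 0 <= d x y,
      forall x y, d x y = 0 <-> x = y,
      forall x y, d x y = d y x &
      forall x y z, d x z <= d x y + d y z].

Definition homogeneous_distance (delta : R -> G -> G) (d : G -> G -> R) :=
  [/\ is_distance d,
      forall g x y, d (g * x)%g (g * y)%g = d x y &
      forall lambda, 0 < lambda -> forall x y,
        d (delta lambda x) (delta lambda y) = lambda * d x y].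

Definition unit_sphere (d : G -> G -> R) : set G := [set q | d 1%g q = 1].

End LieAlgebra.

Section Riemannian.
Context (R : realType) (n : nat) (M : smoothManifoldType R n).

(* The coefficients of the metric in [chart_at p] are obtained by pulling back
   through the change of coordinates from [chart_at p] to the preferred chart
   [chart_at q] at each nearby point [q]. *)
Definition metric_coeff (g : M -> 'rV[R]_n -> 'rV[R]_n -> R) (p : M)
    (u v x : 'rV[R]_n) : R :=
  let q := cinv (chart_at p) x in
  let A := 'd (fun y => cmap (chart_at q) (cinv (chart_at p) y)) x in
  g q (A u) (A v).

Definition riemannian_metric (g : M -> 'rV[R]_n -> 'rV[R]_n -> R) : Prop :=
  [/\ forall p a u v w, g p (a *: u + v) w = a * g p u w + g p v w,
      forall p u v, g p u v = g p v u,
      forall p u, u != 0 -> 0 < g p u u &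
      forall p u v,
        smooth_at (metric_coeff g p u v : 'rV[R]_n -> R^o)
                  (cmap (chart_at p) p)].

Definition C1_curve (gamma : R -> M) : Prop :=
  forall t, t \in `[0, 1] -> {for t, continuous gamma} /\
    Ck_at 1 (fun s : R^o => cmap (chart_at (gamma t)) (gamma s)) t.

Definition curve_length (g : M -> 'rV[R]_n -> 'rV[R]_n -> R)
    (gamma : R -> M) : \bar R :=
  (\int[lebesgue_measure]_(t in `[0%R, 1%R])
     (Num.sqrt (g (gamma t) (velocity gamma t) (velocity gamma t)))%:E)%E.

(* lengths of the piecewise C^1 curves from [x] to [y], each presented as a
   chain of [k] C^1 arcs parametrized by [0, 1] *)
Definition path_lengths (g : M -> 'rV[R]_n -> 'rV[R]_n -> R) (x y : M) :
    set (\bar R) :=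
  [set l | exists (k : nat) (z : nat -> M) (gamma : nat -> R -> M),
     [/\ z 0%N = x, z k = y,
         forall i, (i < k)%N ->
           [/\ C1_curve (gamma i), gamma i 0 = z i & gamma i 1 = z i.+1] &
         l = (\sum_(i < k) curve_length g (gamma i))%E]].

Definition riemannian_distance (g : M -> 'rV[R]_n -> 'rV[R]_n -> R)
    (x y : M) : \bar R := ereal_inf (path_lengths g x y).

(* [j] is the last index, and [col' j] drops the last coordinate. *)
Definition lipschitz_graph_on (S U : set M) : Prop :=
  exists (c : chart R n M) (j : 'I_n) (phi : 'rV[R]_n.-1 -> R^o),
    [/\ smooth_chart c, cdom c = U, j = n.-1 :> nat, lipschitz phi &
        forall q, U q -> (S q <-> cmap c q 0 j = phi (col' j (cmap c q)))].

Definition lipschitz_wrt (rho : M -> M -> \bar R) (f : M -> R) (U : set M) :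
    Prop :=
  exists L : R, 0 <= L /\ forall x y, U x -> U y ->
    (`|f x - f y|%:E <= L%:E * rho x y)%E.

End Riemannian.

(* Main.v *)
(** Put [N q = d 1 q] and write [exp v] for the one-parameter subgroup directed
    by [v]. A dilation maps [exp v t] to [exp v (l ^ i * t)] when [v] has weight
    [i], so that [N (exp v t) = |t| N (exp v 1)] for [v] in [V 1]. By left
    invariance, [N] changes by at most [N x] when its argument is multiplied by
    [x] on either side, and [N (delta l q) = l N q]. The spanning condition says
    that the map [(l, x, y) |-> x * delta l q * y], with [x] and [y] products of
    [exp v t] with [v] in [V 1], is submersive at the identity parameters; an
    inverse function argument, uniform in [q] near [p], reaches every nearby
    point with parameters bounded by the displacement. Hence [N] is Lipschitz in
    coordinates near [p].

    The dilation orbits are transverse to the sphere since [N] grows at unit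
    speed along them. In linear coordinates whose last axis is
    [delta_bar delta p], this and the Lipschitz bound give a cone
    condition, by which the sphere is a Lipschitz graph over its projection;
    McShane's extension defines the graph over the whole base. Finally a curve
    joining two points close to [p] either stays in a coordinate ball, where its
    Riemannian length dominates the coordinate distance, or is longer than a
    fixed multiple of the radius; so the Lipschitz bound transfers to any
    Riemannian distance.

    Differentiability of [delta l q] in [l] is not assumed. It comes from
    writing a point as a product of factors [exp v t] with homogeneous [v], which
    is possible because [G] is connected. *)

Require Import Defs.
From HB Require Import structures.
From mathcomp Require Import all_boot all_order all_fingroup all_algebra.
From mathcomp Require Import all_classical all_reals all_analysis.
From mathcomp Require Import ring lra.

Set Implicit Arguments.
Unset Strict Implicit.
Unset Printing Implicit Defensive.

Import Order.TTheory GRing.Theory Num.Theory.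
Import numFieldNormedType.Exports.

Local Open Scope classical_set_scope.
Local Open Scope ring_scope.

(** * Strict differentiability *)

Section StrictDiff.
Context {R : realType}.
Implicit Types (V W : normedModType R).

(** The only notion of derivative used is strict differentiability at a single point. It is closed
    under composition and products, it supports a Newton iteration, and for a homomorphism it
    follows from the behaviour at the identity, whereas nothing shows in advance that [exp v] or a
    dilation orbit is of class C^1. Uniformity in [q] near [p] is gained by writing [q] as [p] times
    a product of exponentials and treating its parameters as extra variables: points with the same
    parameters are compared by one two-point estimate at the origin. One-parameter subgroups are
    obtained without differential equations, as limits of the powers of [y_k] with exponent the
    integer part of [2^k t], where [y_k] has coordinates [2^-k v]; convergence rests on the
    quadratic error of squaring. Their uniqueness, proved by comparing powers, gives the action of
    the dilations on them. The spanning condition enters through [n] chosen triples, one for each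
    coordinate vector, which turn the submersion into a map whose derivative in an [n]-dimensional
    unknown is the identity. *)

Lemma geometric_cvg n (u : nat -> 'rV[R]_n) (C : R) :
  (forall k, `|u k.+1 - u k| <= C * 2^-1 ^+ k) ->
  exists l, forall k, `|l - u k| <= 2 * C * 2^-1 ^+ k.
Proof.
move=> hu.
have C0 : 0 <= C by have := hu 0%N; rewrite expr0 mulr1; apply: le_trans.
(* The factor [1 - 2^-m] makes the induction on [m] close with equality. *)
have hB k m : `|u (k + m)%N - u k| <= 2 * C * 2^-1 ^+ k * (1 - 2^-1 ^+ m).
  elim: m => [|m IH]; first by rewrite addn0 expr0 !subrr normr0 mulr0.
  have -> : u (k + m.+1)%N - u k
      = (u (k + m).+1 - u (k + m)%N) + (u (k + m)%N - u k).
    by rewrite addnS addrA subrK.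
  apply: le_trans (ler_normD _ _) _; apply: le_trans (lerD (hu _) IH) _.
  by rewrite exprD exprS le_eqVlt; apply/orP; left; apply/eqP; field.
have p2 k : 0 <= 2^-1 ^+ k :> R by rewrite exprn_ge0// invr_ge0.
have hA k m : `|u (k + m)%N - u k| <= 2 * C * 2^-1 ^+ k.
  apply: le_trans (hB k m) _; have pm := p2 m.
  by apply: ler_piMr; [rewrite mulr_ge0// mulr_ge0|rewrite lerBlDr lerDl].
have hgeo : (fun k => 2 * C * 2^-1 ^+ k) @ \oo --> (0 : R).
  by rewrite -(mulr0 (2 * C)); apply: cvgMr; apply: cvg_expr; rewrite gtr0_norm; lra.
have cu : cvg (u @ \oo).
  apply/cauchy_cvgP/cauchy_exP => e e0.
  have /cvgrPdist_lt/(_ _ e0) [N _ hN] := hgeo.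
  exists (u N); exists N => // k /= Nk.
  rewrite -ball_normE /= distrC -(subnKC Nk).
  apply: le_lt_trans (hA _ _) _.
  have := hN N (leqnn N); rewrite /= sub0r normrN.
  by apply: le_lt_trans; rewrite ler_norm.
exists (lim (u @ \oo)) => k.
apply/ler_addgt0Pl => e e0.
have /cvgrPdist_le/(_ _ e0) [N _ hN] := cu.
have := hN (k + N)%N (leq_addl _ _) => /= h1.
have -> : lim (u @ \oo) - u k = (lim (u @ \oo) - u (k + N)%N) + (u (k + N)%N - u k).
  by rewrite subrKA.
by apply: le_trans (ler_normD _ _) (lerD h1 (hA _ _)).
Qed.

(** Both points vary: near [x] the difference between [f] and its linear part is Lipschitz with
    arbitrarily small constant. [L] is required to be bounded because [V] may have infinite
    dimension. *)
Definition sdiff V W (f : V -> W) (x : V) (L : V -> W) : Prop :=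
  [/\ linear L, exists C, forall u, `|L u| <= C * `|u| &
    forall e, 0 < e -> exists2 U, nbhs x U &
      forall y z, U y -> U z -> `|f y - f z - L (y - z)| <= e * `|y - z| ].

Lemma linearB_fun V W (L : V -> W) : linear L -> {morph L : x y / x - y}.
Proof.
by move=> hL x y; have := hL (-1) y x; rewrite !scaleN1r ![- _ + _]addrC.
Qed.

Lemma linear0_fun V W (L : V -> W) : linear L -> L 0 = 0.
Proof. by move=> hL; rewrite -(subrr 0) linearB_fun// subrr. Qed.

Lemma linearD_fun V W (L : V -> W) : linear L -> {morph L : x y / x + y}.
Proof. by move=> hL x y; have := hL 1 x y; rewrite !scale1r. Qed.

Lemma linearZ_fun V W (L : V -> W) : linear L -> forall a u, L (a *: u) = a *: L u.
Proof.
by move=> hL a u; have := hL a u 0; rewrite !addr0 linear0_fun// addr0.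
Qed.

Lemma bounded_pos V W (L : V -> W) : (exists C, forall u, `|L u| <= C * `|u|) ->
  exists2 C, 0 < C & forall u, `|L u| <= C * `|u|.
Proof.
move=> [C hC]; exists (`|C| + 1); first by rewrite ltr_wpDl.
move=> u; apply: le_trans (hC u) _; rewrite ler_wpM2r//.
by rewrite (le_trans (ler_norm _))// lerDl.
Qed.

Lemma sdiff_lip V W (f : V -> W) x L : sdiff f x L -> exists2 K, 0 < K &
  exists2 U, nbhs x U & forall y z, U y -> U z -> `|f y - f z| <= K * `|y - z|.
Proof.
move=> [lL /bounded_pos[C C0 hC] h]; exists (1 + C); first by rewrite addr_gt0.
have [U xU hU] := h 1 ltr01; exists U => // y z Uy Uz.
rewrite -(subrK (L (y - z)) (f y - f z)).
by apply: le_trans (ler_normD _ _) _; rewrite mulrDl lerD// hU.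
Qed.

Lemma sdiff_cont V W (f : V -> W) x L : sdiff f x L -> {for x, continuous f}.
Proof.
move=> /sdiff_lip[K K0 [U xU hU]]; apply/cvgrPdist_le => e e0.
near=> y.
have Uy : U y by near: y.
apply: le_trans (hU _ _ (nbhs_singleton xU) Uy) _.
rewrite -ler_pdivlMl//; near: y.
by apply: cvgr_dist_le; rewrite // mulr_gt0// invr_gt0.
Unshelve. all: by end_near. Qed.

Lemma sdiff_near V W (f g : V -> W) x L :
  (\forall y \near x, f y = g y) -> sdiff f x L -> sdiff g x L.
Proof.
move=> fg [lL bL h]; split => // e e0; have [U xU hU] := h e e0.
exists (U `&` [set y | f y = g y]); first exact: filterI.
by move=> y z [Uy <-] [Uz <-]; exact: hU.
Qed.

Lemma sdiff_lin V W (L : V -> W) x : linear L ->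
  (exists C, forall u, `|L u| <= C * `|u|) -> sdiff L x L.
Proof.
move=> lL bL; split=> // e e0; exists setT; first exact: filterT.
by move=> y z _ _; rewrite linearB_fun// subrr normr0 mulr_ge0// ltW.
Qed.

Lemma sdiff_id V x : sdiff (fun y : V => y) x (fun u => u).
Proof. by apply: sdiff_lin => //; exists 1 => u; rewrite mul1r. Qed.

Lemma sdiff_cst V W (c : W) (x : V) : sdiff (fun=> c) x (fun=> 0).
Proof.
split=> [a u v||e e0]; first by rewrite scaler0 addr0.
  by exists 0 => u; rewrite normr0 mul0r.
exists setT; first exact: filterT.
by move=> y z _ _; rewrite !subr0 subrr normr0 mulr_ge0// ltW.
Qed.

Lemma sdiff_comp V W W' (f : V -> W) (g : W -> W') x L M :
  sdiff f x L -> sdiff g (f x) M -> sdiff (fun y => g (f y)) x (fun u => M (L u)).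
Proof.
move=> df dg; have cf := sdiff_cont df; have [K K0 [U xU hU]] := sdiff_lip df.
case: (df) => lL /bounded_pos[C C0 hC] hf.
case: (dg) => lM /bounded_pos[D D0 hD] hg.
split=> [a u v||e e0]; first by rewrite lL lM.
  exists (D * C) => u; apply: le_trans (hD _) _; rewrite -mulrA ler_pM2l//.
have [S xS hS] := hg (e / 2 / K) ltac:(by rewrite !divr_gt0).
have [T xT hT] := hf (e / 2 / D) ltac:(by rewrite !divr_gt0).
exists (U `&` (f @^-1` S) `&` T).
  by apply: filterI => //; apply: filterI => //; exact: cf.
move=> y z [[Uy Sy] Ty] [[Uz Sz] Tz].
have -> : g (f y) - g (f z) - M (L (y - z))
   = (g (f y) - g (f z) - M (f y - f z)) + M (f y - f z - L (y - z)).
  by rewrite (linearB_fun lM (f y - f z)) subrKA.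
apply: le_trans (ler_normD _ _) _; rewrite [e]splitr mulrDl lerD//.
  apply: le_trans (hS _ _ Sy Sz) _.
  apply: le_trans (ler_wpM2l _ (hU _ _ Uy Uz)) _; first by rewrite !divr_ge0// ltW.
  by rewrite mulrA divfK ?gt_eqF.
apply: le_trans (hD _) _; rewrite -ler_pdivlMl//.
by apply: le_trans (hT _ _ Ty Tz) _; rewrite mulrA [D^-1 * _]mulrC.
Qed.

Lemma sdiffD V W (f g : V -> W) x L M : sdiff f x L -> sdiff g x M ->
  sdiff (fun y => f y + g y) x (fun u => L u + M u).
Proof.
move=> [lL [C hC] hf] [lM [D hD] hg]; split=> [a u v||e e0].
- by rewrite lL lM scalerDr addrACA.
- exists (C + D) => u; apply: le_trans (ler_normD _ _) _; rewrite mulrDl.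
  by rewrite lerD.
have [U xU hU] := hf (e / 2) ltac:(by rewrite divr_gt0).
have [T xT hT] := hg (e / 2) ltac:(by rewrite divr_gt0).
exists (U `&` T); first exact: filterI.
move=> y z [Uy Ty] [Uz Tz].
have -> : f y + g y - (f z + g z) - (L (y - z) + M (y - z))
  = (f y - f z - L (y - z)) + (g y - g z - M (y - z)).
  by rewrite opprD addrACA opprD [LHS]addrACA.
apply: le_trans (ler_normD _ _) _; rewrite [e]splitr mulrDl lerD//.
- exact: hU.
- exact: hT.
Qed.

End StrictDiff.

(** * Mean value inequality, and strict differentiability of C^1 maps *)

Section MeanValue.
Context {R : realType}.
Implicit Types (V W : normedModType R).

Lemma coord_norm_le n (u : 'rV[R]_n) i : `|u 0 i| <= `|u|.
Proof.
rewrite [leRHS]/Num.Def.normr/= mx_normrE.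
exact: (le_bigmax _ (fun ij : 'I_1 * 'I_n => `|u ij.1 ij.2|) (0, i)).
Qed.

Lemma rV_norm_le n (u : 'rV[R]_n) e : 0 <= e -> (forall i, `|u 0 i| <= e) -> `|u| <= e.
Proof.
move=> e0 h; rewrite [leLHS]/Num.Def.normr/= mx_normrE.
by apply: bigmax_le => // -[i j] _ /=; rewrite (ord1 i).
Qed.

Lemma linear_rV_sum n W (L : 'rV[R]_n -> W) : linear L ->
  forall u, L u = \sum_i u 0 i *: L (delta_mx 0 i).
Proof.
move=> lL u.
pose Ll : {linear 'rV[R]_n -> W} := HB.pack L (GRing.isLinear.Build _ _ _ _ L lL).
rewrite -[L]/(Ll : _ -> _) {1}(row_sum_delta u) linear_sum.
by apply: eq_bigr => i _; rewrite linearZ.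
Qed.

Lemma linear_rV_bounded n W (L : 'rV[R]_n -> W) : linear L ->
  exists C, forall u, `|L u| <= C * `|u|.
Proof.
move=> lL; exists (\sum_i `|L (delta_mx 0 i)|) => u; rewrite linear_rV_sum//.
rewrite mulr_suml; apply: le_trans (ler_norm_sum _ _ _) _.
by apply: ler_sum => i _; rewrite normrZ mulrC ler_wpM2l// coord_norm_le.
Qed.

(** Fixing one of the two points at [x] gives the usual first-order expansion, and uniqueness of the
    differential does the rest. *)
Lemma sdiff_diff V W (f : V -> W) x L : sdiff f x L ->
  differentiable f x /\ 'd f x = L :> (V -> W).
Proof.
move=> [lL bL h].
pose Ll : {linear V -> W} := HB.pack L (GRing.isLinear.Build _ _ _ _ L lL).
have cL : continuous Ll.
  by move=> y; exact: (sdiff_cont (sdiff_lin y lL bL)).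
have ex : f \o shift x = cst (f x) + Ll +o_ 0 id.
  apply/eqaddoP => e e0; have [U xU hU] := h e e0.
  have : \forall y \near (0 : V), U (y + x).
    have : {for 0, continuous (fun y : V => y + x)}.
      by apply: continuousD; [exact: cvg_id|exact: cvg_cst].
    by apply; rewrite /= add0r.
  apply: filterS => y Uy; have := hU _ _ Uy (nbhs_singleton xU).
  rewrite addrK; congr (`|_| <= _).
  by rewrite -![(_ + _ : _ -> _) _]/(_ + _) -![(- _ : _ -> _) _]/(- _) /= opprD addrA.
have dE := diff_unique cL ex; split => //.
by apply/diff_locallyP; rewrite dE.
Qed.

Lemma is_derive_line V n (f : V -> 'rV[R]_n) (z v : V) t i :
  differentiable f (z + t *: v) ->
  is_derive t 1 (fun s : R => f (z + s *: v) 0 i) ('d f (z + t *: v) v 0 i).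
Proof.
move=> df.
have dl : is_diff t (cst z + ( *:%R ^~ v)) (0 + ( *:%R ^~ v) : R -> V) by apply: is_diffD.
have dc : is_diff (f (z + t *: v)) (fun N : 'rV[R]_n => N 0 i : R)
    (fun N : 'rV[R]_n => N 0 i : R).
  have lc : linear (fun N : 'rV[R]_n => N 0 i : R^o) by move=> a u w; rewrite !mxE.
  have [h1 h2] := sdiff_diff (sdiff_lin (f (z + t *: v)) lc (linear_rV_bounded lc)).
  exact: DiffDef.
have df' : is_diff ((cst z + ( *:%R ^~ v)) t) f ('d f (z + t *: v)) by exact: DiffDef.
have dd := is_diff_comp (is_diff_comp dl df') dc.
have ex := @ex_diff _ _ _ _ _ _ _ dd.
apply: DeriveDef; first exact: diff_derivable.
rewrite deriveE//.
have -> : (fun s : R => f (z + s *: v) 0 i) =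
   (fun N : 'rV[R]_n => N 0 i : R) \o (f \o (cst z + ( *:%R ^~ v))) by [].
by rewrite diff_val /= -![(_ + _ : _ -> _) _]/(_ + _) add0r scale1r.
Qed.

(** The real mean value theorem is applied to each coordinate, at a point depending on the
    coordinate; the norm being the maximum of the coordinates, nothing is lost when they are put
    together. *)
Lemma mean_value V n (f L : V -> 'rV[R]_n) (y z : V) k :
  (forall t : R, 0 <= t <= 1 -> differentiable f (z + t *: (y - z)) /\
     `|'d f (z + t *: (y - z)) (y - z) - L (y - z)| <= k) ->
  `|f y - f z - L (y - z)| <= k.
Proof.
move=> h.
have k0 : 0 <= k.
  by have [_] := h 0 ltac:(by rewrite lexx ler01); apply: le_trans.
apply: rV_norm_le => // i.
pose g s : R := f (z + s *: (y - z)) 0 i.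
have dg (t : R) : 0 <= t <= 1 -> is_derive t 1 g ('d f (z + t *: (y - z)) (y - z) 0 i).
  by move=> /h[df _]; exact: is_derive_line.
have [|||c] := @MVT R g (fun t => 'd f (z + t *: (y - z)) (y - z) 0 i) 0 1.
- exact: ltr01.
- by move=> t; rewrite in_itv /= => /andP[t0 t1]; apply: dg; rewrite !ltW.
- apply: derivable_within_continuous => t; rewrite in_itv /= => t01.
  by have dgt := dg t t01; exact: ex_derive.
rewrite in_itv /= => /andP[c0 c1]; rewrite /g subr0 mulr1 scale0r addr0 scale1r.
rewrite [z + _]addrC subrK => e.
have [|_] := h c; first by rewrite !ltW.
apply: le_trans; apply: le_trans (coord_norm_le _ i).
by rewrite !mxE -e.
Qed.

Lemma ball_segment V (x y z : V) r t : `|y - x| < r -> `|z - x| < r ->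
  0 <= t <= 1 -> `|z + t *: (y - z) - x| < r.
Proof.
move=> yr zr /andP[t0 t1].
have -> : z + t *: (y - z) - x = t *: (y - x) + (1 - t) *: (z - x).
  by rewrite scalerBl scale1r addrCA -scalerBr opprB addrA subrK [LHS]addrAC.
apply: le_lt_trans (ler_normD _ _) _; rewrite !normrZ !ger0_norm ?subr_ge0//.
have [/eqP->|t0'] := boolP (t == 0); first by rewrite mul0r add0r subr0 mul1r.
have tp : 0 < t by rewrite lt_neqAle eq_sym t0'.
have -> : r = t * r + (1 - t) * r by ring.
by rewrite ltr_leD ?ltr_pM2l// ler_wpM2l ?subr_ge0// ltW.
Qed.

(** Balls are convex, so the mean value inequality applies between any two points of a ball on which
    the differential is close to the one at [x]. *)
Lemma sdiff_of_close V n (f : V -> 'rV[R]_n) x :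
  (forall e, 0 < e -> \forall y \near x, differentiable f y /\
     forall u, `|'d f y u - 'd f x u| <= e * `|u|) ->
  sdiff f x ('d f x).
Proof.
move=> h; split.
- exact: linearP.
- have [df _] := nbhs_singleton (h 1 ltr01).
  by have [k _ hk] := linear_lipschitz (diff_continuous df); exists k.
- move=> e e0; have /nbhs_ballP[r r0 hr] := h e e0.
  exists (ball x r); first exact: nbhsx_ballx.
  move=> y z; rewrite -ball_normE /= distrC [`|x - z|]distrC => yr zr.
  apply: mean_value => t t01.
  have [|d1 d2] := hr (z + t *: (y - z)).
    by rewrite -ball_normE /= distrC; exact: ball_segment.
  by split=> //; rewrite -linearB.
Qed.

Lemma diff_rV_sum m W (f : 'rV[R]_m -> W) y u : differentiable f y ->
  'd f y u = \sum_i u 0 i *: 'D_(delta_mx 0 i) f y.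
Proof.
move=> df; rewrite (@linear_rV_sum _ _ ('d f y))//; last exact: linearP.
by apply: eq_bigr => i _; rewrite deriveE.
Qed.

Lemma diff_close_rV m W (f : 'rV[R]_m -> W) x y e : 0 <= e ->
  differentiable f x -> differentiable f y ->
  (forall i, `|'D_(delta_mx 0 i) f y - 'D_(delta_mx 0 i) f x| <= e) ->
  forall u, `|'d f y u - 'd f x u| <= m%:R * e * `|u|.
Proof.
move=> e0 dx dy h u.
have -> : 'd f y u - 'd f x u =
    \sum_i u 0 i *: ('D_(delta_mx 0 i) f y - 'D_(delta_mx 0 i) f x).
  under [RHS]eq_bigr do rewrite scalerBr.
  by rewrite sumrB; congr (_ - _); exact: diff_rV_sum.
apply: le_trans (ler_norm_sum _ _ _) _.
have -> : m%:R * e * `|u| = \sum_(i < m) e * `|u|.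
  by rewrite sumr_const card_ord -mulrA mulr_natl.
apply: ler_sum => i _; rewrite normrZ mulrC ler_pM//.
exact: coord_norm_le.
Qed.

Lemma continuous_close V W (g : V -> W) x e : {for x, continuous g} -> 0 < e ->
  \forall y \near x, `|g y - g x| <= e.
Proof.
by move=> /cvgrPdist_le h /h; apply: filterS => y; rewrite distrC.
Qed.

Lemma differentiable_lip V W (g : V -> W) x : differentiable g x ->
  exists2 C, 0 < C & \forall y \near x, `|g y - g x| <= C * `|y - x|.
Proof.
move=> dg; have [k k0 hk] := linear_lipschitz (diff_continuous dg).
exists (k + 1); first by rewrite addr_gt0.
have /eqaddoP/(_ 1 ltr01) h := diff_locally dg.
have -> : (\forall y \near x, `|g y - g x| <= (k + 1) * `|y - x|)
  = \forall y \near (0 : V), `|g (y + x) - g x| <= (k + 1) * `|y|.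
  rewrite (near_shift 0 x) subr0 /=.
  by congr (nbhs _ _); apply/funext => y /=; rewrite addrK.
apply: filterS h => y; rewrite /= mul1r.
rewrite -![(_ + _ : _ -> _) _]/(_ + _) -![(- _ : _ -> _) _]/(- _) /= opprD addrA.
move=> h; rewrite -(subrK ('d g x y) (g (y + x) - g x)).
by apply: le_trans (ler_normD _ _) _; rewrite mulrDl mul1r addrC lerD.
Qed.

Lemma Ck1_sdiff m n (D : set 'rV[R]_m) (f : 'rV[R]_m -> 'rV[R]_n) x :
  open_nbhs x D -> Ck 1 D f -> sdiff f x ('d f x).
Proof.
move=> [oD Dx] [df cf]; apply: sdiff_of_close => e e0.
have nD : nbhs x D by exact: open_nbhs_nbhs.
(* Each of the [m] partial derivatives contributes a share of [e]; the [+ 1] covers [m = 0]. *)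
have : \forall y \near x, forall i : 'I_m,
    `|'D_(delta_mx 0 i) f y - 'D_(delta_mx 0 i) f x| <= e / (m%:R + 1).
  apply: (@filter_forall _ _ (fun (i : 'I_m) y =>
    `|'D_(delta_mx 0 i) f y - 'D_(delta_mx 0 i) f x| <= e / (m%:R + 1)) (nbhs x) _) => i.
  apply: (continuous_close (cf (delta_mx 0 i) x Dx)).
  by rewrite divr_gt0 ?ltr_wpDl.
apply: filterS2 nD => y Dy hy; split; first exact: df.
move=> u; have := diff_close_rV (ltW (divr_gt0 e0 (ltr_wpDl (ler0n R m) ltr01)))
  (df _ Dx) (df _ Dy) hy u.
move/le_trans; apply; rewrite ler_wpM2r// mulrCA; apply: ler_piMr; first exact: ltW.
by rewrite ler_pdivrMr ?ltr_wpDl// mul1r lerDl.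
Qed.

Lemma Ck1_sdiff_R n (D : set R^o) (f : R^o -> 'rV[R]_n) x :
  open_nbhs x D -> Ck 1 D f -> sdiff f x ('d f x).
Proof.
move=> [oD Dx] [df cf]; apply: sdiff_of_close => e e0.
have nD : nbhs x D by exact: open_nbhs_nbhs.
have := continuous_close (cf 1 x Dx) e0.
apply: filterS2 nD => y Dy hy; split; first exact: df.
move=> u; have dE z : D z -> 'd f z u = u *: 'D_1 f z.
  move=> Dz; rewrite (deriveE _ (df z Dz)).
  have -> : u = u *: (1 : R^o) by rewrite -[RHS]/(u * 1) mulr1.
  by rewrite linearZ /= -[u *: 1]/(u * 1) mulr1.
have -> : 'd f y u - 'd f x u = u *: ('D_1 f y - 'D_1 f x).
  by rewrite scalerBr; congr (_ - _); exact: dE.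
by rewrite normrZ mulrC ler_wpM2r.
Qed.

(* Only differentiability at [x] itself of the first derivatives is needed for
   the quadratic remainder. *)
Lemma Ck2_quadratic m n (D : set 'rV[R]_m) (f : 'rV[R]_m -> 'rV[R]_n) x :
  open_nbhs x D -> Ck 2 D f -> exists2 C, 0 < C &
  \forall z \near x, `|f z - f x - 'd f x (z - x)| <= C * `|z - x| ^+ 2.
Proof.
move=> [oD Dx] [df ddf].
have hi (i : 'I_m) : exists2 C, 0 < C & \forall y \near x,
    `|'D_(delta_mx 0 i) f y - 'D_(delta_mx 0 i) f x| <= C * `|y - x|.
  by have [dg _] := ddf (delta_mx 0 i); exact: differentiable_lip (dg x Dx).
have /choice[c hc] : forall i : 'I_m, exists C : R, 0 < C /\ \forall y \near x,
    `|'D_(delta_mx 0 i) f y - 'D_(delta_mx 0 i) f x| <= C * `|y - x|.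
  by move=> i; have [C C0 hC] := hi i; exists C.
pose C := \sum_i c i.
have cC i : c i <= C.
  by rewrite /C (bigD1 i)//= lerDl sumr_ge0// => j _; rewrite ltW// (hc j).1.
have C0 : 0 <= C by rewrite sumr_ge0// => i _; rewrite ltW// (hc i).1.
exists (m%:R * C + 1); first by rewrite ltr_wpDl// mulr_ge0.
have : \forall y \near x, D y /\ forall i : 'I_m,
    `|'D_(delta_mx 0 i) f y - 'D_(delta_mx 0 i) f x| <= C * `|y - x|.
  apply: filterI; first exact: open_nbhs_nbhs.
  apply: (@filter_forall _ _ (fun (i : 'I_m) y =>
    `|'D_(delta_mx 0 i) f y - 'D_(delta_mx 0 i) f x| <= C * `|y - x|) (nbhs x) _) => i.
  apply: filterS (hc i).2 => y /le_trans; apply.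
  by rewrite ler_wpM2r.
move=> /nbhs_ballP[r r0 hr]; apply/nbhs_ballP; exists r => // z.
rewrite -ball_normE /= distrC => zr.
apply: (@mean_value _ _ f ('d f x)) => t t01.
have tz : `|x + t *: (z - x) - x| <= `|z - x|.
  rewrite addrC addrA addNr add0r normrZ; case/andP: t01 => t0 t1.
  by rewrite ger0_norm// ler_piMl.
have [Dt ht] := hr (x + t *: (z - x)) ltac:(
  by rewrite -ball_normE /= distrC; apply: le_lt_trans zr).
split; first exact: df.
apply: le_trans (diff_close_rV _ (df _ Dx) (df _ Dt) ht _) _; first by rewrite mulr_ge0.
rewrite expr2 [leRHS]mulrA; apply: ler_wpM2r; first exact: normr_ge0.
rewrite mulrA; apply: le_trans (_ : m%:R * C * `|z - x| <= _).
  by rewrite ler_wpM2l// mulr_ge0.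
by rewrite ler_wpM2r// lerDl.
Qed.

End MeanValue.

(** * Solving equations by a frozen Newton iteration *)

Section Solve.
Context {R : realType}.
Implicit Types (V W : normedModType R).

Lemma row_mx_norm_le m n (a : 'rV[R]_m) (b : 'rV[R]_n) e :
  `|a| <= e -> `|b| <= e -> `|row_mx a b| <= e.
Proof.
move=> ae be; have e0 : 0 <= e by apply: le_trans ae.
apply: rV_norm_le => // i; rewrite mxE; case: splitP => j _.
  by apply: le_trans ae; exact: coord_norm_le.
by apply: le_trans be; exact: coord_norm_le.
Qed.

(** Passage to the limit for inequalities known up to a geometrically small error, the form in which
    the limits of iterations are exploited. *)
Lemma le_geometric (a b C : R) : (forall k : nat, a <= b + C * 2^-1 ^+ k) -> a <= b.
Proof.
move=> h.
have hgeo : (fun k => C * 2^-1 ^+ k) @ \oo --> (0 : R).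
  by rewrite -(mulr0 C); apply: cvgMr; apply: cvg_expr; rewrite gtr0_norm; lra.
apply/ler_addgt0Pl => e e0.
have /cvgrPdist_le/(_ _ e0) [N _ hN] := hgeo.
have := hN N (leqnn N); rewrite /= sub0r normrN => hNN.
apply: le_trans (h N) _; rewrite addrC lerD2r.
by apply: le_trans hNN; rewrite ler_norm.
Qed.

Lemma eq0_geometric V (x : V) C : (forall k : nat, `|x| <= C * 2^-1 ^+ k) -> x = 0.
Proof.
move=> h; apply/normr0_eq0/eqP; rewrite eq_le normr_ge0 andbT.
by apply: le_geometric => k; rewrite add0r; exact: h.
Qed.

(* Newton's iteration with the derivative frozen at the base point, in the
   unknown [w] and with [a] as a parameter. *)
Lemma sdiff_solve m n (F : 'rV[R]_(m + n) -> 'rV[R]_n) La :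
  sdiff F 0 (fun z => La (lsubmx z) + rsubmx z) ->
  exists2 r, 0 < r & forall a y, `|a| < r -> `|y - F (row_mx a 0)| < r ->
    exists2 w, `|w| <= 2 * `|y - F (row_mx a 0)| & F (row_mx a w) = y.
Proof.
move=> [lL _ h].
have [U /nbhs_ballP[rho rho0 hU] hF] := h 2^-1 ltac:(by rewrite invr_gt0).
exists (rho / 4); first by rewrite divr_gt0.
move=> a y ha hy; set d := `|y - F _| in hy *.
have d0 : 0 <= d by rewrite normr_ge0.
have La0 : La 0 = 0.
  by have := linear0_fun lL; rewrite !linear0 addr0.
(* The derivative in the unknown is the identity, so the iteration map is the error term of the
   strict expansion: a contraction of ratio [1/2]. *)
have hcon w w' : `|w| <= 2 * d -> `|w'| <= 2 * d ->
    `|(w + (y - F (row_mx a w))) - (w' + (y - F (row_mx a w')))| <= 2^-1 * `|w - w'|.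
  move=> hw hw'.
  have inU v : `|v| <= 2 * d -> U (row_mx a v).
    move=> hv; apply: hU; rewrite -ball_normE /= sub0r normrN.
    apply: (@le_lt_trans _ _ (rho / 2)); last by lra.
    by apply: row_mx_norm_le; lra.
  have := hF _ _ (inU _ hw') (inU _ hw).
  rewrite opp_row_mx add_row_mx subrr row_mxKl row_mxKr La0 add0r => h1.
  have -> : (w + (y - F (row_mx a w))) - (w' + (y - F (row_mx a w'))) =
     F (row_mx a w') - F (row_mx a w) - (w' - w).
    by rewrite opprD addrACA !opprB [(y - _) + _]addrC subrKA addrC.
  apply: le_trans h1 _; rewrite ler_wpM2l ?invr_ge0//.
  apply: row_mx_norm_le; first by rewrite normr0.
  by rewrite distrC.
pose Phi w := w + (y - F (row_mx a w)).
pose w k := iter k Phi 0.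
have w1 : `|w 1%N - w 0%N| = d by rewrite /w /= /Phi add0r subr0.
have p2 (k : nat) : 0 <= (2^-1 : R) ^+ k by rewrite exprn_ge0// invr_ge0.
(* The factor [1 - 2^-k] keeps every iterate in the ball of radius [2 * d], where the contraction
   estimate holds. *)
have hw k : `|w k| <= 2 * d * (1 - 2^-1 ^+ k) /\ `|w k.+1 - w k| <= d * 2^-1 ^+ k.
  elim: k => [|k [IH1 IH2]].
    by rewrite w1 expr0 /w /= subrr mulr0 normr0 mulr1.
  have hk1 : `|w k.+1| <= 2 * d * (1 - 2^-1 ^+ k.+1).
    rewrite -(subrK (w k) (w k.+1)); apply: le_trans (ler_normD _ _) _.
    apply: le_trans (lerD IH2 IH1) _; rewrite exprS.
    by rewrite le_eqVlt; apply/orP; left; apply/eqP; field.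
  have le2d j : 2 * d * (1 - 2^-1 ^+ j) <= 2 * d.
    by apply: ler_piMr; [rewrite mulr_ge0|rewrite lerBlDr lerDl].
  split=> //.
  have := hcon (w k.+1) (w k) (le_trans hk1 (le2d _)) (le_trans IH1 (le2d _)).
  rewrite -/(Phi _) -/(Phi _) -!/(w _.+1).
  by move=> /le_trans; apply; rewrite exprS mulrCA ler_wpM2l// invr_ge0.
have [l hl] := @geometric_cvg R n w d (fun k => (hw k).2).
have hl0 : `|l| <= 2 * d by have := hl 0%N; rewrite /w /= subr0 expr0 mulr1.
exists l => //; apply/esym/eqP; rewrite -subr_eq0; apply/eqP.
apply: (@eq0_geometric _ _ (3 * d)) => k.
have -> : y - F (row_mx a l) = (Phi l - Phi (w k)) + (w k.+1 - l).
  by rewrite {1}/Phi -/(Phi _) /w /= -/w addrA subrK addrC addrA addNr add0r.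
apply: le_trans (ler_normD _ _) _.
have wk2 : `|w k| <= 2 * d.
  by apply: le_trans (hw k).1 _; apply: ler_piMr; [rewrite mulr_ge0|rewrite lerBlDr lerDl].
have h1 := hcon _ _ hl0 wk2; have h2 := hl k; have h3 := hl k.+1.
rewrite [`|w k.+1 - l|]distrC.
apply: le_trans (lerD h1 h3) _.
apply: le_trans (lerD (ler_wpM2l _ h2) (lexx _)) _; first by rewrite invr_ge0.
rewrite exprS; have := mulr_ge0 d0 (p2 k).
set t := _ ^+ k; lra.
Qed.

End Solve.

(** * Calculus on a Lie group *)

Section GroupCalculus.
Context {R : realType}.
Implicit Types (V W : normedModType R).

Lemma sdiff_row_mx V m n (f : V -> 'rV[R]_m) (g : V -> 'rV[R]_n) x L M :
  sdiff f x L -> sdiff g x M ->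
  sdiff (fun y => row_mx (f y) (g y)) x (fun u => row_mx (L u) (M u)).
Proof.
move=> [lL [C hC] hf] [lM [D hD] hg]; split=> [a u v||e e0].
- by rewrite lL lM scale_row_mx add_row_mx.
- exists (Num.max C D) => u; apply: row_mx_norm_le.
    by apply: le_trans (hC u) _; rewrite ler_wpM2r// le_max lexx.
  by apply: le_trans (hD u) _; rewrite ler_wpM2r// le_max lexx orbT.
have [U xU hU] := hf e e0; have [T xT hT] := hg e e0.
exists (U `&` T); first exact: filterI.
move=> y z [Uy Ty] [Uz Tz].
rewrite !opp_row_mx !add_row_mx; apply: row_mx_norm_le; [exact: hU|exact: hT].
Qed.

Lemma smooth_at_sdiff m n (f : 'rV[R]_m -> 'rV[R]_n) x : smooth_at f x ->
  sdiff f x ('d f x).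
Proof. by move=> [D [oD h]]; exact: Ck1_sdiff (h 1%N). Qed.

Lemma lsubmx_row_mx_norm m n (z : 'rV[R]_(m + n)) : `|lsubmx z| <= `|z|.
Proof. by apply: rV_norm_le => // i; rewrite mxE; exact: coord_norm_le. Qed.

Lemma rsubmx_row_mx_norm m n (z : 'rV[R]_(m + n)) : `|rsubmx z| <= `|z|.
Proof. by apply: rV_norm_le => // i; rewrite mxE; exact: coord_norm_le. Qed.

Lemma chart_nbhs n (M : smoothManifoldType R n) (p : M) :
  nbhs p (cdom (chart_at p)).
Proof. by apply: open_nbhs_nbhs; split; [exact: cdom_open|exact: chart_at_dom]. Qed.

Lemma cmap_nbhs n (M : topologicalType) (c : chart R n M) q : cdom c q ->
  \forall z \near cmap c q, cdom c (cinv c z) /\ cmap c (cinv c z) = z.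
Proof.
move=> cq; have : nbhs (cmap c q) (cmap c @` cdom c).
  by apply: open_nbhs_nbhs; split; [exact: cimage_open|exists q].
by apply: filterS => z [q' cq' <-]; rewrite cmapK.
Qed.

Context {n : nat} {G : lieGroupType R n}.

(** Continuity is asked separately: [cmap] is arbitrary outside its domain, so the coordinate
    expression alone does not keep [f] near [f v]. *)
Definition gsdiff V (f : V -> G) (v : V) (L : V -> 'rV[R]_n) : Prop :=
  {for v, continuous f} /\ sdiff (fun y => cmap (chart_at (f v)) (f y)) v L.

Definition mul_chart (x y : G) (z : 'rV[R]_(n + n)) : 'rV[R]_n :=
  cmap (chart_at (x * y)%g)
    (cinv (chart_at x) (lsubmx z) * cinv (chart_at y) (rsubmx z))%g.

Definition mul_chart_base (x y : G) : 'rV[R]_(n + n) :=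
  row_mx (cmap (chart_at x) x) (cmap (chart_at y) y).

Definition dmul (x y : G) : 'rV[R]_(n + n) -> 'rV[R]_n := 'd (mul_chart x y) (mul_chart_base x y).

Lemma mul_chart_sdiff (x y : G) : sdiff (mul_chart x y) (mul_chart_base x y) (dmul x y).
Proof. exact/smooth_at_sdiff/mulg_smooth. Qed.

Lemma continuous_mulg (T : topologicalType) (f g : T -> G) t :
  {for t, continuous f} -> {for t, continuous g} ->
  {for t, continuous (fun s => f s * g s)%g}.
Proof.
move=> cf cg; have := @mulg_continuous R n G (f t, g t).
apply: (@cvg_comp _ _ _ (fun s => (f s, g s)) (fun xy : G * G => (xy.1 * xy.2)%g)).
exact: cvg_pair.
Qed.

Lemma gsdiff_mul V (f g : V -> G) v L M : gsdiff f v L -> gsdiff g v M ->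
  gsdiff (fun y => f y * g y)%g v (fun u => dmul (f v) (g v) (row_mx (L u) (M u))).
Proof.
move=> [cf df] [cg dg]; split; first exact: continuous_mulg.
have h := sdiff_comp (sdiff_row_mx df dg) (mul_chart_sdiff (f v) (g v)).
apply: sdiff_near h; near=> y.
rewrite /mul_chart row_mxKl row_mxKr !cmapK//.
- by near: y; apply: cg; exact: chart_nbhs.
- by near: y; apply: cf; exact: chart_nbhs.
Unshelve. all: by end_near. Qed.

(** Freezing the left slot of [mul_chart x 1] at [x] leaves the coordinate expression of the left
    translation. *)
Lemma dmul_left (x : G) b : dmul x 1%g (row_mx 0 b) = mdiff (left_translation x) 1%g b.
Proof.
have h := sdiff_comp (sdiff_row_mx (sdiff_cst (cmap (chart_at x) x) _)
  (sdiff_id (cmap (chart_at (1%g : G)) 1%g))) (mul_chart_sdiff x 1%g).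
have [_ e] := sdiff_diff h.
rewrite -[LHS]/((fun u => dmul x 1%g (row_mx 0 u)) b) -e /mdiff.
congr ('d _ _ b); apply/funext => z.
by rewrite /mul_chart row_mxKl row_mxKr cmapK//; exact: chart_at_dom.
Qed.

Lemma dmul_right (x : G) a : dmul 1%g x (row_mx a 0) = mdiff (right_translation x) 1%g a.
Proof.
have h := sdiff_comp (sdiff_row_mx (sdiff_id (cmap (chart_at (1%g : G)) 1%g))
  (sdiff_cst (cmap (chart_at x) x) _)) (mul_chart_sdiff 1%g x).
have [_ e] := sdiff_diff h.
rewrite -[LHS]/((fun u => dmul 1%g x (row_mx u 0)) a) -e /mdiff.
congr ('d _ _ a); apply/funext => z.
by rewrite /mul_chart row_mxKl row_mxKr [cinv (chart_at x) _]cmapK//; exact: chart_at_dom.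
Qed.

Lemma dmulD (x y : G) a b : dmul x y (row_mx a b) = dmul x y (row_mx a 0) + dmul x y (row_mx 0 b).
Proof.
by have [lm _ _] := mul_chart_sdiff x y; rewrite -linearD_fun// add_row_mx addr0 add0r.
Qed.

Lemma dmul_x1 (x : G) a : dmul x 1%g (row_mx a 0) = a.
Proof.
have h := sdiff_comp (sdiff_row_mx (sdiff_id (cmap (chart_at x) x))
  (sdiff_cst (cmap (chart_at (1%g : G)) 1%g) _)) (mul_chart_sdiff x 1%g).
have h' : sdiff (fun y => y) (cmap (chart_at x) x) (fun u => dmul x 1%g (row_mx u 0)).
  apply: sdiff_near h; near=> z.
  rewrite /mul_chart row_mxKl row_mxKr [cinv (chart_at 1%g) _]cmapK; last exact: chart_at_dom.
  rewrite !mulg1; suff [] : cdom (chart_at x) (cinv (chart_at x) z) /\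
     cmap (chart_at x) (cinv (chart_at x) z) = z by [].
  by near: z; apply: cmap_nbhs; exact: chart_at_dom.
have [_ e1] := sdiff_diff h'; have [_ e2] := sdiff_diff (sdiff_id (cmap (chart_at x) x)).
by rewrite e1 in e2; rewrite -[LHS]/((fun u => dmul x 1%g (row_mx u 0)) a) e2.
Unshelve. all: by end_near. Qed.

Lemma dmul_1x (x : G) b : dmul 1%g x (row_mx 0 b) = b.
Proof.
have h := sdiff_comp (sdiff_row_mx (sdiff_cst (cmap (chart_at (1%g : G)) 1%g) _)
  (sdiff_id (cmap (chart_at x) x))) (mul_chart_sdiff 1%g x).
have h' : sdiff (fun y => y) (cmap (chart_at x) x) (fun u => dmul 1%g x (row_mx 0 u)).
  apply: sdiff_near h; near=> z.
  rewrite /mul_chart row_mxKl row_mxKr [cinv (chart_at 1%g) _]cmapK; last exact: chart_at_dom.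
  rewrite !mul1g; suff [] : cdom (chart_at x) (cinv (chart_at x) z) /\
     cmap (chart_at x) (cinv (chart_at x) z) = z by [].
  by near: z; apply: cmap_nbhs; exact: chart_at_dom.
have [_ e1] := sdiff_diff h'; have [_ e2] := sdiff_diff (sdiff_id (cmap (chart_at x) x)).
by rewrite e1 in e2; rewrite -[LHS]/((fun u => dmul 1%g x (row_mx 0 u)) b) e2.
Unshelve. all: by end_near. Qed.

(** When one factor equals 1 at the base point, the differential of the product splits into the
    differential of the other factor and a translate of a vector at the identity, as in the spanning
    condition. *)
Lemma gsdiff_mul1 V (f g : V -> G) v L M : gsdiff f v L -> gsdiff g v M -> g v = 1%g ->
  gsdiff (fun y => f y * g y)%g v
    (fun u => L u + mdiff (left_translation (f v)) 1%g (M u)).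
Proof.
move=> df dg gv; have := gsdiff_mul df dg; congr gsdiff.
by apply/funext => u; rewrite gv dmulD dmul_x1 dmul_left.
Qed.

Lemma gsdiff_1mul V (f g : V -> G) v L M : gsdiff f v L -> gsdiff g v M -> f v = 1%g ->
  gsdiff (fun y => f y * g y)%g v
    (fun u => mdiff (right_translation (g v)) 1%g (L u) + M u).
Proof.
move=> df dg fv; have := gsdiff_mul df dg; congr gsdiff.
by apply/funext => u; rewrite fv dmulD dmul_1x dmul_right.
Qed.

Lemma gsdiff_1mul1 V (f g : V -> G) v L M : gsdiff f v L -> gsdiff g v M ->
  f v = 1%g -> g v = 1%g -> gsdiff (fun y => f y * g y)%g v (fun u => L u + M u).
Proof.
move=> df dg fv gv; have := gsdiff_mul df dg; congr gsdiff.
by apply/funext => u; rewrite fv gv dmulD dmul_1x dmul_x1.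
Qed.

Lemma gsdiff_near V (f g : V -> G) v L : (\forall y \near v, f y = g y) ->
  gsdiff f v L -> gsdiff g v L.
Proof.
move=> fg [cf df]; have fgv : f v = g v by exact: nbhs_singleton fg.
split.
  have : g @ v --> f v by apply: cvg_trans cf; apply: near_eq_cvg; apply: filterS fg => y ->.
  by rewrite fgv.
by rewrite -fgv; apply: sdiff_near df; apply: filterS fg => y ->.
Qed.

Lemma gsdiff_precomp V W (h : V -> W) (f : W -> G) v L M :
  sdiff h v L -> gsdiff f (h v) M -> gsdiff (fun y => f (h y)) v (fun u => M (L u)).
Proof.
move=> dh [cf df]; split; last exact: sdiff_comp dh df.
exact: continuous_comp (sdiff_cont dh) cf.
Qed.

Lemma gsdiff_cst V (v : V) (x : G) : gsdiff (fun=> x) v (fun=> 0).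
Proof. by split; [exact: cvg_cst|exact: sdiff_cst]. Qed.

Lemma gsdiff_smooth V (f : G -> G) (g : V -> G) v L : mfd_smooth f -> gsdiff g v L ->
  gsdiff (fun y => f (g y)) v (fun u => mdiff f (g v) (L u)).
Proof.
move=> sf [cg dg]; have [cf df] := sf (g v); split; first exact: continuous_comp cg cf.
have h := sdiff_comp dg (smooth_at_sdiff df).
apply: sdiff_near h; near=> y.
rewrite cmapK//.
by near: y; apply: cg; exact: chart_nbhs.
Unshelve. all: by end_near. Qed.

End GroupCalculus.

(** * One-parameter subgroups *)

Section LocalGroup.
Context {R : realType} {n : nat} {G : lieGroupType R n}.
Implicit Types (x y q : G) (r e : R).

(** Coordinates centred at the identity, in which multiplication is close to addition. *)
Definition lg (q : G) : 'rV[R]_n := cmap (chart_at (1%g : G)) q - cmap (chart_at (1%g : G)) 1%g.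

Definition lgball r (q : G) : Prop := cdom (chart_at (1%g : G)) q /\ `|lg q| < r.

Lemma lg1 : lg 1%g = 0. Proof. exact: subrr. Qed.

Lemma lg_inj q q' : cdom (chart_at (1%g : G)) q -> cdom (chart_at (1%g : G)) q' ->
  lg q = lg q' -> q = q'.
Proof.
by move=> dq dq' /addIr e; rewrite -(cmapK dq) -(cmapK dq') e.
Qed.

Lemma lgball1 r : 0 < r -> lgball r 1%g.
Proof. by move=> r0; split; [exact: chart_at_dom|rewrite lg1 normr0]. Qed.

Lemma lgball_le r r' q : r <= r' -> lgball r q -> lgball r' q.
Proof. by move=> rr [dq h]; split => //; exact: lt_le_trans rr. Qed.

Lemma nbhs_lgball r : 0 < r -> nbhs (1%g : G) (lgball r).
Proof.
move=> r0; apply: filterI; first exact: chart_nbhs.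
have c1 := cmap_continuous (chart_at_dom (1%g : G)).
have /cvgrPdist_lt/(_ _ r0) := c1.
by apply: filterS => q; rewrite distrC.
Qed.

Lemma lgball_sub (P : set G) : nbhs (1%g : G) P -> exists2 r, 0 < r & lgball r `<=` P.
Proof.
move=> nP; have c1 := cinv_continuous (chart_at_dom (1%g : G)).
have : nbhs (cmap (chart_at (1%g : G)) 1%g) (cinv (chart_at (1%g : G)) @^-1` P).
  by apply: c1; rewrite cmapK//; exact: chart_at_dom.
move=> /nbhs_ballP[r r0 hr]; exists r => // q [dq hq].
rewrite -(cmapK dq); apply: hr.
by rewrite -ball_normE /= distrC.
Qed.

(** The centred inverse chart, a first-order substitute for the exponential map. *)
Definition exq (z : 'rV[R]_n) : G :=
  cinv (chart_at (1%g : G)) (cmap (chart_at (1%g : G)) 1%g + z).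

Lemma lg_exq : exists2 r, 0 < r & forall z, `|z| < r ->
  cdom (chart_at (1%g : G)) (exq z) /\ lg (exq z) = z.
Proof.
have := cmap_nbhs (chart_at_dom (1%g : G)).
move=> /nbhs_ballP[r r0 hr]; exists r => // z zr.
have [|h1 h2] := hr (cmap (chart_at (1%g : G)) 1%g + z).
  by rewrite -ball_normE /= opprD addrA subrr sub0r normrN.
by split=> //; rewrite /lg /exq h2 addrC addKr.
Qed.

(** The differential of the product at [(1, 1)] is the sum of the two arguments; strictness makes
    the deviation from addition Lipschitz with small constant. *)
Lemma mul_est e : 0 < e -> exists2 r, 0 < r &
  (forall x y, lgball r x -> lgball r y -> cdom (chart_at (1%g : G)) (x * y)%g) /\
  (forall x x' y y', lgball r x -> lgball r x' -> lgball r y -> lgball r y' ->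
   `|lg (x * y)%g - lg (x' * y')%g - (lg x - lg x' + (lg y - lg y'))|
     <= e * (`|lg x - lg x'| + `|lg y - lg y'|)).
Proof.
move=> e0.
have [_ _ /(_ e e0)[U /nbhs_ballP[r1 r10 hU] hm]] := mul_chart_sdiff (1%g : G) 1%g.
have cm := @mulg_continuous R n G (1%g, 1%g).
have : nbhs ((1%g : G), (1%g : G)) ((fun xy : G * G => (xy.1 * xy.2)%g) @^-1` cdom (chart_at (1%g : G))).
  by apply: cm; rewrite /= mulg1; exact: chart_nbhs.
move=> [[P Q] /= [nP nQ] hPQ].
have [r2 r20 hr2] := lgball_sub (filterI nP nQ).
exists (Num.min r1 r2); first by rewrite lt_min r10.
have m1 : Num.min r1 r2 <= r1 by rewrite ge_min lexx.
have m2 : Num.min r1 r2 <= r2 by rewrite ge_min lexx orbT.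
split=> [x y hx hy|x x' y y' hx hx' hy hy'].
  have [Px _] := hr2 _ (lgball_le m2 hx); have [_ Qy] := hr2 _ (lgball_le m2 hy).
  by have := hPQ (x, y); apply.
have subE q q' : cmap (chart_at (1%g : G)) q - cmap (chart_at (1%g : G)) q' = lg q - lg q'.
  by rewrite /lg opprB subrKA.
have inU q q' : lgball (Num.min r1 r2) q -> lgball (Num.min r1 r2) q' ->
    U (row_mx (cmap (chart_at (1%g : G)) q) (cmap (chart_at (1%g : G)) q')).
  move=> [_ hq] [_ hq']; apply: hU; rewrite -ball_normE /= distrC /mul_chart_base.
  rewrite opp_row_mx add_row_mx.
  apply: (@le_lt_trans _ _ (Num.max `|lg q| `|lg q'|)).
    by apply: row_mx_norm_le; rewrite le_max lexx ?orbT.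
  by apply: lt_le_trans m1; rewrite gt_max hq hq'.
have := hm _ _ (inU _ _ hx hy) (inU _ _ hx' hy').
rewrite opp_row_mx add_row_mx dmulD dmul_x1 dmul_1x /mul_chart !row_mxKl !row_mxKr.
case: hx hx' hy hy' => [dx _] [dx' _] [dy _] [dy' _].
rewrite !cmapK// mulg1 !subE; move/le_trans; apply.
rewrite ler_wpM2l//; first exact: ltW.
by apply: row_mx_norm_le; rewrite ?lerDl ?lerDr.
Qed.

(** Second-order information, needed for convergence: an error of size [h ^ 2] repeated about
    [1 / h] times is of size [h], which is summable over dyadic [h], while an error merely small
    compared with [h] would not suffice. *)
Lemma mul_quad : exists2 C, 0 < C & exists2 r, 0 < r & forall y, lgball r y ->
  `|lg (y * y)%g - 2 *: lg y| <= C * `|lg y| ^+ 2.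
Proof.
have [D [oD hD]] := mulg_smooth (1%g : G) (1%g : G).
have [C C0 /nbhs_ballP[r r0 hr]] := Ck2_quadratic oD (hD 2%N).
exists C => //; exists r => // y [dy hy].
pose z := row_mx (cmap (chart_at (1%g : G)) y) (cmap (chart_at (1%g : G)) y).
have hz : `|z - mul_chart_base (1%g : G) (1%g : G)| <= `|lg y|.
  by rewrite opp_row_mx add_row_mx; exact: row_mx_norm_le.
have h : `|mul_chart (1%g : G) 1%g z - mul_chart (1%g : G) 1%g (mul_chart_base (1%g : G) 1%g)
    - dmul (1%g : G) 1%g (z - mul_chart_base (1%g : G) 1%g)|
    <= C * `|z - mul_chart_base (1%g : G) 1%g| ^+ 2.
  by apply: hr; rewrite -ball_normE /= distrC; exact: le_lt_trans hz hy.
have e1 : mul_chart (1%g : G) 1%g z = cmap (chart_at (1%g : G)) (y * y)%g.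
  by rewrite /mul_chart row_mxKl row_mxKr cmapK// mulg1.
have e2 : mul_chart (1%g : G) 1%g (mul_chart_base (1%g : G) 1%g)
    = cmap (chart_at (1%g : G)) 1%g.
  by rewrite /mul_chart row_mxKl row_mxKr cmapK ?mulg1//; exact: chart_at_dom.
have e3 : z - mul_chart_base (1%g : G) 1%g = row_mx (lg y) (lg y).
  by rewrite opp_row_mx add_row_mx.
have e4 : dmul (1%g : G) 1%g (row_mx (lg y) (lg y)) = 2 *: lg y.
  by rewrite dmulD dmul_x1 dmul_1x scaler_nat mulr2n.
move: h; rewrite e1 e2 {1}e3 e4 -/(lg _) => /le_trans; apply.
by rewrite ler_wpM2l ?(ltW C0)// lerXn2r ?nnegrE.
Qed.

(** A radius at which the deviation from addition has constant [1/2], so that multiplication is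
    Lipschitz with constant [3 / 2]. *)
Definition lggood r : Prop := [/\ 0 < r,
  (forall x y, lgball r x -> lgball r y -> cdom (chart_at (1%g : G)) (x * y)%g) &
  (forall x x' y y', lgball r x -> lgball r x' -> lgball r y -> lgball r y' ->
   `|lg (x * y)%g - lg (x' * y')%g - (lg x - lg x' + (lg y - lg y'))|
     <= 2^-1 * (`|lg x - lg x'| + `|lg y - lg y'|))].

Lemma lggood_ex : exists r, lggood r.
Proof.
have [|r r0 [h1 h2]] := @mul_est 2^-1; first by rewrite invr_gt0.
by exists r; split.
Qed.

Lemma lggood_le r r' : lggood r -> 0 < r' -> r' <= r -> lggood r'.
Proof.
move=> [r0 h1 h2] r0' rr; split=> //.
  by move=> x y hx hy; apply: h1; exact: lgball_le rr _.
by move=> x x' y y' hx hx' hy hy'; apply: h2; exact: lgball_le rr _.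
Qed.

Lemma mul_est_right e r :
  (forall x x' y y', lgball r x -> lgball r x' -> lgball r y -> lgball r y' ->
   `|lg (x * y)%g - lg (x' * y')%g - (lg x - lg x' + (lg y - lg y'))|
     <= e * (`|lg x - lg x'| + `|lg y - lg y'|)) -> 0 < r ->
  forall x y, lgball r x -> lgball r y ->
    `|lg (x * y)%g - lg x - lg y| <= e * `|lg y|.
Proof.
move=> h r0 x y hx hy; have := h x x y 1%g hx hx hy (lgball1 r0).
by rewrite mulg1 lg1 subr0 subrr normr0 !add0r.
Qed.

Lemma mul_lip r : lggood r -> forall x x' y y',
  lgball r x -> lgball r x' -> lgball r y -> lgball r y' ->
  `|lg (x * y)%g - lg (x' * y')%g| <= 3 / 2 * (`|lg x - lg x'| + `|lg y - lg y'|).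
Proof.
move=> [r0 _ h] x x' y y' hx hx' hy hy'.
rewrite -(subrK (lg x - lg x' + (lg y - lg y')) (lg (x * y)%g - lg (x' * y')%g)).
apply: le_trans (ler_normD _ _) _.
have := h _ _ _ _ hx hx' hy hy'; have := ler_normD (lg x - lg x') (lg y - lg y').
lra.
Qed.

(** Each further factor [y] moves the coordinates by at most [3 / 2] times the size of [y], so the
    powers stay in the good ball as long as the accumulated bound does. *)
Lemma pow_ball r y (N : nat) : lggood r -> cdom (chart_at (1%g : G)) y ->
  3 / 2 * N%:R * `|lg y| < r -> forall j, (j <= N)%N ->
  lgball r (y ^+ j)%g /\ `|lg (y ^+ j)%g| <= 3 / 2 * j%:R * `|lg y|.
Proof.
move=> [r0 h1 h2] dy hN; elim=> [|j IH] jN.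
  by rewrite expg0 lg1 normr0 mulr0 mul0r; split=> //; exact: lgball1.
have [bj hj] := IH (ltnW jN).
have yr : `|lg y| < r.
  apply: le_lt_trans hN; apply: ler_peMl; first exact: normr_ge0.
  have : (1 : R) <= N%:R by rewrite ler1n; exact: leq_ltn_trans jN.
  lra.
have h := mul_est_right h2 r0 bj (conj dy yr).
have hj1 : `|lg (y ^+ j.+1)%g| <= 3 / 2 * j.+1%:R * `|lg y|.
  rewrite expgSr -[lg _](subrK (lg (y ^+ j)%g + lg y)).
  apply: le_trans (ler_normD _ _) _; rewrite opprD addrA.
  have := ler_normD (lg (y ^+ j)%g) (lg y).
  rewrite -natr1; lra.
split=> //; split; first by rewrite expgSr; exact: h1.
apply: le_lt_trans hj1 _; apply: le_lt_trans hN.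
by rewrite ler_wpM2r// ler_wpM2l ?ler_nat// divr_ge0.
Qed.

(** The relative error of one multiplication adds up over the factors and stays relative, uniformly
    in [N]. This identifies the tangent vector of the limit curve. *)
Lemma pow_lin e : 0 < e -> exists2 r, 0 < r & forall y (N : nat),
  cdom (chart_at (1%g : G)) y -> 3 / 2 * N%:R * `|lg y| < r ->
  `|lg (y ^+ N)%g - N%:R *: lg y| <= e * N%:R * `|lg y|.
Proof.
move=> e0; have [r1 hr1] := lggood_ex; have [r2 r20 [_ hr2]] := mul_est e0.
pose r := Num.min r1 r2; have r0 : 0 < r by rewrite lt_min r20; case: hr1 => ->.
have rr1 : r <= r1 by rewrite ge_min lexx.
have rr2 : r <= r2 by rewrite ge_min lexx orbT.
have gr := lggood_le hr1 r0 rr1.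
exists r => // y N dy hN.
have hb := pow_ball gr dy hN.
suff H j : (j <= N)%N -> `|lg (y ^+ j)%g - j%:R *: lg y| <= e * j%:R * `|lg y| by exact: H.
elim: j => [|j IH] jN; first by rewrite expg0 lg1 scale0r subrr normr0 mulr0 mul0r.
have [bj _] := hb j (ltnW jN).
have b1 : lgball r y by have [] := hb 1%N (leq_ltn_trans (leq0n _) jN); rewrite expg1.
have := mul_est_right hr2 r20 (lgball_le rr2 bj) (lgball_le rr2 b1).
rewrite -expgSr => h; have := IH (ltnW jN) => hI.
have -> : lg (y ^+ j.+1)%g - j.+1%:R *: lg y =
  (lg (y ^+ j.+1)%g - lg (y ^+ j)%g - lg y) + (lg (y ^+ j)%g - j%:R *: lg y).
  by rewrite -natr1 scalerDl scale1r opprD addrA [X in _ = X + (_ - _)]addrAC subrKA [LHS]addrAC.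
apply: le_trans (ler_normD _ _) _; rewrite -natr1; lra.
Qed.

(** Telescoping through the mixed products of [a ^+ j] and [b ^+ (N - j)]. Exchanging one factor
    costs two multiplications, each Lipschitz with constant [3 / 2], whence [9 / 4]. *)
Lemma pow_tel r : lggood r -> forall a b (N : nat) m, cdom (chart_at (1%g : G)) a ->
  cdom (chart_at (1%g : G)) b -> `|lg a| <= m -> `|lg b| <= m -> 3 / 2 * N%:R * m < r ->
  `|lg (a ^+ N)%g - lg (b ^+ N)%g| <= 9 / 4 * N%:R * `|lg a - lg b|.
Proof.
move=> gr a b N m da db am bm hN.
have c0 : 0 <= 3 / 2 * N%:R :> R by rewrite mulr_ge0// divr_ge0.
have hba := pow_ball gr da (le_lt_trans (ler_wpM2l c0 am) hN).
have hbb := pow_ball gr db (le_lt_trans (ler_wpM2l c0 bm) hN).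
suff H j : (j <= N)%N ->
   `|lg (a ^+ j * b ^+ (N - j))%g - lg (b ^+ N)%g| <= 9 / 4 * j%:R * `|lg a - lg b|.
  by have := H N (leqnn N); rewrite subnn expg0 mulg1.
elim: j => [|j IH] jN.
  by rewrite expg0 mul1g subn0 subrr normr0 mulr0 mul0r.
have hj := IH (ltnW jN).
have N0 : (0 < N)%N by exact: leq_ltn_trans jN.
have ba : lgball r a by have [] := hba 1%N N0; rewrite expg1.
have bb : lgball r b by have [] := hbb 1%N N0; rewrite expg1.
have [bj _] := hba j (ltnW jN).
have [bj1 _] := hba j.+1 jN; rewrite expgSr in bj1.
have [bw _] := hbb (N - j.+1)%N (leq_subr _ _).
have [r0 h1 h2] := gr.
have baj : lgball r (a ^+ j * b)%g.
  split; first exact: h1.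
  have h := mul_est_right h2 r0 bj bb.
  rewrite -[lg _](subrK (lg (a ^+ j)%g + lg b)).
  apply: le_lt_trans (ler_normD _ _) _; rewrite opprD addrA.
  have h3 := ler_normD (lg (a ^+ j)%g) (lg b).
  have [_ h4] := hba j (ltnW jN).
  apply: (@le_lt_trans _ _ (3 / 2 * j%:R * m + 3 / 2 * m)).
    have : 3 / 2 * j%:R * `|lg a| <= 3 / 2 * j%:R * m.
      by rewrite ler_wpM2l// mulr_ge0// divr_ge0.
    lra.
  apply: le_lt_trans hN.
  have m0 : 0 <= m by apply: le_trans am.
  have : j.+1%:R * m <= N%:R * m by rewrite ler_wpM2r// ler_nat.
  rewrite -natr1; lra.
have k1 := mul_lip gr bj bj ba bb.
have k2 := mul_lip gr bj1 baj bw bw.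
have -> : (a ^+ j.+1 * b ^+ (N - j.+1))%g = (a ^+ j * a * b ^+ (N - j.+1))%g.
  by rewrite expgSr.
rewrite -(subrK (lg (a ^+ j * b ^+ (N - j))%g) (lg (a ^+ j * a * _)%g)) -addrA.
apply: le_trans (ler_normD _ _) _.
have e1 : (a ^+ j * b ^+ (N - j))%g = (a ^+ j * b * b ^+ (N - j.+1))%g.
  by rewrite subnS -mulgA -expgS prednK// subn_gt0.
rewrite {1}e1; move: k1 k2; rewrite !subrr normr0 => k1 k2.
rewrite -natr1; lra.
Qed.

End LocalGroup.

(** * Local one-parameter subgroups as limits of dyadic powers *)

Section Euler.
Context {R : realType} {n : nat} {G : lieGroupType R n}.
Implicit Types (t s : R).

Lemma truncnD_bool (x y : R) : 0 <= x -> 0 <= y ->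
  exists b : bool, Num.truncn (x + y) = (Num.truncn x + Num.truncn y + b)%N.
Proof.
move=> x0 y0; have /andP[h1 h2] := truncn_itv x0; have /andP[h3 h4] := truncn_itv y0.
rewrite -natr1 in h2; rewrite -natr1 in h4.
have [h|h] := leP ((Num.truncn x)%:R + (Num.truncn y)%:R + 1) (x + y).
  by exists true; apply: truncn_def; rewrite addn1 -!natr1 natrD; apply/andP; split; lra.
by exists false; apply: truncn_def; rewrite addn0 -!natr1 natrD; apply/andP; split; lra.
Qed.

(** An Euler scheme: [g t] is the limit of [y k ^+ N k t], where [y k] has coordinates [2^-k *: v]
    and [N k t] is the integer part of [t * 2 ^+ k]. Integer parts are additive up to 0 or 1, so
    additivity in [t] survives in the limit. Times are confined to [[0, 1]] so that all powers stay
    in one coordinate ball. *)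
Lemma euler_local : exists2 rho, 0 < rho & forall v : 'rV[R]_n, `|v| <= rho ->
  exists g : R -> G,
    (forall t s, 0 <= t -> 0 <= s -> t + s <= 1 -> g (t + s) = (g t * g s)%g) /\
    (forall e, 0 < e -> exists2 d, 0 < d & forall t, 0 <= t -> t <= d -> t <= 1 ->
       cdom (chart_at (1%g : G)) (g t) /\ `|lg (g t) - t *: v| <= e * t).
Proof.
have [r gr] := @lggood_ex R n G.
have [C C0 [r2 r20 hC]] := @mul_quad R n G.
have [r1 r10 hex] := @lg_exq R n G.
have r0 : 0 < r by case: gr.
(* The division by 4 leaves room for the powers, whose coordinates reach [3 / 2] times the size of
   [v]. *)
pose rho := Num.min r (Num.min r1 r2) / 4.
have rho0 : 0 < rho by rewrite divr_gt0// !lt_min r0 r10.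
have hr : 4 * rho <= r by rewrite /rho mulrC divfK// ge_min lexx.
have hr1 : 4 * rho <= r1 by rewrite /rho mulrC divfK// !ge_min lexx orbT.
have hr2 : 4 * rho <= r2 by rewrite /rho mulrC divfK// !ge_min lexx !orbT.
exists rho => // v hv.
have v0 : 0 <= `|v| by exact: normr_ge0.
pose h k : R := 2^-1 ^+ k.
have h0 k : 0 < h k by rewrite exprn_gt0// invr_gt0.
have hS k : h k.+1 = 2^-1 * h k by rewrite /h exprS.
have h1 k : h k <= 1 by rewrite exprn_ile1// ?invr_ge0// invf_le1// ler1n.
have hK k : 2 ^+ k * h k = 1 by rewrite -exprMn divff// expr1n.
pose y k : G := exq (h k *: v).
have hy k : cdom (chart_at (1%g : G)) (y k) /\ lg (y k) = h k *: v.
  apply: hex; rewrite normrZ gtr0_norm//.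
  apply: (@le_lt_trans _ _ `|v|); last by lra.
  by rewrite ler_piMl.
have ny k : `|lg (y k)| = h k * `|v| by rewrite (hy k).2 normrZ gtr0_norm.
pose N k t := Num.truncn (t * 2 ^+ k).
have Nh k t : 0 <= t -> (N k t)%:R * h k <= t /\ t <= (N k t)%:R * h k + h k.
  move=> t0; have /truncn_itv/andP[k1 k2] : 0 <= t * 2 ^+ k by rewrite mulr_ge0 ?exprn_ge0.
  have e : t = t * 2 ^+ k * h k by rewrite -mulrA hK mulr1.
  split; first by have := ler_wpM2r (ltW (h0 k)) k1; rewrite -e.
  by have := ler_wpM2r (ltW (h0 k)) (ltW k2); rewrite -e -natr1 mulrDl mul1r.
pose g k t := (y k ^+ N k t)%g.
have b1 k M : M%:R * h k <= 1 -> 3 / 2 * M%:R * `|lg (y k)| < r.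
  move=> hM; rewrite ny -mulrA [M%:R * _]mulrA.
  have : M%:R * h k * `|v| <= `|v| by rewrite ler_piMl.
  lra.
have hg k t : 0 <= t -> t <= 1 -> lgball r (g k t) /\ `|lg (g k t)| <= 3 / 2 * `|v|.
  move=> t0 t1; have [k1 k2] := Nh k t t0.
  have [a1 a2] := pow_ball gr (hy k).1 (b1 k _ (le_trans k1 t1)) (leqnn _).
  split=> //; apply: le_trans a2 _; rewrite ny -mulrA ler_wpM2l// ?divr_ge0// mulrA.
  by rewrite ler_piMl// (le_trans k1).
have yb k (b : bool) : lgball r (y k ^+ b)%g /\ `|lg (y k ^+ b)%g| <= h k * `|v|.
  case: b; last by rewrite expg0 lg1 normr0 mulr_ge0// ?ltW//; split => //; exact: lgball1.
  rewrite expg1 ny; split=> //; split; first exact: (hy k).1.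
  rewrite ny; apply: (@le_lt_trans _ _ `|v|); last by lra.
  by rewrite ler_piMl.
have mulb k (b : bool) x : lgball r x -> `|lg (x * y k ^+ b)%g - lg x| <= 3 / 2 * (h k * `|v|).
  move=> bx; have [yb1 yb2] := yb k b.
  have := mul_lip gr bx bx yb1 (lgball1 r0).
  rewrite mulg1 subrr normr0 add0r lg1 subr0 => /le_trans; apply.
  by rewrite ler_wpM2l// divr_ge0.
(* The first term is the squaring error of [y k.+1], carried through [N k t] factors; the second is
   the extra factor [y k.+1] present when the integer part at level [k.+1] is odd. *)
pose C' := 9 / 16 * C * `|v| ^+ 2 + 3 / 4 * `|v|.
have C'0 : 0 <= C' by rewrite addr_ge0// !mulr_ge0// ltW.
have hstep t : 0 <= t -> t <= 1 -> forall k, `|lg (g k.+1 t) - lg (g k t)| <= C' * 2^-1 ^+ k.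
  move=> t0 t1 k; have [k1 k2] := Nh k t t0.
  have tk0 : 0 <= t * 2 ^+ k by rewrite mulr_ge0// exprn_ge0.
  have [b eb] := truncnD_bool tk0 tk0.
  have eN : N k.+1 t = (2 * N k t + b)%N.
    by rewrite /N exprS mul2n -addnn -eb; congr Num.truncn; ring.
  have eg : g k.+1 t = ((y k.+1 ^+ 2) ^+ N k t * y k.+1 ^+ b)%g.
    by rewrite /g eN expgnDr expgnA.
  have b2 : 3 / 2 * 2%:R * `|lg (y k.+1)| < r.
    by apply: b1; rewrite hS mulrA divff// mul1r.
  have [bq hq] := pow_ball gr (hy k.+1).1 b2 (leqnn _).
  have bq2 : lgball r ((y k.+1 ^+ 2) ^+ N k t)%g.
    rewrite -expgnA.
    have bb : 3 / 2 * (2 * N k t)%N%:R * `|lg (y k.+1)| < r.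
      apply: b1; rewrite hS natrM; apply: le_trans t1; apply: le_trans k1.
      by rewrite le_eqVlt; apply/orP; left; apply/eqP; field.
    by have [] := pow_ball gr (hy k.+1).1 bb (leqnn _).
  have q1 : `|lg (y k.+1 ^+ 2)%g - lg (y k)| <= C * (h k * `|v| / 2) ^+ 2.
    have by2 : lgball r2 (y k.+1).
      split; first exact: (hy _).1.
      rewrite ny; apply: (@le_lt_trans _ _ `|v|); last by lra.
      by rewrite ler_piMl.
    have := hC _ by2; rewrite -expg2 ny hS (hy k).2 (hy k.+1).2 hS scalerA mulrA divff// mul1r.
    by move/le_trans; apply; rewrite le_eqVlt; apply/orP; left; apply/eqP; field.
  have q2 : `|lg (y k.+1 ^+ 2 ^+ N k t)%g - lg (g k t)| <= 9 / 4 * (N k t)%:R * `|lg (y k.+1 ^+ 2)%g - lg (y k)|.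
    apply: (pow_tel gr bq.1 (hy k).1 (m := 3 / 2 * (h k * `|v|))).
    - by apply: le_trans hq _; rewrite ny hS; have := mulr_ge0 (ltW (h0 k)) v0; lra.
    - by rewrite ny; have := mulr_ge0 (ltW (h0 k)) v0; lra.
    - have : (N k t)%:R * h k * `|v| <= `|v| by rewrite ler_piMl// (le_trans k1).
      lra.
  have q3 := mulb k.+1 b _ bq2.
  rewrite eg -(subrKA (lg ((y k.+1 ^+ 2) ^+ N k t)%g)).
  apply: le_trans (ler_normD _ _) _; apply: le_trans (lerD q3 q2) _.
  have q4 : 9 / 4 * (N k t)%:R * `|lg (y k.+1 ^+ 2)%g - lg (y k)|
      <= 9 / 16 * C * `|v| ^+ 2 * h k.
    apply: le_trans (ler_wpM2l _ q1) _; first by rewrite mulr_ge0// divr_ge0.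
    have p : 0 <= C * `|v| ^+ 2 * h k by rewrite !mulr_ge0// ltW.
    have := ler_wpM2r p (le_trans k1 t1); rewrite mul1r; lra.
  rewrite hS -/(h k) /C' mulrDl; lra.
have /choice[l hl] : forall t, exists l : 'rV[R]_n, 0 <= t -> t <= 1 ->
    forall k, `|l - lg (g k t)| <= 2 * C' * h k.
  move=> t; have [t0|] := leP 0 t; last by exists 0.
  have [t1|] := leP t 1; last by exists 0.
  by have [l hl] := geometric_cvg (hstep t t0 t1); exists l.
have hl32 t : 0 <= t -> t <= 1 -> `|l t| <= 3 / 2 * `|v|.
  move=> t0 t1; apply: (@le_geometric _ _ _ (2 * C')) => k.
  rewrite -(subrK (lg (g k t)) (l t)) addrC; apply: le_trans (ler_normD _ _) _.
  by apply: lerD (hl t t0 t1 k); have [] := hg k t t0 t1.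
have hG t : 0 <= t -> t <= 1 -> lgball r (exq (l t) : G) /\ lg (exq (l t) : G) = l t.
  move=> t0 t1; have h2 := hl32 t t0 t1.
  have [] := hex (l t); first by lra.
  by move=> h3 h4; split=> //; split=> //; rewrite h4; lra.
exists (fun t => exq (l t)); split.
- move=> t s t0 s0 ts1.
  have t1 : t <= 1 by lra. have s1 : s <= 1 by lra. have ts0 : 0 <= t + s by lra.
  have [bt et] := hG t t0 t1; have [bs es] := hG s s0 s1; have [bts ets] := hG _ ts0 ts1.
  apply: lg_inj; [exact: bts.1|by case: gr => _ + _; apply|].
  apply/eqP; rewrite -subr_eq0; apply/eqP.
  apply: (@eq0_geometric _ _ _ (2 * C' + 3 / 2 * (2 * C' + 2 * C') + 3 / 2 * `|v|)) => k.
  have [bgt _] := hg k t t0 t1; have [bgs _] := hg k s s0 s1.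
  (* At level [k] additivity fails by at most one factor [y k], which tends to 1. *)
  have [b eb] : exists b : bool, g k (t + s) = (g k t * g k s * y k ^+ b)%g.
    have [b eb] := @truncnD_bool (t * 2 ^+ k) (s * 2 ^+ k)
      ltac:(by rewrite mulr_ge0// exprn_ge0) ltac:(by rewrite mulr_ge0// exprn_ge0).
    by exists b; rewrite /g -!expgnDr /N mulrDl eb.
  have bgts : lgball r (g k t * g k s)%g.
    have k1 := (Nh k t t0).1; have k2 := (Nh k s s0).1.
    rewrite /g -expgnDr.
    have bb : 3 / 2 * (N k t + N k s)%N%:R * `|lg (y k)| < r.
      by apply: b1; rewrite natrD mulrDl; lra.
    by have [] := pow_ball gr (hy k).1 bb (leqnn _).
  have q1 := mulb k b _ bgts; rewrite -eb in q1.
  have q2 := hl _ ts0 ts1 k.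
  have q3 := mul_lip gr bgt bt bgs bs.
  rewrite et es [`|_ - l t|]distrC [`|_ - l s|]distrC in q3.
  have q4 := hl _ t0 t1 k; have q5 := hl _ s0 s1 k.
  rewrite ets.
  have -> : l (t + s) - lg (exq (l t) * exq (l s) : G)%g =
    (l (t + s) - lg (g k (t + s))) + (lg (g k (t + s)) - lg (g k t * g k s)%g)
    + (lg (g k t * g k s)%g - lg (exq (l t) * exq (l s) : G)%g).
    by rewrite !subrKA.
  apply: le_trans (ler_normD _ _) _; apply: le_trans (lerD (ler_normD _ _) (lexx _)) _.
  rewrite -/(h k); lra.
- move=> e e0; pose e' := e / (`|v| + 1).
  have e'0 : 0 < e' by rewrite divr_gt0// ltr_wpDl.
  have ev : e' * `|v| <= e.
    by rewrite /e' mulrAC ler_pdivrMr ?ltr_wpDl// ler_wpM2l ?(ltW e0)// lerDl.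
  have [d d0 hd] := @pow_lin R n G e' e'0.
  exists (d / (2 * (`|v| + 1))); first by rewrite divr_gt0// mulr_gt0// ltr_wpDl.
  move=> t t0 td t1; have [bt et] := hG t t0 t1; split; first exact: bt.1.
  rewrite et; apply: (@le_geometric _ _ _ (2 * C' + `|v|)) => k.
  have [k1 k2] := Nh k t t0.
  have tv : t * `|v| <= t * (`|v| + 1) by rewrite ler_wpM2l// lerDl.
  have td' : t * (`|v| + 1) <= d / 2.
    by move: td; rewrite invfM mulrA ler_pdivlMr// ltr_wpDl.
  have bb : 3 / 2 * (N k t)%:R * `|lg (y k)| < d.
    rewrite ny -mulrA [(N k t)%:R * _]mulrA.
    have := ler_wpM2r v0 k1; lra.
  have q1 := hd _ _ (hy k).1 bb.
  rewrite -/(g k t) (hy k).2 scalerA normrZ (gtr0_norm (h0 k)) in q1.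
  have q2 := hl t t0 t1 k.
  have -> : l t - t *: v = (l t - lg (g k t)) + (lg (g k t) - ((N k t)%:R * h k) *: v)
     + ((N k t)%:R * h k - t) *: v by rewrite scalerBl !subrKA.
  apply: le_trans (ler_normD _ _) _; apply: le_trans (lerD (ler_normD _ _) (lexx _)) _.
  rewrite normrZ ler0_norm; last by lra.
  have q3 : - ((N k t)%:R * h k - t) * `|v| <= h k * `|v| by rewrite ler_wpM2r//; lra.
  have q4 : e' * (N k t)%:R * (h k * `|v|) <= e * t.
    have -> : e' * (N k t)%:R * (h k * `|v|) = (e' * `|v|) * ((N k t)%:R * h k) by ring.
    by apply: ler_pM => //; rewrite mulr_ge0// ltW.
  rewrite -/(h k); lra.
Qed.

End Euler.

(** * Extension of a local homomorphism to the whole line *)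

Section Extend.
Context {R : realType} {G : groupType}.
Implicit Types (t s : R).

Lemma maxrB t : Num.max t 0 - Num.max (- t) 0 = t.
Proof. by rewrite /Order.max; do 2 case: ifPn; rewrite -?leNgt; lra. Qed.

(** For [t >= 0] the value is the [M]-th power of [g] at [t / M], for any integer [M >= t]; two
    choices of [M] agree by subdividing further into their product. Negative times are reached by
    differences. *)
Lemma extend_hom (g : R -> G) :
  (forall t s, 0 <= t -> 0 <= s -> t + s <= 1 -> g (t + s) = (g t * g s)%g) ->
  exists2 h : R -> G, (forall t s, h (t + s) = (h t * h s)%g) &
    forall t, 0 <= t -> t <= 1 -> h t = g t.
Proof.
move=> gD.
have g0 : g 0 = 1%g.
  have := gD 0 0 (lexx 0) (lexx 0); rewrite addr0 => /(_ ler01) h.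
  by apply: (mulgI (g 0)); rewrite -h mulg1.
have gX j t : 0 <= t -> j%:R * t <= 1 -> g (j%:R * t) = (g t ^+ j)%g.
  move=> t0; elim: j => [|j IH] h; first by rewrite mul0r g0 expg0.
  have h' : j%:R * t <= 1 by apply: le_trans h; rewrite -natr1 mulrDl mul1r lerDl.
  rewrite -natr1 mulrDl mul1r gD ?IH ?expgSr//; first by rewrite mulr_ge0.
  by move: h; rewrite -natr1 mulrDl mul1r.
pose N t := (Num.truncn t).+1.
pose h t : G := (g (t / (N t)%:R)%R ^+ N t)%g.
have N0 (M : nat) : (0 < M)%N -> 0 < M%:R :> R by rewrite ltr0n.
have divK (M : nat) (t : R) : (0 < M)%N -> t = M%:R * (t / M%:R)%R.
  by move=> /N0 M0; rewrite mulrC divfK ?gt_eqF.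
have hE (M : nat) t : (0 < M)%N -> 0 <= t -> t <= M%:R -> h t = (g (t / M%:R)%R ^+ M)%g.
  have aux (M1 M2 : nat) : (0 < M1)%N -> (0 < M2)%N -> 0 <= t -> t <= M1%:R ->
      (g (t / M1%:R)%R = g (t / M1%:R / M2%:R)%R ^+ M2)%g.
    move=> p1 p2 t0 t1; rewrite -gX.
    - by rewrite -divK.
    - by rewrite !divr_ge0.
    - by rewrite -divK// ler_pdivrMr ?mul1r ?N0.
  move=> M0 t0 tM; rewrite /h (aux (N t) M)//; last by rewrite /N ltW// truncnS_gt.
  rewrite (aux M (N t))// -!expgnA mulnC; congr (_ ^+ _)%g; congr g.
  by rewrite mulrAC.
have gc t s : 0 <= t -> 0 <= s -> t + s <= 1 -> commute (g t) (g s).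
  by move=> t0 s0 ts; rewrite /commute -!gD// 1?addrC.
have hD t s : 0 <= t -> 0 <= s -> h (t + s) = (h t * h s)%g.
  move=> t0 s0; pose M := N (t + s).
  have M0 : (0 < M)%N by [].
  have ts : t + s <= M%:R by rewrite ltW// truncnS_gt.
  rewrite (hE M)//; last by rewrite addr_ge0.
  rewrite (hE M t)//; last by lra.
  rewrite (hE M s)//; last by lra.
  have t0' : 0 <= t / M%:R by rewrite divr_ge0.
  have s0' : 0 <= s / M%:R by rewrite divr_ge0.
  have ts' : t / M%:R + s / M%:R <= 1 by rewrite -mulrDl ler_pdivrMr ?mul1r ?N0.
  by rewrite -expgMn -?gD ?mulrDl//; exact: gc.
have hc t s : 0 <= t -> 0 <= s -> commute (h t) (h s).
  by move=> t0 s0; rewrite /commute -!hD// addrC.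
have hc' t s : 0 <= t -> 0 <= s -> (h s * (h t)^-1 = (h t)^-1 * h s)%g.
  by move=> t0 s0; apply: commuteV; exact: hc.
(* The positive and negative parts of [t] give one splitting; [kE] shows that every splitting of [t]
   as a difference of nonnegative numbers gives the same value. *)
pose k t : G := (h (Num.max t 0)%R * (h (Num.max (- t) 0)%R)^-1)%g.
have kE t a b : 0 <= a -> 0 <= b -> t = a - b -> k t = (h a * (h b)^-1)%g.
  move=> a0 b0 e; rewrite /k; set p := Num.max t 0; set m := Num.max (- t) 0.
  have p0 : 0 <= p by rewrite le_max lexx orbT.
  have m0 : 0 <= m by rewrite le_max lexx orbT.
  have epm : p + b = a + m.
    have := maxrB t; rewrite -/p -/m; lra.
  apply: (mulIg (h b)); rewrite mulgVK -mulgA -hc'// mulgA -hD// epm hD//.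
  by rewrite mulgK.
exists k.
  move=> t s; pose a r : R := Num.max r 0; pose b r : R := Num.max (- r) 0.
  have a0 r : 0 <= a r by rewrite le_max lexx orbT.
  have b0 r : 0 <= b r by rewrite le_max lexx orbT.
  have e r : r = a r - b r.
    by rewrite -[LHS]maxrB.
  rewrite (@kE _ (a t + a s) (b t + b s)) ?addr_ge0//; last first.
    by rewrite {1}(e t) {1}(e s) opprD addrACA.
  rewrite -/(a t) /k -/(a s) -/(b t) -/(b s) !hD// invgM.
  rewrite -!mulgA; congr (_ * _)%g; rewrite mulgA; apply: commute_sym.
  apply: commuteM; first by apply: commute_sym; apply: commuteV; exact: hc.
  by apply: commuteV; apply: commute_sym; apply: commuteV; exact: hc.
move=> t t0 t1; rewrite (@kE t t 0) ?subr0//.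
by rewrite (hE 1%N)// (hE 1%N 0)// mul0r g0 !divr1 !expg1 invg1 mulg1.
Qed.
End Extend.

(** * Existence and uniqueness of one-parameter subgroups *)

Section OneParameter.
Context {R : realType} {n : nat} {G : lieGroupType R n}.
Implicit Types (t s e : R) (v : 'rV[R]_n) (c : R -> G).

Definition one_param c v : Prop :=
  (forall t s, c (t + s) = (c t * c s)%g) /\ gsdiff c 0 (fun t : R => t *: v).

Lemma hom_R0 c : (forall t s, c (t + s) = (c t * c s)%g) -> c 0 = 1%g.
Proof. by move=> cD; apply: (mulgI (c 0)); rewrite -cD addr0 mulg1. Qed.

Lemma hom_RN c : (forall t s, c (t + s) = (c t * c s)%g) ->
  forall t, c (- t) = ((c t)^-1)%g.
Proof.
by move=> cD t; apply: (mulgI (c t)); rewrite -cD subrr hom_R0// mulgV.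
Qed.

Lemma hom_RX c : (forall t s, c (t + s) = (c t * c s)%g) ->
  forall t (N : nat), c (N%:R * t) = (c t ^+ N)%g.
Proof.
move=> cD t; elim=> [|N IH]; first by rewrite mul0r hom_R0.
by rewrite -natr1 mulrDl mul1r cD IH expgSr.
Qed.

Lemma linear_scale v : linear (fun t : R => t *: v).
Proof. by move=> a x y; rewrite scalerDl scalerA. Qed.

Lemma scale_bounded v : exists C, forall t : R, `|t *: v| <= C * `|t|.
Proof. by exists `|v| => t; rewrite normrZ mulrC. Qed.

(* The homomorphism property transports a one-sided derivative at the identity
   to a two-sided strict one. *)
Lemma hom_gsdiff0 c v : (forall t s, c (t + s) = (c t * c s)%g) ->
  (forall e, 0 < e -> exists2 d, 0 < d & forall t, 0 <= t -> t <= d ->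
     cdom (chart_at (1%g : G)) (c t) /\ `|lg (c t) - t *: v| <= e * t) ->
  gsdiff c 0 (fun t : R => t *: v).
Proof.
move=> cD hc; have c0 := hom_R0 cD.
have [d1 d10 hd1] := hc 1 ltr01.
have lipc t : 0 <= t -> t <= d1 -> `|lg (c t)| <= (`|v| + 1) * t.
  move=> t0 td; have [_ h] := hd1 t t0 td.
  rewrite -(subrK (t *: v) (lg (c t))); apply: le_trans (ler_normD _ _) _.
  by rewrite normrZ ger0_norm//; lra.
have vp : 0 < `|v| + 1 by rewrite ltr_wpDl.
have inball r : 0 < r -> exists2 d, 0 < d & forall t, 0 <= t -> t < d -> lgball r (c t).
  move=> r0; exists (Num.min d1 (r / (`|v| + 1))); first by rewrite lt_min d10 divr_gt0.
  move=> t t0; rewrite lt_min => /andP[td tr]; split; first by have [] := hd1 t t0 (ltW td).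
  apply: le_lt_trans (lipc t t0 (ltW td)) _.
  by rewrite mulrC -ltr_pdivlMr.
have cc : {for 0, continuous c}.
  move=> P; rewrite /= c0 => nP.
  have ci : nbhs (1%g : G) ((fun x : G => (x^-1)%g) @^-1` P).
    by have [+ _] := @invg_smooth R n G 1%g; apply; rewrite invg1.
  have [r r0 hr] := lgball_sub (filterI nP ci).
  have [d d0 hd] := inball r r0.
  apply/nbhs_ballP; exists d => // t; rewrite -ball_normE /= sub0r normrN => td.
  have [t0|t0] := leP 0 t.
    by have [] := hr _ (hd t t0 ltac:(by rewrite ger0_norm in td)).
  have [_] := hr _ (hd (- t) ltac:(by rewrite oppr_ge0 ltW) ltac:(by rewrite ltr0_norm in td)).
  by rewrite /= (hom_RN cD) invgK.
split=> //; rewrite c0; split; [exact: linear_scale|exact: scale_bounded|].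
move=> e e0.
pose e1 := e / 2 / (`|v| + 1); have e10 : 0 < e1 by rewrite !divr_gt0.
have [r r0 [hr1 hr2]] := @mul_est R n G e1 e10.
have [d2 d20 hd2] := inball r r0.
have [d3 d30 hd3] := hc (e / 2) ltac:(by rewrite divr_gt0).
pose D := Num.min d1 (Num.min d2 d3) / 2.
have m0 : 0 < Num.min d1 (Num.min d2 d3) by rewrite !lt_min d10 d20 d30.
have D0 : 0 < D by rewrite divr_gt0.
have D2 : 2 * D <= d2 by rewrite /D mulrC divfK// !ge_min lexx orbT.
have D3 : 2 * D <= d3 by rewrite /D mulrC divfK// !ge_min lexx !orbT.
have D1 : 2 * D <= d1 by rewrite /D mulrC divfK// !ge_min lexx.
have nr : nbhs (0 : R) (fun s : R => lgball r (c s)).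
  by apply: cc; rewrite /= c0; exact: nbhs_lgball.
exists ((fun s : R => lgball r (c s)) `&` ball (0 : R) D).
  by apply: filterI => //; exact: nbhsx_ballx.
have key s t : s <= t -> lgball r (c s) -> `|s| < D -> `|t| < D ->
    `|cmap (chart_at (1%g : G)) (c t) - cmap (chart_at (1%g : G)) (c s) - (t - s) *: v| <= e * (t - s).
  move=> st bs sD tD.
  have ts0 : 0 <= t - s by rewrite subr_ge0.
  have tsD : t - s < 2 * D.
    by move: sD tD; rewrite !ltr_norml => /andP[? _] /andP[_ ?]; lra.
  have -> : cmap (chart_at (1%g : G)) (c t) - cmap (chart_at (1%g : G)) (c s) = lg (c t) - lg (c s).
    by rewrite /lg opprB subrKA.
  have et : c t = (c s * c (t - s))%g by rewrite -cD addrC subrK.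
  have bts := hd2 (t - s) ts0 ltac:(lra).
  have q1 := mul_est_right hr2 r0 bs bts; rewrite -et in q1.
  have [_ q2] := hd3 (t - s) ts0 ltac:(lra).
  have q3 := lipc (t - s) ts0 ltac:(lra).
  rewrite -(subrKA (lg (c (t - s)))).
  apply: le_trans (ler_normD _ _) _.
  have q4 : e1 * `|lg (c (t - s))| <= e / 2 * (t - s).
    apply: le_trans (ler_wpM2l (ltW e10) q3) _.
    by rewrite mulrA /e1 divfK ?gt_eqF.
  lra.
move=> y z [by_ +] [bz +]; rewrite -!ball_normE /= !sub0r !normrN => yD zD.
have [zy|yz] := leP z y.
  by rewrite [`|y - z|]ger0_norm ?subr_ge0//; exact: key.
rewrite -normrN !opprB [`|y - z|]distrC [`|z - y|]ger0_norm ?subr_ge0 ?(ltW yz)//.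
have := key y z (ltW yz) by_ yD zD.
by rewrite -[(z - y) *: v]opprK -scaleNr opprB opprK addrC.
Qed.

(** Near [t] the curve is [c t] times its own restriction near 0. *)
Lemma hom_gsdiff c L : (forall t s, c (t + s) = (c t * c s)%g) -> gsdiff c 0 L ->
  forall t, gsdiff c t (fun u => mdiff (left_translation (c t)) 1%g (L u)).
Proof.
move=> cD dc t; have c0 := hom_R0 cD.
have ds : sdiff (fun s : R => s - t) t (fun u => u + 0) := sdiffD (sdiff_id _) (sdiff_cst _ _).
have dg : gsdiff (fun s => c (s - t)) t (fun u => L (u + 0)).
  by apply: (gsdiff_precomp ds); rewrite subrr.
have ctt : c (t - t) = 1%g by rewrite subrr.
have := gsdiff_mul1 (gsdiff_cst t (c t)) dg ctt.
have -> : (fun s => c t * c (s - t))%g = c.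
  by apply/funext => s; rewrite -cD addrC subrK.
by congr gsdiff; apply/funext => u; rewrite add0r addr0.
Qed.

(** The scheme handles small vectors only; [v] is scaled down by [a] and time sped up by [a^-1]. *)
Lemma one_param_ex v : exists c, one_param c v.
Proof.
have [rho rho0 h] := @euler_local R n G.
have vp : 0 < `|v| + 1 by rewrite ltr_wpDl.
pose a := rho / (`|v| + 1); have a0 : 0 < a by rewrite divr_gt0.
have [|g [gD dg]] := h (a *: v).
  rewrite normrZ gtr0_norm// /a mulrAC ler_pdivrMr// ler_wpM2l ?(ltW rho0)//.
  by rewrite lerDl.
have [c cD cg] := extend_hom gD.
have dc : gsdiff c 0 (fun t : R => t *: (a *: v)).
  apply: hom_gsdiff0 => // e e0; have [d d0 hd] := dg e e0.
  exists (Num.min d 1); first by rewrite lt_min d0 ltr01.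
  by move=> t t0; rewrite le_min => /andP[td t1]; rewrite cg//; exact: hd.
exists (fun t => c (a^-1 * t)); split; first by move=> t s; rewrite mulrDr cD.
have dl : sdiff (fun t : R => a^-1 * t) 0 (fun t : R => a^-1 * t).
  apply: sdiff_lin; first by move=> k x y; rewrite mulrDr; congr (_ + _); exact: mulrCA.
  by exists `|a^-1| => u; rewrite normrM.
have := gsdiff_precomp (f := c) (M := fun t : R => t *: (a *: v)) dl.
rewrite mulr0 => /(_ dc); congr gsdiff; apply/funext => t.
by rewrite scalerA mulrAC mulVf ?gt_eqF// mul1r.
Qed.

(** At time [t / N] the two curves differ by an amount small compared with [1 / N], and taking
    [N]-th powers magnifies a difference at most by a multiple of [N]. Letting [N] grow gives
    equality at small [t]. *)
Lemma one_param_unique c1 c2 v : one_param c1 v -> one_param c2 v -> c1 =1 c2.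
Proof.
move=> [h1 [k1 d1]] [h2 [k2 d2]].
have e1 := hom_R0 h1; have e2 := hom_R0 h2; rewrite e1 in d1; rewrite e2 in d2.
have [r gr] := @lggood_ex R n G; have r0 : 0 < r by case: gr.
have near0 c : (forall t s, c (t + s) = (c t * c s)%g) -> {for 0, continuous c} ->
  sdiff (fun y => cmap (chart_at (1%g : G)) (c y)) 0 (fun t : R => t *: v) ->
  (forall e, 0 < e -> exists2 d, 0 < d & forall t, `|t| < d ->
     cdom (chart_at (1%g : G)) (c t) /\ `|lg (c t) - t *: v| <= e * `|t|).
  move=> h k [_ _ dc] e e0; have [U nU hU] := dc e e0; have c0 := hom_R0 h.
  have : nbhs (0 : R) (U `&` (c @^-1` cdom (chart_at (1%g : G)))).
    by apply: filterI => //; apply: k; rewrite /= c0; exact: chart_nbhs.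
  move=> /nbhs_ballP[d d0 hd]; exists d => // t td.
  have [] := hd t ltac:(by rewrite -ball_normE /= sub0r normrN).
  move=> Ut dt; split=> //.
  by have := hU t 0 Ut (nbhs_singleton nU); rewrite c0 subr0.
have n1 := near0 c1 h1 k1 d1; have n2 := near0 c2 h2 k2 d2.
have [da da0 hda] := n1 1 ltr01; have [db db0 hdb] := n2 1 ltr01.
have vp : 0 < `|v| + 1 by rewrite ltr_wpDl.
pose K := 3 / 2 * (`|v| + 1); have K0 : 0 < K by rewrite mulr_gt0.
pose D := Num.min (r / K) (Num.min da db).
have D0 : 0 < D by rewrite !lt_min da0 db0 divr_gt0.
have Da : D <= da by rewrite !ge_min lexx orbT.
have Db : D <= db by rewrite !ge_min lexx !orbT.
have Dr : D <= r / K by rewrite !ge_min lexx.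
have small t : `|t| < D -> c1 t = c2 t.
  move=> tD; have [ca _] := hda t (lt_le_trans tD Da); have [cb _] := hdb t (lt_le_trans tD Db).
  apply: lg_inj => //; apply/eqP; rewrite -subr_eq0 -normr_le0; apply/ler_addgt0Pl => e e0.
  rewrite addr0.
  (* The comparison of powers yields [9 / 4 * 2 * e'] times the size of [t]; the 5 absorbs [9 / 2],
     and the [+ 1] covers [t = 0]. *)
  pose e' := e / (5 * (`|t| + 1)).
  have tp : 0 < `|t| + 1 by rewrite ltr_wpDl.
  have e'0 : 0 < e' by rewrite divr_gt0// mulr_gt0.
  have [dc dc0 hdc] := n1 e' e'0; have [dd dd0 hdd] := n2 e' e'0.
  pose m := Num.min dc dd; have m0 : 0 < m by rewrite lt_min dc0 dd0.
  pose N := (Num.truncn (`|t| / m)).+1.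
  have N0 : 0 < N%:R :> R by rewrite ltr0n.
  have N1 : 1 <= N%:R :> R by rewrite ler1n.
  pose s := t / N%:R.
  have es : `|s| = `|t| / N%:R by rewrite normrM normfV (gtr0_norm N0).
  have sm : `|s| < m by rewrite es ltr_pdivrMr// mulrC -ltr_pdivrMr// truncnS_gt.
  have st : `|s| <= `|t| by rewrite es ler_pdivrMr// ler_peMr.
  have tE : t = N%:R * s by rewrite mulrC divfK// gt_eqF.
  have [c1s l1] := hda s (le_lt_trans st (lt_le_trans tD Da)).
  have [c2s l2] := hdb s (le_lt_trans st (lt_le_trans tD Db)).
  have [_ l3] := hdc s ltac:(by apply: lt_le_trans sm _; rewrite ge_min lexx).
  have [_ l4] := hdd s ltac:(by apply: lt_le_trans sm _; rewrite ge_min lexx orbT).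
  have bd c : `|lg (c s) - s *: v| <= 1 * `|s| -> `|lg (c s)| <= (`|v| + 1) * `|s|.
    move=> l; rewrite -(subrK (s *: v) (lg (c s))); apply: le_trans (ler_normD _ _) _.
    by rewrite normrZ; lra.
  have NsE : N%:R * `|s| = `|t| by rewrite es mulrC divfK// gt_eqF.
  have q := pow_tel gr c1s c2s (bd _ l1) (bd _ l2) (N := N).
  rewrite -!hom_RX// -tE in q; apply: le_trans (q _) _.
    rewrite [_ * `|s|]mulrC !mulrA -[3 / 2 * _ * _]mulrA NsE mulrAC -/K mulrC -ltr_pdivlMr//.
    exact: lt_le_trans tD Dr.
  have q5 : `|lg (c1 s) - lg (c2 s)| <= 2 * e' * `|s|.
    rewrite -(subrKA (s *: v)); apply: le_trans (ler_normD _ _) _.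
    by rewrite [X in _ + X]distrC; lra.
  apply: le_trans (ler_wpM2l _ q5) _; first by rewrite mulr_ge0 ?(ltW N0)// divr_ge0.
  have -> : 9 / 4 * N%:R * (2 * e' * `|s|) = 9 / 2 * e' * (N%:R * `|s|) by field.
  rewrite NsE /e'.
  have : e / (5 * (`|t| + 1)) * `|t| <= e / 5.
    rewrite invfM mulrA -mulrA ler_piMr ?divr_ge0 ?(ltW e0)//.
    by rewrite mulrC ler_pdivrMr// mul1r lerDl.
  lra.
(* An arbitrary time is an integer multiple of a small one. *)
move=> t; pose N := (Num.truncn (`|t| / D)).+1.
have N0 : 0 < N%:R :> R by rewrite ltr0n.
have tE : t = N%:R * (t / N%:R) by rewrite mulrC divfK// gt_eqF.
rewrite tE !hom_RX// small// normrM normfV (gtr0_norm N0).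
by rewrite ltr_pdivrMr// mulrC -ltr_pdivrMr// truncnS_gt.
Qed.

End OneParameter.

(** * Strict differentiability of real powers and products *)

Section RealCalculus.
Context {R : realType}.

Lemma sdiff_realfun (f df : R -> R) (x : R) : (\forall y \near x, is_derive (y : R) (1 : R) f (df y)) ->
  {for x, continuous df} -> sdiff f x (fun u => u * df x).
Proof.
move=> hf cdf; split.
- by move=> a u v; rewrite mulrDl -[a *: u]/(a * u) -mulrA.
- by exists `|df x| => u; rewrite normrM mulrC.
move=> e e0; have cl := continuous_close cdf e0.
have /nbhs_ballP[r r0 hr] : nbhs x (fun y => is_derive (y : R) (1 : R) f (df y) /\
  `|df y - df x| <= e) by apply: filterS2 hf cl.
have key y z : y < z -> ball x r y -> ball x r z ->
    `|f z - f y - (z - y) * df x| <= e * `|z - y|.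
  move=> yz yr zr.
  have inr t : y <= t -> t <= z -> ball x r t.
    move=> yt tz; move: yr zr; rewrite -!ball_normE /= !ltr_norml => /andP[? ?] /andP[? ?].
    by apply/andP; split; lra.
  have [||c] := @MVT R f df y z yz.
  - by move=> t; rewrite in_itv /= => /andP[yt tz]; have [] := hr t (inr _ (ltW yt) (ltW tz)).
  - apply: derivable_within_continuous => t; rewrite in_itv /= => /andP[yt tz].
    by have [dt _] := hr t (inr _ yt tz); exact: ex_derive.
  rewrite in_itv /= => /andP[yc cz] ->; have [_ /= hc] := hr c (inr _ (ltW yc) (ltW cz)).
  by rewrite [df c * _]mulrC -mulrBr normrM mulrC ler_wpM2r.
exists (ball x r); first exact: nbhsx_ballx.
move=> y z yr zr; have [yz|zy|->] := ltgtP y z; last by rewrite !subrr mul0r subrr normr0 mulr0.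
  rewrite -normrN !opprB [`|y - z|]distrC.
  by have := key y z yz yr zr; congr (`|_| <= _); ring.
exact: key.
Qed.

Lemma sdiff_powR (d : R) : sdiff (fun x : R => x `^ d) 1 (fun u => u * d).
Proof.
have h : sdiff (fun x : R => x `^ d) 1 (fun u => u * (d * 1 `^ (d - 1))).
  apply: (@sdiff_realfun (fun x : R => x `^ d) (fun x => d * x `^ (d - 1))).
    by near=> y; apply: is_derive1_powR; near: y; exact: lt_nbhsr.
  have c : {for (1 : R), continuous (fun y : R => y `^ (d - 1))}.
    apply: differentiable_continuous; apply/derivable1_diffP.
    by have h := @is_derive1_powR R (d - 1) 1 ltr01; exact: ex_derive.
  by apply: cvgM; [exact: cvg_cst|exact: c].
by move: h; congr sdiff; apply/funext => u; rewrite powR1 mulr1.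
Unshelve. all: by end_near. Qed.

Lemma sdiffM (V : normedModType R) (f g : V -> R) x L M : sdiff f x L -> sdiff g x M ->
  sdiff (fun y => f y * g y) x (fun u => L u * g x + f x * M u).
Proof.
move=> df dg; have cf := sdiff_cont df; have cg := sdiff_cont dg.
case: df dg => [lL /bounded_pos[C C0 hC] hf] [lM /bounded_pos[D D0 hD] hg]; split.
- move=> a u v; rewrite lL lM -![a *: _]/(a * _); ring.
- exists (C * `|g x| + `|f x| * D) => u; apply: le_trans (ler_normD _ _) _.
  rewrite !normrM mulrDl lerD//.
    by rewrite mulrAC ler_wpM2r.
  by rewrite -mulrA ler_wpM2l.
move=> e e0; pose e1 := e / (4 * (`|f x| + `|g x| + C + D + 2)).
have p0 : 0 < `|f x| + `|g x| + C + D + 2.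
  by have := normr_ge0 (f x); have := normr_ge0 (g x); lra.
have e10 : 0 < e1 by rewrite divr_gt0// mulr_gt0.
have eE : e = 4 * (e1 * (`|f x| + `|g x| + C + D + 2)).
  by rewrite /e1 invfM; field; rewrite gt_eqF//; lra.
have [U nU hU] := hf e1 e10; have [T nT hT] := hg e1 e10.
pose e2 := Num.min e1 1; have e20 : 0 < e2 by rewrite lt_min e10 ltr01.
have nf := continuous_close cf e20; have ng := continuous_close cg e20.
exists ((U `&` T) `&` ([set y | `|f y - f x| <= e2] `&` [set y | `|g y - g x| <= e2])).
  by apply: filterI; apply: filterI.
move=> y z [[Uy Ty] [fy gy]] [[Uz Tz] [fz gz]].
have h1 := hU y z Uy Uz; have h2 := hT y z Ty Tz.
rewrite /= /e2 !le_min in fy gy fz gz.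
case/andP: gy => gy gy1; case/andP: fz => fz fz1.
set d := y - z in h1 h2 *.
have -> : f y * g y - f z * g z - (L d * g x + f x * M d) =
  (f y - f z - L d) * g y + L d * (g y - g x) + (f z * (g y - g z - M d) + (f z - f x) * M d).
  by ring.
have gyb : `|g y| <= `|g x| + 1 by rewrite -(subrK (g x) (g y)) addrC (le_trans (ler_normD _ _))// lerD2l.
have fzb : `|f z| <= `|f x| + 1 by rewrite -(subrK (f x) (f z)) addrC (le_trans (ler_normD _ _))// lerD2l.
apply: le_trans (ler_normD _ _) _; apply: le_trans (lerD (ler_normD _ _) (ler_normD _ _)) _.
rewrite !normrM.
have d0 : 0 <= `|d| by [].
have t1 := ler_pM (normr_ge0 _) (normr_ge0 _) h1 gyb.
have t2 := ler_pM (normr_ge0 _) (normr_ge0 _) (hC d) gy.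
have t3 := ler_pM (normr_ge0 _) (normr_ge0 _) fzb h2.
have t4 := ler_pM (normr_ge0 _) (normr_ge0 _) fz (hD d).
apply: le_trans (lerD (lerD t1 t2) (lerD t3 t4)) _.
have -> : e1 * `|d| * (`|g x| + 1) + C * `|d| * e1 + ((`|f x| + 1) * (e1 * `|d|) + e1 * (D * `|d|))
  = (e1 * (`|f x| + `|g x| + C + D + 2)) * `|d| by ring.
rewrite eE ler_wpM2r//.
have := mulr_gt0 e10 p0; lra.
Qed.

End RealCalculus.

(** * Products of curves, and generation of the group near the identity *)

Section Products.
Context {R : realType} {n : nat} {G : lieGroupType R n}.
Implicit Types (V : normedModType R).

Lemma gsdiff_prod1 (I : eqType) V (r : seq I) (f : I -> V -> G) (v : V) (L : I -> V -> 'rV[R]_n) :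
  (forall i, i \in r -> gsdiff (f i) v (L i) /\ f i v = 1%g) ->
  gsdiff (fun y => \prod_(i <- r) f i y)%g v (fun u => \sum_(i <- r) L i u).
Proof.
elim: r => [|i r IH] h.
  have := @gsdiff_cst R n G V v 1%g; congr gsdiff; apply/funext => y; by rewrite big_nil.
have [di fi] := h i (mem_head _ _).
have hr j : j \in r -> gsdiff (f j) v (L j) /\ f j v = 1%g.
  by move=> jr; apply: h; rewrite inE jr orbT.
have dr := IH hr.
have r1 : (\prod_(i <- r) f i v)%g = 1%g.
  rewrite big_seq_cond; elim/big_rec: _ => // j x /andP[jr _] ->.
  by rewrite (hr j jr).2 mulg1.
have := gsdiff_1mul1 di dr fi r1.
by congr gsdiff; apply/funext => y; rewrite big_cons.
Qed.

Lemma gsdiff_prod_ex (I : eqType) V (r : seq I) (f : I -> V -> G) (v : V) :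
  (forall i, i \in r -> exists L, gsdiff (f i) v L) ->
  exists L, gsdiff (fun y => \prod_(i <- r) f i y)%g v L.
Proof.
elim: r => [|i r IH] h.
  exists (fun=> 0); have := @gsdiff_cst R n G V v 1%g; congr gsdiff.
  by apply/funext => y; rewrite big_nil.
have [Li di] := h i (mem_head _ _).
have [Lr dr] : exists L, gsdiff (fun y => \prod_(i <- r) f i y)%g v L.
  by apply: IH => j jr; apply: h; rewrite inE jr orbT.
eexists; have := gsdiff_mul di dr; congr gsdiff.
by apply/funext => y; rewrite big_cons.
Qed.

(** A set stable under right multiplication by a neighborhood of 1 is both open and closed, so it
    contains every path issuing from 1. This propagates to all of [G] what is known for small
    products of exponentials. *)
Lemma connected_generation (H W : set G) : simply_connected R G -> nbhs (1%g : G) W ->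
  H 1%g -> (forall q w, H q -> W w -> H (q * w)%g) -> forall q, H q.
Proof.
move=> [pc _] nW H1 HW q; have [c [cc c0 c1]] := pc 1%g q.
have cK := connected_continuous_connected (@segment_connected R 0 1) cc.
have nq (x : G) : nbhs x (fun y => W (x^-1 * y)%g).
  have := continuous_mulg (@cvg_cst G (x^-1)%g _ (nbhs x) _) (@cvg_id _ (nbhs x)).
  by apply; rewrite /= mulVg.
(* For closedness the roles are exchanged: a limit point [x] must be reached from a nearby [y] in
   [H], which involves the inverse of [y]. *)
have nq' (x : G) : nbhs x (fun y => W (y^-1 * x)%g).
  have [ci _] := @invg_smooth R n G x.
  have := continuous_mulg ci (@cvg_cst G x _ (nbhs x) _).
  by apply; rewrite /= mulVg.
have oH : open H.
  rewrite openE => x Hx; apply: filterS (nq x) => y Wy.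
  by have := HW _ _ Hx Wy; rewrite mulVKg.
have clH : closed H.
  move=> x clx; have [y [Hy Wy]] := clx _ (nq' x).
  by have := HW _ _ Hy Wy; rewrite mulVKg.
have hB : c @` `[0, 1] `&` H = c @` `[0, 1].
  apply: cK.
  - exists 1%g; split => //; exists 0 => //; rewrite /= in_itv /= lexx ler01 //.
  - by exists H.
  - by exists H.
have : (c @` `[0, 1]) q by exists 1 => //; rewrite /= in_itv /= lexx ler01.
by rewrite -hB => -[].
Qed.

End Products.

(** * Dilations *)

Section Dilations.
Context {R : realType} {n : nat} {G : lieGroupType R n}.
Context {V : R -> {vspace 'rV[R]_n}} {delta : R -> G -> G} {d : G -> G -> R}.
Hypothesis scG : simply_connected R G.
Hypothesis grV : is_grading G V.
Hypothesis dilV : is_dilation_family V delta.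
Hypothesis homd : homogeneous_distance delta d.
Implicit Types (t s l : R) (v : 'rV[R]_n).

Definition exp1 (v : 'rV[R]_n) : R -> G := sval (cid (one_param_ex v)).

Lemma exp1P v : one_param (exp1 v) v. Proof. exact: svalP (cid (one_param_ex v)). Qed.

Lemma exp1D v t s : exp1 v (t + s) = (exp1 v t * exp1 v s)%g.
Proof. exact: (exp1P v).1. Qed.

Lemma exp10 v : exp1 v 0 = 1%g. Proof. exact: hom_R0 (exp1D v). Qed.

Lemma exp1N v t : exp1 v (- t) = ((exp1 v t)^-1)%g.
Proof. exact: hom_RN (exp1D v) t. Qed.

Lemma exp1_gsdiff0 v : gsdiff (exp1 v) 0 (fun t : R => t *: v).
Proof. exact: (exp1P v).2. Qed.

Lemma deltaM l x y : 0 < l -> delta l (x * y)%g = (delta l x * delta l y)%g.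
Proof. by move=> /dilV [[h _ _] _]; exact: h. Qed.

Lemma delta_one l : 0 < l -> delta l 1%g = 1%g.
Proof. by move=> l0; apply: (mulgI (delta l 1%g)); rewrite -deltaM// !mulg1. Qed.

Lemma sdiff_mulr_l (a : R) (t : R) : sdiff (fun t : R => a * t) t (fun t : R => a * t).
Proof.
apply: sdiff_lin; first by move=> k x y; rewrite mulrDr; congr (_ + _); exact: mulrCA.
by exists `|a| => u; rewrite normrM.
Qed.

(** Both sides are one-parameter subgroups with initial velocity [l ^ i] times [v]. *)
Lemma delta_exp1 l i v t : 0 < l -> 0 < i -> v \in V i ->
  delta l (exp1 v t) = exp1 v (l `^ i * t).
Proof.
move=> l0 i0 vi; have [[hm hs _] hd] := dilV l0.
have o1 : one_param (fun t => delta l (exp1 v t)) (l `^ i *: v).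
  split; first by move=> a b; rewrite exp1D hm.
  have := gsdiff_smooth hs (exp1_gsdiff0 v); congr gsdiff; apply/funext => u.
  by rewrite exp10 linearZ /= (hd i i0 v vi) !scalerA.
have o2 : one_param (fun t => exp1 v (l `^ i * t)) (l `^ i *: v).
  split; first by move=> a b; rewrite mulrDr exp1D.
  have := gsdiff_precomp (f := exp1 v) (M := fun t : R => t *: v) (sdiff_mulr_l (l `^ i) 0).
  rewrite mulr0 => /(_ (exp1_gsdiff0 v)); congr gsdiff; apply/funext => u.
  by rewrite scalerA mulrC.
exact: (one_param_unique o1 o2).
Qed.

(** An entry [(j, (i, v))] records the component [v] of weight [i] of the [j]-th coordinate vector.
    No adapted basis is chosen: the coordinate [w 0 j] drives all the components of the [j]-th
    vector, so products over the frame have exactly [n] parameters. *)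
Lemma grading_frame : exists r : seq ('I_n * (R * 'rV[R]_n)),
  (forall x, x \in r -> 0 < x.2.1 /\ x.2.2 \in V x.2.1) /\
  forall w : 'rV[R]_n, \sum_(x <- r) w 0 x.1 *: x.2.2 = w.
Proof.
have [[s [_ s0 _ _ full]] _] := grV.
have /choice[f hf] : forall j : 'I_n, exists f : 'I_(size s) -> 'rV[R]_n,
    (forall k, f k \in V s`_k) /\ delta_mx 0 j = \sum_k f k.
  move=> j; have : delta_mx 0 j \in (\sum_(k < size s) V s`_k)%VS by rewrite full memvf.
  by move=> /memv_sumP[f hf e]; exists f; split => // k; exact: hf.
exists [seq (j, (s`_k, f j k)) | j : 'I_n <- enum 'I_n, k : 'I_(size s) <- enum 'I_(size s)]; split.
  move=> x /allpairsP[[j k] [_ _ ->]] /=; split; last exact: (hf j).1.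
  by apply: (allP s0); exact: mem_nth.
move=> w; rewrite big_allpairs_dep /= big_enum /= [RHS]row_sum_delta.
apply: eq_bigr => j _; rewrite big_enum /= (hf j).2 scaler_sumr.
by [].
Qed.

(** A variant of coordinates of the second kind, in which several factors share a coordinate. *)
Definition expprod (r : seq ('I_n * (R * 'rV[R]_n))) (w : 'rV[R]_n) : G :=
  (\prod_(x <- r) exp1 x.2.2 (w 0 x.1))%g.

Lemma sdiff_coord m (w : 'rV[R]_m) (j : 'I_m) :
  sdiff (fun w : 'rV[R]_m => w 0 j) w (fun w : 'rV[R]_m => w 0 j).
Proof.
have lc : linear (fun N : 'rV[R]_m => N 0 j : R^o) by move=> a u v; rewrite !mxE.
by have := sdiff_lin w lc (linear_rV_bounded lc).
Qed.

Lemma exp1_gsdiff_at0 (U : normedModType R) (f : U -> R) (x : U) L v : sdiff f x L -> f x = 0 ->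
  gsdiff (fun y => exp1 v (f y)) x (fun u => L u *: v) /\ exp1 v (f x) = 1%g.
Proof.
move=> df fx; split; last by rewrite fx exp10.
have := gsdiff_precomp (f := exp1 v) (M := fun t : R => t *: v) df.
by rewrite fx => /(_ (exp1_gsdiff0 v)).
Qed.

Lemma expprod_gsdiff0 r :
  gsdiff (expprod r) 0 (fun u => \sum_(x <- r) u 0 x.1 *: x.2.2).
Proof.
have h := @gsdiff_prod1 R n G _ _ r
  (fun x (w : 'rV[R]_n) => exp1 x.2.2 (w 0 x.1)) 0 (fun x u => u 0 x.1 *: x.2.2).
by apply: h => x _; apply: exp1_gsdiff_at0; [exact: sdiff_coord|rewrite mxE].
Qed.

Lemma expprod0 r : expprod r 0 = 1%g.
Proof. by rewrite /expprod big1 // => x _; rewrite mxE exp10. Qed.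

(** By the reconstruction formula of the frame, the differential of [expprod r] at 0 is the
    identity, so nearby points are reached by Newton iteration. *)
Lemma expprod_surj r e : (forall w : 'rV[R]_n, \sum_(x <- r) w 0 x.1 *: x.2.2 = w) ->
  0 < e -> nbhs (1%g : G) [set q | exists2 w, `|w| < e & expprod r w = q].
Proof.
move=> hr e0.
have [c0 d0] := expprod_gsdiff0 r.
rewrite expprod0 in d0.
(* The solver is used with an empty block of parameters. *)
pose F (z : 'rV[R]_(0 + n)) := lg (expprod r (rsubmx z)).
have drs : sdiff (fun z : 'rV[R]_(0 + n) => rsubmx z) 0 (fun z : 'rV[R]_(0 + n) => rsubmx z).
  apply: sdiff_lin; first by move=> a u v; rewrite linearP.
  by exists 1 => u; rewrite mul1r; exact: rsubmx_row_mx_norm.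
have dF : sdiff F 0 (fun z => (fun=> 0 : 'rV[R]_n) (lsubmx z) + rsubmx z).
  have rs0 : rsubmx (0 : 'rV[R]_(0 + n)) = 0 by rewrite linear0.
  have d0' : sdiff (fun w => cmap (chart_at (1%g : G)) (expprod r w))
    (rsubmx (0 : 'rV[R]_(0 + n))) (fun u => \sum_(x <- r) u 0 x.1 *: x.2.2) by rewrite rs0.
  have h := sdiffD (sdiff_comp drs d0') (sdiff_cst (- cmap (chart_at (1%g : G)) 1%g) _).
  have -> : (fun z => (fun=> 0 : 'rV[R]_n) (lsubmx z) + rsubmx z) =
    (fun u : 'rV[R]_(0 + n) => \sum_(x <- r) rsubmx u 0 x.1 *: x.2.2 + 0).
    by apply/funext => u; rewrite hr addr0 add0r.
  exact: h.
have [rho rho0 hF] := sdiff_solve (La := fun=> 0 : 'rV[R]_n) dF.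
have F0 : F (row_mx 0 0) = 0 by rewrite /F row_mxKr expprod0 lg1.
(* The solver only matches coordinates; equality in the group also requires the product to lie in
   the chart domain. *)
have : nbhs (0 : 'rV[R]_n) (expprod r @^-1` cdom (chart_at (1%g : G))).
  by apply: c0; rewrite /= expprod0; exact: chart_nbhs.
move=> /nbhs_ballP[eps eps0 heps].
have m0 : 0 < Num.min rho (Num.min (eps / 2) (e / 2)) by rewrite !lt_min rho0 !divr_gt0.
apply: filterS (nbhs_lgball m0) => q [dq]; rewrite !lt_min => /and3P[q1 q2 q3].
have [w hw Fw] := hF 0 (lg q) ltac:(by rewrite normr0) ltac:(by rewrite F0 subr0).
rewrite F0 subr0 in hw; exists w; first by lra.
apply: lg_inj => //; last by move: Fw; rewrite /F row_mxKr.
by apply: heps; rewrite -ball_normE /= sub0r normrN; lra.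
Qed.

Lemma delta_expprod r l w : (forall x, x \in r -> 0 < x.2.1 /\ x.2.2 \in V x.2.1) ->
  0 < l -> delta l (expprod r w) = (\prod_(x <- r) exp1 x.2.2 (l `^ x.2.1 * w 0 x.1))%g.
Proof.
move=> hr l0; rewrite /expprod; elim: r hr => [|x r IH] h.
  by rewrite !big_nil delta_one.
rewrite !big_cons deltaM// IH; last by move=> y yr; apply: h; rewrite inE yr orbT.
by have [i0 vi] := h x (mem_head _ _); rewrite (delta_exp1 _ l0 i0 vi).
Qed.

(** The definition of dilations constrains each [delta l] separately, with no regularity in [l].
    Both properties are stable under right multiplication by [expprod r w], whose dilates are
    explicit in [l]. *)
Lemma delta_orbit q : delta 1 q = q /\ exists L, gsdiff (fun l => delta l q) 1 L.
Proof.
have [r [hr1 hr2]] := grading_frame.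
apply: (connected_generation (H := fun q => delta 1 q = q /\
   exists L, gsdiff (fun l => delta l q) 1 L) scG (expprod_surj hr2 ltr01)).
  split; first exact: delta_one.
  exists (fun=> 0); apply: gsdiff_near (gsdiff_cst _ 1%g); near=> l.
  by rewrite delta_one//; near: l; exact: lt_nbhsr.
move=> {}q _ [e1 [L dL]] [w _ <-].
have dprod l := @delta_expprod r l w hr1.
split.
  rewrite deltaM// e1 dprod//; congr (_ * _)%g; apply: eq_bigr => x _.
  by rewrite powR1 mul1r.
have [M dM] : exists M, gsdiff (fun l => \prod_(x <- r) exp1 x.2.2 (l `^ x.2.1 * w 0 x.1))%g 1 M.
  apply: gsdiff_prod_ex => x xr; eexists.
  apply: (gsdiff_precomp (f := exp1 x.2.2)
     (sdiffM (sdiff_powR x.2.1) (sdiff_cst (w 0 x.1) (1 : R)))).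
  exact: hom_gsdiff (exp1D _) (exp1_gsdiff0 _) _.
eexists; apply: gsdiff_near (gsdiff_mul dL dM); near=> l.
have l0 : 0 < l by near: l; exact: lt_nbhsr.
by rewrite deltaM// dprod.
Unshelve. all: by end_near. Qed.

Lemma delta1 q : delta 1 q = q. Proof. exact: (delta_orbit q).1. Qed.

Lemma delta_gsdiff q : gsdiff (fun l => delta l q) 1 (fun u : R => u *: delta_bar delta q).
Proof.
have [e [L dL]] := delta_orbit q; have [_ dd] := dL; rewrite e in dd.
have [df dE] := sdiff_diff dd.
have dbE : delta_bar delta q = L 1 by rewrite /delta_bar derive1E' // dE.
move: dL; congr gsdiff; apply/funext => u; rewrite dbE.
have [lL _ _] := dd; rewrite -(linearZ_fun lL) -[u *: 1]/(u * 1).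
by rewrite mulr1.
Qed.

Lemma dnorm_delta l q : 0 < l -> d 1%g (delta l q) = l * d 1%g q.
Proof. by move=> l0; have [_ _ h] := homd; rewrite -(h l l0) delta_one. Qed.

Lemma dnorm_ge0 q : 0 <= d 1%g q. Proof. by have [[h _ _ _] _ _] := homd; exact: h. Qed.

Lemma dnormM x y : d 1%g (x * y)%g <= d 1%g x + d 1%g y.
Proof.
have [[_ _ _ ht] hl _] := homd; apply: le_trans (ht _ x _) _.
by rewrite -[X in d X (x * y)%g](mulg1 x) hl.
Qed.

Lemma dnormV x : d 1%g (x^-1)%g = d 1%g x.
Proof.
have [[_ _ hs _] hl _] := homd.
by rewrite -(hl x) mulg1 mulgV hs.
Qed.

Lemma dnormMr_le x y : `|d 1%g (x * y)%g - d 1%g x| <= d 1%g y.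
Proof.
rewrite ler_norml; apply/andP; split; last by rewrite lerBlDl dnormM.
rewrite lerBrDr addrC lerBlDr -{1}(mulgK y x).
by apply: le_trans (dnormM _ _) _; rewrite dnormV.
Qed.

Lemma dnormMl_le x y : `|d 1%g (y * x)%g - d 1%g x| <= d 1%g y.
Proof.
rewrite ler_norml; apply/andP; split; last by rewrite lerBlDr dnormM.
rewrite lerBrDr addrC lerBlDr addrC -{1}(mulKg y x).
by apply: le_trans (dnormM _ _) _; rewrite dnormV.
Qed.

Lemma dnorm_exp1 v t : v \in V 1 -> d 1%g (exp1 v t) = `|t| * d 1%g (exp1 v 1).
Proof.
move=> v1.
have pos s : 0 < s -> d 1%g (exp1 v s) = s * d 1%g (exp1 v 1).
  move=> s0; rewrite -dnorm_delta// (delta_exp1 _ s0 ltr01 v1) powRr1 ?(ltW s0)//.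
  by rewrite mulr1.
have [t0|t0|->] := ltgtP t 0.
- by rewrite ltr0_norm// -pos ?oppr_gt0// exp1N dnormV.
- by rewrite gtr0_norm// pos.
- rewrite normr0 mul0r exp10; have [[_ h _ _] _ _] := homd.
  exact/h.
Qed.

End Dilations.

(** * Lipschitz bound for the distance from the identity *)

Section SphereDistance.
Context {R : realType} {n : nat} {G : lieGroupType R n}.
Context {V : R -> {vspace 'rV[R]_n}} {delta : R -> G -> G} {d : G -> G -> R} {p : G}.
Hypothesis scG : simply_connected R G.
Hypothesis grV : is_grading G V.
Hypothesis dilV : is_dilation_family V delta.
Hypothesis homd : homogeneous_distance delta d.

Let phi := cmap (chart_at p).
Let dL := mdiff (left_translation p) 1%g.
Let dR := mdiff (right_translation p) 1%g.

(** Joint strict differentiability in the dilation factor and in the dilated point, at factor 1 and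
    point [p]. The dilation distributes over the product, leaving the orbit of [p] times
    exponentials with explicit arguments. *)
Lemma delta_expprod_gsdiff (U : normedModType R) r (f : U -> R) (g : U -> 'rV[R]_n) x Lf Lg :
  (forall y, y \in r -> 0 < y.2.1 /\ y.2.2 \in V y.2.1) ->
  (forall w : 'rV[R]_n, \sum_(y <- r) w 0 y.1 *: y.2.2 = w) ->
  sdiff f x Lf -> f x = 0 -> sdiff g x Lg -> g x = 0 ->
  gsdiff (fun z => delta (1 + f z) (p * expprod r (g z)))%g x
    (fun u => Lf u *: delta_bar delta p + dL (Lg u)).
Proof.
move=> hr1 hr2 df fx dg gx.
have d1 : sdiff (fun z => 1 + f z) x (fun u => 0 + Lf u) := sdiffD (sdiff_cst _ _) df.
have fx1 : 1 + f x = 1 by rewrite fx addr0.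
have D : gsdiff (fun z => delta (1 + f z) p) x (fun u => (0 + Lf u) *: delta_bar delta p).
  apply: (gsdiff_precomp (f := fun l => delta l p) (M := fun u : R => u *: delta_bar delta p) d1).
  by rewrite fx1; exact: (delta_gsdiff scG grV dilV).
have dgi j : sdiff (fun z => g z 0 j) x (fun u => Lg u 0 j) := sdiff_comp dg (sdiff_coord _ _).
have E : gsdiff (fun z => \prod_(y <- r) exp1 (G := G) y.2.2 ((1 + f z) `^ y.2.1 * g z 0 y.1))%g x
    (fun u => \sum_(y <- r) Lg u 0 y.1 *: y.2.2).
  have dy i j : sdiff (fun z => (1 + f z) `^ i * g z 0 j) x (fun u => Lg u 0 j).
    have dp : sdiff (fun z => (1 + f z) `^ i) x (fun u => (0 + Lf u) * i).
      apply: (sdiff_comp (g := fun l : R => l `^ i) (M := fun u => u * i) d1).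
      by rewrite fx1; exact: sdiff_powR.
    (* Since [g] vanishes at [x], the variation of the power contributes nothing to first order. *)
    have := sdiffM dp (dgi j); congr sdiff; apply/funext => u.
    by rewrite gx mxE mulr0 add0r fx1 powR1 mul1r.
  apply: (@gsdiff_prod1 R n G _ U r (fun y z => exp1 (G := G) y.2.2 ((1 + f z) `^ y.2.1 * g z 0 y.1))
    x (fun y u => Lg u 0 y.1 *: y.2.2)) => y _.
  by apply: exp1_gsdiff_at0; [exact: dy|rewrite gx mxE mulr0].
have E0 : (\prod_(y <- r) exp1 (G := G) y.2.2 ((1 + f x) `^ y.2.1 * g x 0 y.1))%g = 1%g.
  by rewrite big1// => y _; rewrite gx mxE mulr0 exp10.
have h := gsdiff_mul1 D E E0.
have h' : gsdiff (fun z => delta (1 + f z) p *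
    \prod_(y <- r) exp1 (G := G) y.2.2 ((1 + f z) `^ y.2.1 * g z 0 y.1))%g x
    (fun u => Lf u *: delta_bar delta p + dL (Lg u)).
  move: h; congr gsdiff; apply/funext => u.
  by rewrite /= add0r hr2 fx1 (delta1 scG grV dilV).
have pos : nbhs x ((fun z => 1 + f z) @^-1` [set l | 0 < l]).
  by apply: (sdiff_cont d1); rewrite /= fx1; exact: lt_nbhsr.
apply: gsdiff_near h'; apply: filterS pos => z l0.
by rewrite (deltaM dilV)// (delta_expprod dilV _ hr1).
Qed.

Lemma near_expprod r e : (forall w : 'rV[R]_n, \sum_(y <- r) w 0 y.1 *: y.2.2 = w) ->
  0 < e -> \forall q \near p, exists2 a, `|a| < e & q = (p * expprod r a)%g.
Proof.
move=> hr e0.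
have c : {for p, continuous (fun q => p^-1 * q)%g}.
  exact: continuous_mulg (@cvg_cst G (p^-1)%g _ (nbhs p) _) (@cvg_id _ (nbhs p)).
have : nbhs p ((fun q => p^-1 * q)%g @^-1` [set q | exists2 w, `|w| < e & expprod r w = q]).
  by apply: c; rewrite /= mulVg; exact: expprod_surj.
by apply: filterS => q [a ae qE]; exists a => //; rewrite qE mulVKg.
Qed.

Lemma norm_lsub_small k m (z : 'rV[R]_(k + m)) e : `|lsubmx z| < e -> `|rsubmx z| < e -> `|z| < e.
Proof.
move=> h1 h2; rewrite -(hsubmxK z); apply: (@le_lt_trans _ _ (Num.max `|lsubmx z| `|rsubmx z|)).
  by apply: row_mx_norm_le; rewrite le_max lexx ?orbT.
by rewrite gt_max h1 h2.
Qed.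

Lemma sdiff_lsub k m (z : 'rV[R]_(k + m)) :
  sdiff (fun z : 'rV[R]_(k + m) => lsubmx z) z (fun z : 'rV[R]_(k + m) => lsubmx z).
Proof.
apply: sdiff_lin; first by move=> a u v; rewrite linearP.
by exists 1 => u; rewrite mul1r; exact: lsubmx_row_mx_norm.
Qed.

Lemma sdiff_rsub k m (z : 'rV[R]_(k + m)) :
  sdiff (fun z : 'rV[R]_(k + m) => rsubmx z) z (fun z : 'rV[R]_(k + m) => rsubmx z).
Proof.
apply: sdiff_lin; first by move=> a u v; rewrite linearP.
by exists 1 => u; rewrite mul1r; exact: rsubmx_row_mx_norm.
Qed.

Lemma lsub0 k m : lsubmx (0 : 'rV[R]_(k + m)) = 0. Proof. exact: linear0. Qed.
Lemma rsub0 k m : rsubmx (0 : 'rV[R]_(k + m)) = 0. Proof. exact: linear0. Qed.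

(** The left block of [z] locates [q], the last coordinate is [l - 1]. The two-point estimate at 0,
    applied to two parameters with the same left block, is uniform in [q], and its linear part is
    that of the orbit of [p]. *)
Lemma delta_flow e : 0 < e -> exists2 rho, 0 < rho &
  \forall q \near p, forall l, `|l - 1| < rho -> cdom (chart_at p) (delta l q) /\
   `|phi (delta l q) - phi q - (l - 1) *: delta_bar delta p| <= e * `|l - 1|.
Proof.
move=> e0; have [r [hr1 hr2]] := grading_frame grV.
pose f (z : 'rV[R]_(n + 1)) : R := rsubmx z 0 0.
pose g (z : 'rV[R]_(n + 1)) : 'rV[R]_n := lsubmx z.
have df : sdiff f 0 f := sdiff_comp (sdiff_rsub _) (sdiff_coord _ _).
have [cF dF] := delta_expprod_gsdiff hr1 hr2 df ltac:(by rewrite /f rsub0 mxE)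
  (sdiff_lsub (0 : 'rV[R]_(n + 1))) (lsub0 _ _).
pose F (z : 'rV[R]_(n + 1)) := delta (1 + f z) (p * expprod r (lsubmx z))%g.
have F0 : F 0 = p by rewrite /F /f rsub0 mxE addr0 lsub0 expprod0 mulg1 (delta1 scG grV dilV).
rewrite -/(F 0) F0 in dF.
have [_ _ /(_ e e0)[U nU hU]] := dF.
have nC : nbhs (0 : 'rV[R]_(n + 1)) (F @^-1` cdom (chart_at p)).
  by apply: cF; rewrite -/(F 0) F0; exact: chart_nbhs.
have /nbhs_ballP[rho rho0 hrho] : nbhs (0 : 'rV[R]_(n + 1)) (U `&` F @^-1` cdom (chart_at p)).
  exact: filterI.
exists rho => //.
apply: filterS (near_expprod hr2 rho0) => q [a ale qE] l hl.
have in0 (w : 'rV[R]_1) : `|w| < rho -> ball (0 : 'rV[R]_(n + 1)) rho (row_mx a w).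
  move=> hw; rewrite -ball_normE /= sub0r normrN.
  by apply: norm_lsub_small; rewrite ?row_mxKl ?row_mxKr.
have nw (h : R) : `|const_mx h : 'rV[R]_1| <= `|h|.
  by apply: rV_norm_le => // i; rewrite mxE.
have [Ul Cl] := hrho _ (in0 (const_mx (l - 1)) (le_lt_trans (nw _) hl)).
have [U0 _] := hrho _ (in0 0 ltac:(by rewrite normr0)).
have Fl (h : R) : F (row_mx a (const_mx h)) = delta (1 + h) q.
  by rewrite /F /f row_mxKl row_mxKr mxE qE.
have F00 : F (row_mx a 0) = q.
  by rewrite /F /f row_mxKl row_mxKr mxE addr0 (delta1 scG grV dilV) qE.
have el : 1 + (l - 1) = l by rewrite addrC subrK.
split; first by move: Cl; rewrite /= -/(F _) Fl el.
have := hU _ _ Ul U0; rewrite -!/(F _) Fl F00 el.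
rewrite opp_row_mx add_row_mx subrr subr0 row_mxKl linear0 addr0 /f row_mxKr mxE.
move/le_trans; apply; rewrite ler_wpM2l ?(ltW e0)//.
by apply: row_mx_norm_le; rewrite ?normr0.
Qed.

Hypothesis spanp : (linfun dL @: V 1 + linfun dR @: V 1 + <[delta_bar delta p]>)%VS = fullv.

(** A linear right inverse of the sum map of the spanning condition. Moving along the [j]-th triple
    has total effect the [j]-th coordinate vector, so the derivative in these [n] unknowns is the
    identity, as the solver demands. *)
Lemma span_frame : exists (vl vr : 'I_n -> 'rV[R]_n) (h : 'I_n -> R),
  [/\ forall j, vl j \in V 1, forall j, vr j \in V 1 &
   forall w : 'rV[R]_n, \sum_j w 0 j *: (dL (vl j) + dR (vr j) + h j *: delta_bar delta p) = w].
Proof.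
have /choice[f hf] : forall j : 'I_n, exists f : 'rV[R]_n * 'rV[R]_n * R,
   [/\ f.1.1 \in V 1, f.1.2 \in V 1 &
    delta_mx 0 j = dL f.1.1 + dR f.1.2 + f.2 *: delta_bar delta p].
  move=> j; have : delta_mx 0 j \in
     (linfun dL @: V 1 + linfun dR @: V 1 + <[delta_bar delta p]>)%VS by rewrite spanp memvf.
  move=> /memv_addP[u /memv_addP[u1 /memv_imgP[x1 hx1 ->] [u2 /memv_imgP[x2 hx2 ->] ->]] [y /vlineP[k ->] ->]].
  exists (x1, x2, k); split=> //=.
  by congr (_ + _ + _); [exact: lfunE|exact: lfunE].
exists (fun j => (f j).1.1), (fun j => (f j).1.2), (fun j => (f j).2); split.
- by move=> j; case: (hf j).
- by move=> j; case: (hf j).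
- move=> w; rewrite [RHS]row_sum_delta; apply: eq_bigr => j _.
  by have [_ _ <-] := hf j.
Qed.

Lemma expprod1_gsdiff (vl : 'I_n -> 'rV[R]_n) :
  gsdiff (fun z : 'rV[R]_(n + n) => \prod_(j <- enum 'I_n) exp1 (G := G) (vl j) (rsubmx z 0 j))%g 0
    (fun u => \sum_(j <- enum 'I_n) rsubmx u 0 j *: vl j).
Proof.
have h := @gsdiff_prod1 R n G _ _ (enum 'I_n)
  (fun j (z : 'rV[R]_(n + n)) => exp1 (G := G) (vl j) (rsubmx z 0 j)) 0
  (fun j u => rsubmx u 0 j *: vl j).
apply: h => j _; apply: exp1_gsdiff_at0; last by rewrite rsub0 mxE.
exact: sdiff_comp (sdiff_rsub _) (sdiff_coord _ _).
Qed.

Lemma expprod1_at0 (vl : 'I_n -> 'rV[R]_n) :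
  (\prod_(j <- enum 'I_n) exp1 (G := G) (vl j) (rsubmx (0 : 'rV[R]_(n + n)) 0 j))%g = 1%g.
Proof. by rewrite big1// => j _; rewrite rsub0 mxE exp10. Qed.

(** Weight one is essential for a linear bound: along a direction of weight [i > 1] the distance
    only grows like the power [1 / i] of the parameter. *)
Lemma dnorm_expprod1 (vl : 'I_n -> 'rV[R]_n) : (forall j, vl j \in V 1) ->
  exists2 K, 0 <= K & forall w : 'rV[R]_n,
   d 1%g (\prod_(j <- enum 'I_n) exp1 (G := G) (vl j) (w 0 j))%g <= K * `|w|.
Proof.
move=> hv; exists (\sum_(j <- enum 'I_n) d 1%g (exp1 (G := G) (vl j) 1)).
  by apply: sumr_ge0 => j _; exact: (dnorm_ge0 homd).
move=> w; elim: (enum 'I_n) => [|j s IH].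
  rewrite !big_nil mul0r; have [[_ h _ _] _ _] := homd.
  by rewrite (h 1%g 1%g).2.
rewrite !big_cons mulrDl; apply: le_trans (dnormM homd _ _) _.
apply: lerD IH; rewrite (dnorm_exp1 dilV homd)// mulrC ler_wpM2l ?(dnorm_ge0 homd)//.
exact: coord_norm_le.
Qed.

(** The weight-one factors change the distance by a multiple of the displacement, the dilation by a
    multiple proportional to the distance itself; hence the factor [d 1 q + 1]. *)
Lemma dnorm_lip : exists2 K, 0 < K & exists2 W, nbhs p W &
  forall q q', W q -> W q' -> `|d 1%g q' - d 1%g q| <= K * (d 1%g q + 1) * `|phi q' - phi q|.
Proof.
have [r [hr1 hr2]] := grading_frame grV.
have [vl [vr [h [hvl hvr hsp]]]] := span_frame.
pose f (z : 'rV[R]_(n + n)) : R := \sum_j rsubmx z 0 j * h j.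
have lf : linear (f : _ -> R^o).
  move=> a u v; rewrite /f scaler_sumr -big_split /=; apply: eq_bigr => j _.
  by rewrite linearP !mxE mulrDl -[a *: _]/(a * _) mulrA.
have bf := linear_rV_bounded lf.
have df : sdiff f 0 f := sdiff_lin 0 lf bf.
have f0 : f 0 = 0 by rewrite /f big1// => j _; rewrite rsub0 mxE mul0r.
have dD := delta_expprod_gsdiff hr1 hr2 df f0 (sdiff_lsub (0 : 'rV[R]_(n + n))) (lsub0 _ _).
pose D (z : 'rV[R]_(n + n)) := delta (1 + f z) (p * expprod r (lsubmx z))%g.
have D0 : D 0 = p by rewrite /D f0 addr0 lsub0 expprod0 mulg1 (delta1 scG grV dilV).
pose Pl (z : 'rV[R]_(n + n)) := (\prod_(j <- enum 'I_n) exp1 (G := G) (vl j) (rsubmx z 0 j))%g.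
pose Pr (z : 'rV[R]_(n + n)) := (\prod_(j <- enum 'I_n) exp1 (G := G) (vr j) (rsubmx z 0 j))%g.
have dDP := gsdiff_mul1 dD (expprod1_gsdiff vl) (expprod1_at0 vl).
have [cF dF] := gsdiff_1mul (expprod1_gsdiff vr) dDP (expprod1_at0 vr).
pose F z := (Pr z * (D z * Pl z))%g.
have Pl0 : Pl 0 = 1%g := expprod1_at0 vl.
have Pr0 : Pr 0 = 1%g := expprod1_at0 vr.
have F0 : F 0 = p by rewrite /F Pl0 Pr0 mul1g mulg1 D0.
have dF' : sdiff (fun z => phi (F z)) 0 (fun u => dL (lsubmx u) + rsubmx u).
  move: dF; rewrite -/(Pr _) -/(D 0) -/(Pl _) -/(F 0) F0; congr sdiff; apply/funext => u.
  rewrite -/(D 0) -/(Pl 0) D0 Pl0 mulg1 -/dL -/dR.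
  rewrite !big_enum /=.
  have eL : dL (\sum_j rsubmx u 0 j *: vl j) = \sum_j rsubmx u 0 j *: dL (vl j).
    by rewrite linear_sum; apply: eq_bigr => j _; rewrite linearZ.
  have eR : dR (\sum_j rsubmx u 0 j *: vr j) = \sum_j rsubmx u 0 j *: dR (vr j).
    by rewrite linear_sum; apply: eq_bigr => j _; rewrite linearZ.
  have eS : rsubmx u = \sum_j rsubmx u 0 j *: dL (vl j) + \sum_j rsubmx u 0 j *: dR (vr j)
      + f u *: delta_bar delta p.
    rewrite -[LHS]hsp /f scaler_suml -!big_split /=; apply: eq_bigr => j _.
    by rewrite !scalerDr scalerA.
  move: eL eR eS.
  set A := \sum_j _ *: dL _; set B := \sum_j _ *: dR _; set C := f u *: _ => eL eR eS.
  transitivity (B + (C + dL (lsubmx u) + A)); first by congr (_ + (_ + _)).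
  transitivity (dL (lsubmx u) + (A + B + C)); last by congr (_ + _).
  rewrite [LHS]addrC [C + _]addrC -!addrA; congr (_ + _).
  by rewrite [LHS]addrC -addrA.
have [rho rho0 hF] := sdiff_solve dF'.
(* The bound on [f] keeps the dilation factor [1 + f z] positive. *)
have nC : nbhs (0 : 'rV[R]_(n + n)) (F @^-1` cdom (chart_at p) `&`
    [set z | `|f z| <= 2^-1]).
  apply: filterI; first by apply: cF; rewrite -/(F 0) F0; exact: chart_nbhs.
  have half0 : 0 < 2^-1 :> R by rewrite invr_gt0.
  have := continuous_close (sdiff_cont df) half0; rewrite f0.
  by apply: filterS => z; rewrite subr0.
move: nC => /nbhs_ballP[s s0 hs].
have [Kl Kl0 hKl] := dnorm_expprod1 hvl; have [Kr Kr0 hKr] := dnorm_expprod1 hvr.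
have [Cf Cf0 hCf] := bounded_pos bf.
pose K := 2 * (Cf + Kl + Kr + 1) * 2.
have K0 : 0 < K by rewrite /K; lra.
exists K => //.
have c1 := cmap_continuous (chart_at_dom p).
(* Two points of the neighborhood are less than [2 * m] apart in coordinates, so the solution [w]
   has norm below [4 * m]; these must be at most [rho] and [s]. *)
pose m := Num.min (rho / 2) (s / 8); have m0 : 0 < m by rewrite lt_min !divr_gt0.
have m1 : m <= rho / 2 by rewrite ge_min lexx.
have m2 : m <= s / 8 by rewrite ge_min lexx orbT.
exists (cdom (chart_at p) `&` ([set q | `|phi q - phi p| < m] `&`
    [set q | exists2 a, `|a| < Num.min rho s & q = (p * expprod r a)%g])).
  apply: filterI; first exact: chart_nbhs.
  apply: filterI; last by apply: near_expprod => //; rewrite lt_min rho0 s0.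
  by have /cvgrPdist_lt/(_ _ m0) := c1; apply: filterS => q; rewrite distrC.
move=> q q' [dq [/= qm [a]]]; rewrite lt_min => /andP[arho as_] qE [dq' [/= qm' _]].
have Fa0 : F (row_mx a 0) = q.
  have ra : rsubmx (row_mx a (0 : 'rV[R]_n)) = rsubmx (0 : 'rV[R]_(n + n)).
    by rewrite row_mxKr rsub0.
  have fa0 : f (row_mx a 0) = 0.
    by rewrite /f big1// => j _; rewrite row_mxKr mxE mul0r.
  rewrite /F /Pr /Pl ra -/(Pr 0) -/(Pl 0) Pr0 Pl0 mul1g mulg1 /D fa0 addr0 row_mxKl.
  by rewrite (delta1 scG grV dilV) qE.
have qq' : `|phi q' - phi q| < 2 * m.
  rewrite -(subrKA (phi p)); apply: le_lt_trans (ler_normD _ _) _.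
  by rewrite [X in _ + X]distrC; lra.
have [w hw] := hF a (phi q') arho ltac:(by rewrite Fa0; lra).
rewrite Fa0 in hw => Fw.
have ws : `|w| < s by lra.
have [Cw fw] := hs (row_mx a w) ltac:(by rewrite -ball_normE /= sub0r normrN;
   apply: norm_lsub_small; rewrite ?row_mxKl ?row_mxKr).
have Fq' : F (row_mx a w) = q' by rewrite -(cmapK dq') -[LHS](cmapK Cw); congr cinv.
rewrite /= in fw.
set h0 := f (row_mx a w) in fw.
have l0 : 0 < 1 + h0 by move: fw; rewrite ler_norml => /andP[? _]; lra.
have q'E : q' = (Pr (row_mx a w) * (delta (1 + h0) q * Pl (row_mx a w)))%g.
  by rewrite -Fq' /F /D row_mxKl -qE.
have nPr : d 1%g (Pr (row_mx a w)) <= Kr * `|w|.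
  by apply: le_trans (hKr _); rewrite /Pr row_mxKr.
have nPl : d 1%g (Pl (row_mx a w)) <= Kl * `|w|.
  by apply: le_trans (hKl _); rewrite /Pl row_mxKr.
have nh : `|h0| <= Cf * `|w|.
  have -> : h0 = f (row_mx 0 w) by rewrite /h0 /f !row_mxKr.
  apply: le_trans (hCf _) _; rewrite ler_wpM2l ?(ltW Cf0)//.
  by apply: row_mx_norm_le; rewrite ?normr0.
have b1 := dnormMl_le homd (delta (1 + h0) q * Pl (row_mx a w))%g (Pr (row_mx a w)).
have b2 := dnormMr_le homd (delta (1 + h0) q) (Pl (row_mx a w)).
rewrite -q'E in b1; rewrite (dnorm_delta dilV homd)// in b2.
have Nq0 := dnorm_ge0 homd q.
set N' := d 1%g q' in b1 *; set Nq := d 1%g q in b2 Nq0 *.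
set M := d 1%g (_ * _)%g in b1 b2.
have -> : N' - Nq = (N' - M) + (M - (1 + h0) * Nq) + h0 * Nq by ring.
apply: le_trans (ler_normD _ _) _; apply: le_trans (lerD (ler_normD _ _) (lexx _)) _.
rewrite normrM (ger0_norm Nq0).
have w0 : 0 <= `|w| by [].
have t1 : `|h0| * Nq <= Cf * `|w| * Nq by rewrite ler_wpM2r.
have : (Kl + Kr) * `|w| + Cf * `|w| * Nq <= (Cf + Kl + Kr + 1) * (Nq + 1) * `|w|.
  rewrite -subr_ge0.
  have -> : (Cf + Kl + Kr + 1) * (Nq + 1) * `|w| - ((Kl + Kr) * `|w| + Cf * `|w| * Nq)
    = (Cf + 1 + (Kl + Kr + 1) * Nq) * `|w| by ring.
  by rewrite mulr_ge0// addr_ge0 ?mulr_ge0 ?addr_ge0// ltW.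
have : (Cf + Kl + Kr + 1) * (Nq + 1) * `|w| <= (Cf + Kl + Kr + 1) * (Nq + 1) * (2 * `|phi q' - phi q|).
  by rewrite ler_wpM2l// mulr_ge0 ?addr_ge0// ltW.
have : 0 <= (Cf + Kl + Kr + 1) * (Nq + 1) * (2 * `|phi q' - phi q|).
  by rewrite !mulr_ge0 ?addr_ge0// ltW.
rewrite /K; lra.
Qed.

End SphereDistance.

(** * The sphere as a Lipschitz graph *)

Section CkLinear.
Context {R : realType}.
Implicit Types (V W : normedModType R).

Lemma near_eq_differentiable V W (f g : V -> W) x : (\forall y \near x, f y = g y) ->
  differentiable f x -> differentiable g x.
Proof.
move=> fg df; have fgx := nbhs_singleton fg.
have [cd od] := (diff_locallyP x f).1 df.
have ex : g \o shift x = cst (g x) + 'd f x +o_ 0 id.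
  apply/eqaddoP => e e0; move/eqaddoP: od => /(_ e e0).
  have : \forall y \near (0 : V), f (y + x) = g (y + x).
    have c : {for 0, continuous (fun y : V => y + x)}.
      by apply: continuousD; [exact: cvg_id|exact: cvg_cst].
    have : nbhs (0 + x) (fun y => f y = g y) by rewrite add0r.
    by move/c.
  apply: filterS2 => y fgy.
  by rewrite -![(_ + _ : _ -> _) _]/(_ + _) -![(- _ : _ -> _) _]/(- _) /= fgy -fgx.
have dE := diff_unique cd ex.
by apply/diff_locallyP; rewrite dE; split.
Qed.

(** The chain rule identifies derivatives on [D] only, so higher smoothness must be insensitive to
    values outside [D]. *)
Lemma Ck_congr k V W (D : set V) (f g : V -> W) : open D -> (forall x, D x -> f x = g x) ->
  Ck k D f -> Ck k D g.
Proof.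
move=> oD; elim: k f g => [|k IH] f g fg /=.
  move=> cf x Dx; have nfg : \forall y \near x, f y = g y.
    by apply: filterS (open_nbhs_nbhs (conj oD Dx)) => y /fg.
  have : g @ x --> f x by apply: cvg_trans (cf x Dx); exact: near_eq_cvg.
  by rewrite (fg x Dx).
move=> [df cf]; split.
  move=> x Dx; apply: near_eq_differentiable (df x Dx).
  by apply: filterS (open_nbhs_nbhs (conj oD Dx)) => y /fg.
move=> v; apply: IH (cf v) => x Dx.
apply: near_eq_derive.
by apply: filterS (open_nbhs_nbhs (conj oD Dx)) => y /fg.
Qed.

(** The derivative along [v] of a composite with [A] is the derivative along [v *m A], composed with
    [A]: the same form, so induction on [k] applies without a general chain rule of order [k]. *)
Lemma Ck_precomp_lin k m p W (D : set 'rV[R]_p) (f : 'rV[R]_p -> W) (A : 'M[R]_(m, p)) :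
  open D -> Ck k D f -> Ck k ((fun x => x *m A) @^-1` D) (fun x => f (x *m A)).
Proof.
have lA : linear (fun x : 'rV[R]_m => x *m A).
  by move=> a u v; rewrite mulmxDl scalemxAl.
have dA x := sdiff_lin x lA (linear_rV_bounded lA).
move=> oD; have oAD : open ((fun x : 'rV[R]_m => x *m A) @^-1` D).
  by apply: open_comp => // x _; exact: sdiff_cont (dA x).
elim: k f => [|k IH] f /=.
  move=> cf x Dx; apply: (@continuous_comp _ _ _ (fun x : 'rV[R]_m => x *m A) f).
    exact: sdiff_cont (dA x).
  exact: cf.
move=> [df cf].
have dc x : D (x *m A) -> differentiable (fun x : 'rV[R]_m => f (x *m A)) x.
  move=> Dx; apply: (@differentiable_comp _ _ _ _ (fun x : 'rV[R]_m => x *m A) f).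
    exact: (sdiff_diff (dA x)).1.
  exact: df.
split=> // v; apply: Ck_congr (IH _ (cf (v *m A))) => // x Dx.
rewrite deriveE; last exact: df.
rewrite deriveE; last exact: dc.
rewrite (@diff_comp _ _ _ _ (fun x : 'rV[R]_m => x *m A) f x (sdiff_diff (dA x)).1 (df _ Dx)).
by rewrite /= (sdiff_diff (dA x)).2.
Qed.

Lemma Ck_postcomp_lin k m p V (D : set V) (f : V -> 'rV[R]_m) (A : 'M[R]_(m, p)) :
  open D -> Ck k D f -> Ck k D (fun x => f x *m A).
Proof.
have lA : linear (fun x : 'rV[R]_m => x *m A).
  by move=> a u v; rewrite mulmxDl scalemxAl.
have dA x := sdiff_lin x lA (linear_rV_bounded lA).
move=> oD; elim: k f => [|k IH] f /=.
  move=> cf x Dx; apply: (@continuous_comp _ _ _ f (fun x : 'rV[R]_m => x *m A)).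
    exact: cf.
  exact: sdiff_cont (dA (f x)).
move=> [df cf].
have dc x : D x -> differentiable (fun x => f x *m A) x.
  move=> Dx; apply: (@differentiable_comp _ _ _ _ f (fun x : 'rV[R]_m => x *m A)).
    exact: df.
  exact: (sdiff_diff (dA (f x))).1.
split=> // v; apply: Ck_congr (IH _ (cf v)) => // x Dx.
rewrite deriveE; last exact: df.
rewrite deriveE; last exact: dc.
rewrite (@diff_comp _ _ _ _ f (fun x : 'rV[R]_m => x *m A) x (df _ Dx) (sdiff_diff (dA (f x))).1).
by rewrite /= (sdiff_diff (dA (f x))).2.
Qed.

Lemma smooth_at_precomp_lin m p W (f : 'rV[R]_p -> W) (A : 'M[R]_(m, p)) x :
  smooth_at f (x *m A) -> smooth_at (fun x => f (x *m A)) x.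
Proof.
have lA : linear (fun x : 'rV[R]_m => x *m A).
  by move=> a u v; rewrite mulmxDl scalemxAl.
move=> [D [[oD Dx] cf]]; exists ((fun x => x *m A) @^-1` D); split.
  split=> //; apply: open_comp => // y _.
  exact: sdiff_cont (sdiff_lin y lA (linear_rV_bounded lA)).
by move=> k; exact: Ck_precomp_lin.
Qed.

Lemma smooth_at_postcomp_lin m p V (f : V -> 'rV[R]_m) (A : 'M[R]_(m, p)) x :
  smooth_at f x -> smooth_at (fun x => f x *m A) x.
Proof.
move=> [D [[oD Dx] cf]]; exists D; split => // k; exact: Ck_postcomp_lin.
Qed.

(** Gaussian elimination on a matrix of rank one carries [v] to a multiple of the first coordinate
    vector; a transposition and a scaling finish. *)
Lemma row_to_delta n (v : 'rV[R]_n) (j : 'I_n) : v != 0 ->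
  exists2 A : 'M[R]_n, A \in unitmx & v *m A = delta_mx 0 j.
Proof.
case: n v j => [|n] v j v0; first by case: j.
have rk : \rank v = 1%N.
  by apply/eqP; rewrite eqn_leq rank_leq_row lt0n mxrank_eq0.
have ev := mulmx_ebase v; rewrite rk in ev.
have cu := col_ebase_unit v; have ru := row_ebase_unit v.
set C := col_ebase v in ev cu; set E := row_ebase v in ev ru.
have [c cE] : exists c, C = c%:M by exists (C 0 0); exact: mx11_scalar.
have c0 : c != 0 by move: cu; rewrite cE unitmxE det_scalar1 unitfE.
exists (c^-1 *: (invmx E *m tperm_mx 0 j)).
  rewrite unitmxZ ?unitfE ?invr_eq0// unitmx_mul unitmx_inv ru /=.
  exact: unitmx_perm.
rewrite -ev cE mul_scalar_mx -!scalemxAl -scalemxAr scalerA.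
rewrite mulmxA mulmxK// mulfV// scale1r.
rewrite -xcolE; apply/rowP => k; rewrite !mxE /= andbT; congr (_%:R); congr nat_of_bool.
rewrite -[RHS](inj_eq (@perm_inj _ (tperm 0 j))) tpermR eq_sym.
by rewrite -[RHS](inj_eq val_inj).
Qed.

End CkLinear.

(** * McShane extension, and linear changes of chart *)

Section McShane.
Context {R : realType}.

(** The extension at [z] is the infimum over [t] in [S] of [a t] plus [K] times the distance from
    [z] to [b t]. With points of the sphere as [t], height as [a] and projection as [b], the cone
    condition by itself makes the height a function of the projection. *)
Lemma mcshane (T : Type) (U : normedModType R) (S : set T) (a : T -> R) (b : T -> U) (K : R) t0 :
  S t0 -> 0 <= K -> (forall s t, S s -> S t -> a s - a t <= K * `|b s - b t|) ->
  exists f : U -> R^o, [/\ lipschitz f, forall x y, `|f x - f y| <= K * `|x - y| &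
    forall t, S t -> f (b t) = a t].
Proof.
move=> St0 K0 hS; pose E z := [set a t + K * `|z - b t| | t in S].
have lbE z s : S s -> lbound (E z) (a s - K * `|b s - z|).
  move=> Ss _ [t St <-]; have h1 := hS s t Ss St.
  have h2 : K * `|b s - b t| <= K * (`|b s - z| + `|z - b t|).
    by rewrite ler_wpM2l// -(subrKA z) ler_normD.
  lra.
have E0 z : E z !=set0 by exists (a t0 + K * `|z - b t0|); exists t0.
have hlE z : has_lbound (E z) by exists (a t0 - K * `|b t0 - z|); exact: lbE.
pose f z : R^o := inf (E z).
have fle x y : f x <= f y + K * `|x - y|.
  rewrite -lerBlDr; apply: lb_le_inf => // _ [t St <-].
  rewrite lerBlDr; apply: le_trans (ge_inf (hlE x) _) _; first by exists t.
  have : K * `|x - b t| <= K * (`|x - y| + `|y - b t|).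
    by rewrite ler_wpM2l// -(subrKA y) ler_normD.
  lra.
have flip x y : `|f x - f y| <= K * `|x - y|.
  rewrite ler_norml; apply/andP; split.
    by have := fle y x; rewrite [`|y - x|]distrC; lra.
  by have := fle x y; lra.
exists f; split=> //.
  apply: (@klipschitzW _ _ _ K); first exact: (@globally_properfilter _ _ (0, 0)).
  by move=> [x y] /= _; exact: flip.
move=> t St; apply/eqP; rewrite eq_le; apply/andP; split.
  apply: (ge_inf (hlE _)); exists t => //.
  by rewrite subrr normr0 mulr0 addr0.
apply: lb_le_inf => //; have := lbE (b t) t St.
by rewrite subrr normr0 mulr0 subr0.
Qed.

Lemma coordB n (u v : 'rV[R]_n) j : (u - v) 0 j = u 0 j - v 0 j.
Proof. by rewrite !mxE. Qed.

Lemma coordD n (u v : 'rV[R]_n) j : (u + v) 0 j = u 0 j + v 0 j.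
Proof. by rewrite !mxE. Qed.

Lemma coord_delta n (h : R) (j : 'I_n) : (h *: (delta_mx 0 j : 'rV[R]_n)) 0 j = h.
Proof. by rewrite !mxE !eqxx mulr1. Qed.

Lemma delta_mx_norm_le n (h : R) (j : 'I_n) : `|h *: (delta_mx 0 j : 'rV[R]_n)| <= `|h|.
Proof.
rewrite normrZ ler_piMr//; apply: rV_norm_le => // i; rewrite mxE eqxx /=.
by case: (i == j); rewrite ?normr1 ?normr0.
Qed.

Lemma col'_norm_le n (j : 'I_n) (v : 'rV[R]_n) : `|col' j v| <= `|v|.
Proof. by apply: rV_norm_le => // i; rewrite mxE; exact: coord_norm_le. Qed.

Lemma norm_le_col' n (j : 'I_n) (v : 'rV[R]_n) : v 0 j = 0 -> `|v| <= `|col' j v|.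
Proof.
move=> vj; apply: rV_norm_le => // i; have [k ->|->] := unliftP j i.
  by have := coord_norm_le (col' j v) k; rewrite mxE.
by rewrite vj normr0.
Qed.

Lemma col'_delta n (j : 'I_n) : col' j (delta_mx 0 j : 'rV[R]_n) = 0.
Proof. by apply/rowP => i; rewrite !mxE eqxx eq_sym (negbTE (neq_lift j i)). Qed.

Lemma chart_ball_sub n (M : smoothManifoldType R n) (p : M) (P : set M) : nbhs p P ->
  exists2 r, 0 < r & forall q, cdom (chart_at p) q ->
    `|cmap (chart_at p) q - cmap (chart_at p) p| < r -> P q.
Proof.
move=> nP; have c1 := cinv_continuous (chart_at_dom p).
have : nbhs (cmap (chart_at p) p) (cinv (chart_at p) @^-1` P).
  by apply: c1; rewrite cmapK//; exact: chart_at_dom.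
move=> /nbhs_ballP[r r0 hr]; exists r => // q dq hq.
rewrite -(cmapK dq); apply: hr.
by rewrite -ball_normE /= distrC.
Qed.

Lemma chart_ball_image n (M : smoothManifoldType R n) (p : M) :
  exists2 r, 0 < r & forall z, `|z - cmap (chart_at p) p| < r ->
    cdom (chart_at p) (cinv (chart_at p) z) /\ cmap (chart_at p) (cinv (chart_at p) z) = z.
Proof.
have /nbhs_ballP[r r0 hr] := cmap_nbhs (chart_at_dom p).
by exists r => // z zr; apply: hr; rewrite -ball_normE /= distrC.
Qed.

Definition lin_tball n (M : smoothManifoldType R n) (p : M) (A : 'M[R]_n) (s : R) : set M :=
  [set q | cdom (chart_at p) q /\
    `|cmap (chart_at p) q *m A - cmap (chart_at p) p *m A| < s].

Lemma mulmx_rV_cont n (A : 'M[R]_n) : continuous (fun x : 'rV[R]_n => x *m A).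
Proof.
have lA : linear (fun x : 'rV[R]_n => x *m A).
  by move=> a u v; rewrite mulmxDl scalemxAl.
by move=> x; exact: sdiff_cont (sdiff_lin x lA (linear_rV_bounded lA)).
Qed.

Lemma mulmx_rV_bounded n (A : 'M[R]_n) :
  exists2 C, 0 < C & forall x : 'rV[R]_n, `|x *m A| <= C * `|x|.
Proof.
apply: bounded_pos; apply: linear_rV_bounded.
by move=> a u v; rewrite mulmxDl scalemxAl.
Qed.

Lemma linear_chart n (M : smoothManifoldType R n) (p : M) (A : 'M[R]_n) :
  A \in unitmx -> exists2 s0, 0 < s0 & forall s, 0 < s -> s <= s0 ->
  exists c : chart R n M, [/\ smooth_chart c, cdom c = lin_tball p A s &
    cmap c = fun q => cmap (chart_at p) q *m A].
Proof.
move=> uA; have [r r0 hr] := chart_ball_image p.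
have [C C0 hC] := mulmx_rV_bounded (invmx A).
(* Within this radius the inverse matrix lands in a coordinate ball contained in the image of
   [chart_at p], so the new chart has a full ball as image. *)
exists (r / C); first by rewrite divr_gt0.
move=> s s0 sr; pose phi := cmap (chart_at p); pose psi := cinv (chart_at p).
have ctau q : cdom (chart_at p) q -> {for q, continuous (fun q => phi q *m A)}.
  move=> dq; apply: (@continuous_comp _ _ _ phi (fun x => x *m A)).
    exact: cmap_continuous.
  exact: mulmx_rV_cont.
have hA x : `|x - phi p *m A| < s -> cdom (chart_at p) (psi (x *m invmx A)) /\
    phi (psi (x *m invmx A)) = x *m invmx A.
  move=> hx; apply: hr; rewrite -[cmap _ p](mulmxK uA) -mulmxBl.
  apply: le_lt_trans (hC _) _; rewrite mulrC -ltr_pdivlMr//.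
  exact: lt_le_trans sr.
have o1 : open (lin_tball p A s).
  rewrite openE => q [dq hq]; apply: filterI.
    by apply: open_nbhs_nbhs; split => //; exact: cdom_open.
  have e0 : 0 < s - `|phi q *m A - phi p *m A| by rewrite subr_gt0.
  have /cvgrPdist_lt/(_ _ e0) := ctau q dq.
  apply: filterS => q'; rewrite distrC => h /=.
  rewrite -(subrKA (phi q *m A)); apply: le_lt_trans (ler_normD _ _) _.
  by rewrite -ltrBrDr.
have o2 : open ((fun q => phi q *m A) @` lin_tball p A s).
  have -> : (fun q => phi q *m A) @` lin_tball p A s = ball (phi p *m A) s.
    apply/seteqP; split => [_ [q [dq hq] <-]|x]; first by rewrite -ball_normE /= distrC.
    rewrite -ball_normE /= distrC => hx; have [h1 h2] := hA x hx.
    exists (psi (x *m invmx A)); last by rewrite h2 mulmxKV.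
    by split=> //; rewrite -/phi h2 mulmxKV.
  exact: ball_open.
have k1 q : lin_tball p A s q -> psi ((phi q *m A) *m invmx A) = q.
  by move=> [dq _]; rewrite mulmxK//; exact: cmapK.
have k2 q : lin_tball p A s q -> {for q, continuous (fun q => phi q *m A)}.
  by move=> [dq _]; exact: ctau.
have k3 q : lin_tball p A s q -> {for (phi q *m A), continuous (fun x : 'rV[R]_n => psi (x *m invmx A))}.
  move=> [dq _]; apply: (@continuous_comp _ _ _ (fun x : 'rV[R]_n => x *m invmx A) psi).
    exact: mulmx_rV_cont.
  by rewrite mulmxK//; exact: cinv_continuous.
exists (Chart o1 o2 k1 k2 k3); split=> // q0; split => q /=.
  move=> [dq _] dq0; apply: (smooth_at_precomp_lin (f := fun y => cmap (chart_at q0) (psi y)) (A := invmx A)).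
  rewrite mulmxK//.
  exact: chart_at_transition.
move=> dq0 [dq _]; apply: (smooth_at_postcomp_lin (f := fun x => cmap (chart_at p) (cinv (chart_at q0) x))).
exact: chart_at_transition.
Qed.

End McShane.

(** * Lipschitz bound at the sphere, and nonvanishing of the dilation direction *)

Section SphereGraph.
Context {R : realType} {n : nat} {G : lieGroupType R n}.
Context {V : R -> {vspace 'rV[R]_n}} {delta : R -> G -> G} {d : G -> G -> R} {p : G}.
Hypothesis scG : simply_connected R G.
Hypothesis grV : is_grading G V.
Hypothesis dilV : is_dilation_family V delta.
Hypothesis homd : homogeneous_distance delta d.
Hypothesis Sp : unit_sphere d p.
Hypothesis spanp : (linfun (mdiff (left_translation p) 1%g) @: V 1 +
   linfun (mdiff (right_translation p) 1%g) @: V 1 + <[delta_bar delta p]>)%VS = fullv.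

Let phi := cmap (chart_at p).

(** Comparison with [p], at distance 1 from the identity, bounds the distance by [1 + 2 * K] on a
    unit coordinate ball, which turns the factor [d 1 q + 1] into a constant. *)
Lemma dnorm_lip_chart : exists2 K, 0 < K & exists2 r, 0 < r &
  forall q q', cdom (chart_at p) q -> cdom (chart_at p) q' -> `|phi q - phi p| < r ->
    `|phi q' - phi p| < r -> `|d 1%g q' - d 1%g q| <= K * `|phi q' - phi q|.
Proof.
have [K K0 [W nW hW]] := dnorm_lip scG grV dilV homd spanp.
have [r r0 hr] := chart_ball_sub nW.
have Wp := nbhs_singleton nW.
pose r' := Num.min r 1; have r'0 : 0 < r' by rewrite lt_min r0 ltr01.
exists (K * (2 * K + 2)); first by rewrite mulr_gt0//; lra.
exists r' => // q q' dq dq'; rewrite !lt_min => /andP[q1 q2] /andP[q3 q4].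
have Wq := hr q dq q1; have Wq' := hr q' dq' q3.
have h1 := hW p q Wp Wq; rewrite Sp in h1.
have h2 : d 1%g q <= 1 + K * 2.
  have h3 : K * (1 + 1) * `|phi q - phi p| <= K * 2 * 1.
    by rewrite ler_wpM2l ?(ltW q2)// mulr_ge0// ltW.
  by have := ler_norm (d 1%g q - 1); lra.
apply: le_trans (hW q q' Wq Wq') _; rewrite ler_wpM2r// ler_wpM2l ?(ltW K0)//.
lra.
Qed.

(** Otherwise the orbit of [p] would move in coordinates by at most [(l - 1) / (2 * K)] for [l > 1]
    close to 1, while the distance grows by exactly [l - 1], against the Lipschitz constant [K]. *)
Lemma delta_bar_neq0 : delta_bar delta p != 0.
Proof.
apply/eqP => db0; have [K K0 [r r0 hK]] := dnorm_lip_chart.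
have e0 : 0 < (2 * K)^-1 by rewrite invr_gt0 mulr_gt0.
have [rho rho0 hf] := delta_flow (p := p) scG grV dilV e0.
have [r' r'0 hr'] := chart_ball_sub hf.
have c : {for 1, continuous (fun l => delta l p)}.
  exact: (delta_gsdiff scG grV dilV p).1.
have hcdom := hr' p (chart_at_dom p) ltac:(by rewrite subrr normr0).
pose l := 1 + Num.min (rho / 2) (Num.min (1/2) (r * K)).
have m0 : 0 < Num.min (rho / 2) (Num.min (1/2) (r * K)) by rewrite !lt_min !divr_gt0// mulr_gt0.
have m1 : Num.min (rho / 2) (Num.min (1/2) (r * K)) <= rho / 2 by rewrite ge_min lexx.
have m2 : Num.min (rho / 2) (Num.min (1/2) (r * K)) <= r * K by rewrite !ge_min lexx !orbT.
set m := Num.min _ _ in l m0 m1 m2 *.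
have lm : l - 1 = m by rewrite /l addrC addKr.
have [dl hl] := hcdom l ltac:(by rewrite lm gtr0_norm//; lra).
rewrite lm db0 scaler0 subr0 (gtr0_norm m0) in hl.
have lp0 : 0 < l by rewrite /l; lra.
have rK : (2 * K)^-1 * m <= r / 2.
  have -> : r / 2 = (2 * K)^-1 * (r * K) by field; rewrite gt_eqF.
  by rewrite ler_wpM2l ?(ltW e0).
have := hK p (delta l p) (chart_at_dom p) dl ltac:(by rewrite subrr normr0) ltac:(lra).
rewrite (dnorm_delta dilV homd)// Sp mulr1 lm (gtr0_norm m0) => h.
have : K * `|phi (delta l p) - phi p| <= K * ((2 * K)^-1 * m) by rewrite ler_wpM2l ?(ltW K0).
rewrite mulrA invfM mulrCA divff ?gt_eqF// mulr1; lra.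
Qed.

Lemma dim_gt0 : (0 < n)%N.
Proof.
have := delta_bar_neq0; rewrite lt0n; apply: contra => /eqP n0.
by apply/eqP/rowP => -[i hi]; exfalso; rewrite n0 in hi.
Qed.

End SphereGraph.

Lemma sphere_graph (R : realType) (n : nat) (G : lieGroupType R n)
    (V : R -> {vspace 'rV[R]_n}) (delta : R -> G -> G) (d : G -> G -> R) (p : G) (R1 : R) :
  simply_connected R G -> is_grading G V -> is_dilation_family V delta ->
  homogeneous_distance delta d -> unit_sphere d p ->
  (linfun (mdiff (left_translation p) 1%g) @: V 1 +
   linfun (mdiff (right_translation p) 1%g) @: V 1 + <[delta_bar delta p]>)%VS = fullv ->
  0 < R1 -> exists U : set G,
  [/\ open_nbhs p U, lipschitz_graph_on (unit_sphere d) U &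
    forall q, U q -> cdom (chart_at p) q /\
      `|cmap (chart_at p) q - cmap (chart_at p) p| < R1].
Proof.
move=> scG grV dilV homd Sp spanp R10; pose phi := cmap (chart_at p).
have [K K0 [r r0 hK]] := dnorm_lip_chart scG grV dilV homd Sp spanp.
have jlt : (n.-1 < n)%N by rewrite prednK// (dim_gt0 scG grV dilV homd Sp spanp).
pose j := Ordinal jlt.
have [A uA hA] := row_to_delta j (delta_bar_neq0 scG grV dilV homd Sp spanp).
have [CA CA0 hCA] := mulmx_rV_bounded A.
have [CB CB0 hCB] := mulmx_rV_bounded (invmx A).
have [s0 s00 hchart] := linear_chart p uA.
pose tau q := phi q *m A.
have tauB q q' : `|phi q - phi q'| <= CB * `|tau q - tau q'|.
  by rewrite -[X in `|X| <= _](mulmxK uA) mulmxBl; exact: hCB.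
pose L := K * CB; have L0 : 0 < L by rewrite mulr_gt0.
have hL q q' : cdom (chart_at p) q -> cdom (chart_at p) q' -> `|phi q - phi p| < r ->
    `|phi q' - phi p| < r -> `|d 1%g q' - d 1%g q| <= L * `|tau q' - tau q|.
  move=> h1 h2 h3 h4; apply: le_trans (hK _ _ h1 h2 h3 h4) _.
  by rewrite /L -mulrA ler_wpM2l ?(ltW K0).
(* The error of the flow is chosen so that [e * (2 * L + 1)] is [1/2]: terms proportional to the
   dilation increment can then be absorbed, both in the cone condition and in the converse
   inclusion. *)
pose e := (2 * (2 * L + 1))^-1.
have e0 : 0 < e by rewrite invr_gt0; lra.
have eL : e * (2 * L + 1) = 2^-1.
  by rewrite /e invfM -mulrA mulVf ?mulr1// gt_eqF//; lra.
have e1 : 0 < e / CA by rewrite divr_gt0.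
have [rho rho0 hf] := delta_flow (p := p) scG grV dilV e1.
have [r2 r20 hr2] := chart_ball_sub hf.
have hflow q l : cdom (chart_at p) q -> `|phi q - phi p| < r2 -> `|l - 1| < rho ->
    cdom (chart_at p) (delta l q) /\
    `|tau (delta l q) - tau q - (l - 1) *: delta_mx 0 j| <= e * `|l - 1|.
  move=> dq hq hl; have [h1 h2] := hr2 q dq hq l hl; split=> //.
  rewrite -hA scalemxAl -!mulmxBl; apply: le_trans (hCA _) _.
  rewrite mulrC -ler_pdivlMr//; apply: le_trans h2 _.
  by rewrite mulrAC.
(* In order: validity of the flow estimate; validity of the Lipschitz bound at dilated points, which
   stay within [5 * s1]; dilation increments below [rho]; positivity of the dilation factor; the
   prescribed radius [R1]; existence of the linear chart. *)
pose s1 := Num.min (Num.min (r2 / CB) (r / (5 * CB))) (Num.min (Num.min (rho / 4) (1 / 4))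
  (Num.min (R1 / CB) s0)).
have s10 : 0 < s1 by rewrite !lt_min s00 !divr_gt0 ?mulr_gt0.
have a1 : s1 <= r2 / CB by rewrite !ge_min lexx.
have a2 : s1 <= r / (5 * CB) by rewrite !ge_min lexx !orbT.
have a3 : s1 <= rho / 4 by rewrite !ge_min lexx !orbT.
have a4 : s1 <= 1 / 4 by rewrite !ge_min lexx !orbT.
have a5 : s1 <= R1 / CB by rewrite !ge_min lexx !orbT.
have a6 : s1 <= s0 by rewrite !ge_min lexx !orbT.
rewrite ler_pdivlMr// in a1; rewrite ler_pdivlMr ?mulr_gt0// in a2; rewrite ler_pdivlMr// in a5.
have b1 : s1 * CB < r.
  by have := mulr_gt0 s10 CB0; move: a2; clear; lra.
have b2 : 5 * s1 * CB <= r by move: a2; clear; lra.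
have phiT q s : `|tau q - tau p| < s -> `|phi q - phi p| < s * CB.
  by move=> h; apply: le_lt_trans (tauB _ _) _; rewrite mulrC ltr_pM2r.
have e12 : e <= 1 / 2 by rewrite -[e]mulr1 div1r -eL ler_wpM2l ?(ltW e0)//; move: L0; clear; lra.
have eL2 : e * L <= 1 / 4.
  by have := eL; rewrite mulrDr mulrCA mulr1; move: e0; clear; lra.
pose S' : set G := lin_tball p A s1 `&` unit_sphere d.
have tball_le s s' q : s <= s' -> lin_tball p A s q -> lin_tball p A s' q.
  by move=> ss [dq h]; split => //; exact: lt_le_trans ss.
have Np := @dnorm_delta R n G V delta d dilV homd.
have S'p : S' p.
  split=> //; split; first exact: chart_at_dom.
  by rewrite subrr normr0.
(* Dilating [y] by [1 + h] lifts it by [h] up to an error [e * |h|], while the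
   distance from the identity becomes [1 + h]; comparing with [x], whose distance
   is [1], bounds [h] by the horizontal displacement. *)
have cone x y : S' x -> S' y -> tau x 0 j - tau y 0 j <= 2 * L * `|col' j (tau x) - col' j (tau y)|.
  move=> [[dx tx] Sx] [[dy ty] Sy]; set h := tau x 0 j - tau y 0 j.
  have hs : `|h| < 2 * s1.
    have h1 : `|h| <= `|tau x - tau y|.
      by rewrite /h -coordB; exact: coord_norm_le.
    apply: le_lt_trans h1 _; rewrite -(subrKA (tau p)); apply: le_lt_trans (ler_normD _ _) _.
    rewrite [X in _ + X]distrC; move: tx ty; rewrite -/(phi _) -/(tau _); clear; lra.
  have el : 1 + h - 1 = h by rewrite addrC addKr.
  have hrho : `|1 + h - 1| < rho by rewrite el; move: hs a3 s10; clear; lra.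
  have [d1 f1] := hflow y (1 + h) dy (lt_le_trans (phiT _ _ ty) a1) hrho.
  rewrite el in f1.
  have h0 : 0 <= `|h| by [].
  have eh : e * `|h| <= 1 / 2 * `|h| by rewrite ler_wpM2r.
  have nhd := delta_mx_norm_le h j.
  have f2 : `|tau (delta (1 + h) y) - tau p| < 5 * s1.
    have -> : tau (delta (1 + h) y) - tau p = (tau (delta (1 + h) y) - tau y - h *: delta_mx 0 j)
      + h *: delta_mx 0 j + (tau y - tau p) by rewrite subrK subrKA.
    apply: le_lt_trans (ler_normD _ _) _; apply: le_lt_trans (lerD (ler_normD _ _) (lexx _)) _.
    have ty' : `|tau y - tau p| < s1 by [].
    move: ty' f1 nhd eh hs s10; clear; lra.
  have f3 := hL x (delta (1 + h) y) dx d1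
    (lt_trans (phiT _ _ tx) b1) (lt_le_trans (phiT _ _ f2) b2).
  have hp : 0 < 1 + h by move: hs; rewrite ltr_norml => /andP[hs1 _]; move: hs1 a4; clear; lra.
  rewrite (Np (1 + h) y hp) (Sy : d 1%g y = 1) (Sx : d 1%g x = 1) mulr1 el in f3.
  have f4 : `|tau (delta (1 + h) y) - tau x| <= e * `|h| + `|col' j (tau x) - col' j (tau y)|.
    have -> : tau (delta (1 + h) y) - tau x = (tau (delta (1 + h) y) - tau y - h *: delta_mx 0 j)
      + (h *: delta_mx 0 j + (tau y - tau x)).
      by rewrite [RHS]addrA subrK subrKA.
    apply: le_trans (ler_normD _ _) _; apply: lerD => //.
    apply: le_trans (norm_le_col' (j := j) _) _.
      by rewrite coordD coordB coord_delta /h subrKA subrr.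
    by rewrite linearD linearZ /= col'_delta scaler0 add0r linearB /= distrC.
  have f5 : L * `|tau (delta (1 + h) y) - tau x| <= L * (e * `|h| + `|col' j (tau x) - col' j (tau y)|).
    by rewrite ler_wpM2l ?(ltW L0).
  (* Absorbing this quarter of the increment leaves the slope [4 / 3 * L], below the announced
     [2 * L]. *)
  have f6 : L * (e * `|h|) <= 1 / 4 * `|h|.
    by rewrite mulrA [L * e]mulrC ler_wpM2r.
  have := ler_norm h; have := normr_ge0 (col' j (tau x) - col' j (tau y)).
  have : 0 <= L * `|col' j (tau x) - col' j (tau y)| by rewrite mulr_ge0 ?(ltW L0).
  move: f3 f5 f6; clear; lra.
have K2 : 0 <= 2 * L by rewrite mulr_ge0 ?(ltW L0).
have [g [glip gK gE]] := mcshane (b := fun q => col' j (tau q)) S'p K2 cone.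
(* The graph function is built from the ball of radius [s1], but the graph property is claimed on a
   smaller one: bringing a point back to the sphere needs an increment of at most [2 * (s * L)], and
   the result must stay in the larger ball. *)
pose s := s1 / (8 * (L + 1)).
have L1 : 0 < 8 * (L + 1) by move: L0; clear; lra.
have s_0 : 0 < s by rewrite divr_gt0.
have sL : s * (8 * (L + 1)) = s1 by rewrite /s divfK// gt_eqF.
have sLp : 0 < s * L by rewrite mulr_gt0.
have ss1 : s <= s1 by move: sL sLp s_0; clear; lra.
have b3 : s * L <= s1 / 8 by move: sL s_0; clear; lra.
have sCB : s * CB <= s1 * CB by rewrite ler_wpM2r ?(ltW CB0).
have [c [sc dc mc]] := hchart s s_0 (le_trans ss1 a6).
exists (lin_tball p A s); split.
- split; first by rewrite -dc; exact: cdom_open.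
  split; [exact: chart_at_dom|by rewrite subrr normr0].
- exists c, j, g; split => // q Uq; rewrite mc -/(tau q).
  have Uq1 := tball_le _ _ _ ss1 Uq.
  have [dq tq] := Uq; rewrite -/(phi _) -/(phi _) -/(tau _) -/(tau _) in tq.
  split=> [Sq|gq]; first by rewrite gE.
  (* The dilate of [q] lying on the sphere is again a point of the graph, but it
     differs from [q] almost vertically; hence it is [q]. *)
  set f := d 1%g q.
  have pr : `|phi q - phi p| < r.
    exact: lt_trans (phiT _ _ tq) (le_lt_trans sCB b1).
  have f1 := hL p q (chart_at_dom p) dq ltac:(by rewrite subrr normr0) pr.
  rewrite (Sp : d 1%g p = 1) -/f in f1.
  have f2 : L * `|tau q - tau p| <= L * s by rewrite ler_wpM2l ?(ltW L0)// ltW.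
  have fb : `|f - 1| <= 1 / 32 by move: f1 f2 b3 a4; clear; lra.
  have f0 : 31 / 32 <= f by move: fb; rewrite ler_norml => /andP[fb1 _]; move: fb1; clear; lra.
  have fp : 0 < f by move: f0; clear; lra.
  pose l := f^-1; set h := l - 1.
  have hE : h * f = 1 - f by rewrite /h /l mulrBl mulVf ?gt_eqF// mul1r.
  have hb : `|h| <= 2 * (s * L).
    have e1h : `|h| * f = `|f - 1|.
      by rewrite -[in LHS](gtr0_norm fp) -normrM hE distrC.
    have : `|h| * (31 / 32) <= `|h| * f by rewrite ler_wpM2l.
    have := normr_ge0 h; move: e1h f1 f2; clear; lra.
  have lp : 0 < l by rewrite invr_gt0.
  have hrho : `|l - 1| < rho by move: hb b3 a3 s10; rewrite -/h; clear; lra.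
  have [dw hw] := hflow q l dq (lt_le_trans (phiT _ _ tq) (le_trans sCB a1)) hrho.
  rewrite -/h in hw.
  have Nw : d 1%g (delta l q) = 1 by rewrite Np// /l mulVf// gt_eqF.
  have h0 : 0 <= `|h| by [].
  have nhd := delta_mx_norm_le h j.
  have eh : e * `|h| <= 1 / 2 * `|h| by rewrite ler_wpM2r.
  have S'w : S' (delta l q).
    split=> //; split => //; rewrite -/(phi _) -/(phi _) -/(tau _) -/(tau _).
    have -> : tau (delta l q) - tau p = (tau (delta l q) - tau q - h *: delta_mx 0 j)
      + h *: delta_mx 0 j + (tau q - tau p) by rewrite subrK subrKA.
    apply: le_lt_trans (ler_normD _ _) _; apply: le_lt_trans (lerD (ler_normD _ _) (lexx _)) _.
    move: hw nhd tq hb b3 eh s10 sL sLp; clear; lra.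
  pose v := tau (delta l q) - tau q - h *: delta_mx 0 j.
  have vE : tau (delta l q) - tau q = v + h *: delta_mx 0 j by rewrite subrK.
  have cE : col' j (tau (delta l q)) - col' j (tau q) = col' j v.
    by rewrite -linearB /= vE linearD linearZ /= col'_delta scaler0 addr0.
  have q1 := gK (col' j (tau (delta l q))) (col' j (tau q)).
  rewrite (gE _ S'w) -gq -coordB vE coordD coord_delta cE in q1.
  have q2 : 2 * L * `|col' j v| <= 2 * L * (e * `|h|).
    by apply: (ler_wpM2l K2); exact: le_trans (col'_norm_le j v) hw.
  have q3 : `|v 0 j| <= e * `|h| by apply: le_trans (coord_norm_le _ _) _.
  have q4 : `|h| <= `|v 0 j + h| + `|v 0 j|.
    by rewrite -{1}(addrK (v 0 j) h) [h + _]addrC; exact: ler_normB.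
  have q5 : 2 * L * (e * `|h|) + e * `|h| = 1 / 2 * `|h|.
    by rewrite div1r -eL; ring.
  (* The estimates combine to bound the absolute value of [h] by half of itself. *)
  have h00 : h = 0 by apply/normr0_eq0; move: q1 q2 q3 q4 q5 h0; clear; lra.
  by move: hE; rewrite h00 mul0r => /esym/eqP; rewrite subr_eq0 => /eqP.
- move=> q [dq tq]; split => //.
  exact: lt_le_trans (phiT _ _ tq) (le_trans sCB a5).
Qed.

(** * Lower bound for the Riemannian distance *)

Section CurveCalculus.
Context {R : realType}.
Implicit Types (V W : normedModType R).

(* No measurability is needed: the integral of a nonnegative function is a supremum over the
   simple functions below it. *)
Lemma le_integral_subset d (T : measurableType d) (mu : {measure set T -> \bar R})
    (D1 D2 : set T) (f g : T -> \bar R) : D1 `<=` D2 ->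
  (forall x, D1 x -> (f x <= g x)%E) -> (forall x, D2 x -> (0 <= g x)%E) ->
  (\int[mu]_(x in D1) f x <= \int[mu]_(x in D2) g x)%E.
Proof.
move=> D12 fg g0; rewrite integralE.
apply: (@le_trans _ _ (\int[mu]_(x in D1) f^\+ x)%E).
  by rewrite -[leRHS]sube0; apply: leeB => //; apply: integral_ge0.
rewrite !ge0_integralE//; apply: le_ereal_sup => _ [h hh <-]; exists h => // x.
apply: le_trans (hh x) _; rewrite /patch; case: ifPn => [|_].
  rewrite inE => D1x; rewrite mem_set; last exact: D12.
  rewrite funeposE; have := fg x D1x; have := g0 x (D12 _ D1x) => h1 h2.
  by rewrite ge_max h2 h1.
by case: ifPn => //; rewrite inE => /g0.
Qed.

(** The fundamental theorem is applied to [h] or to [- h] on [[0, T]], and [g] only serves as an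
    upper bound: the speed of a curve is read in a chart that changes with the point, so no
    regularity in [t] is at hand. [T] will be an exit time. *)
Lemma derive_integral_le (T : R) (h h' g : R -> R) : 0 <= T -> T <= 1 ->
  (forall t : R, 0 <= t <= T -> is_derive t (1 : R) h (h' t)) ->
  (forall t : R, 0 <= t <= T -> {for t, continuous h'}) ->
  (forall t, 0 <= t <= 1 -> 0 <= g t) -> (forall t, 0 <= t <= T -> `|h' t| <= g t) ->
  ((`|h T - h 0|)%:E <= \int[lebesgue_measure]_(t in `[0%R, 1%R]) (g t)%:E)%E.
Proof.
move=> T0 T1 dh ch g0 hg.
have key (k k' : R -> R) : (forall t : R, 0 <= t <= T -> is_derive t (1 : R) k (k' t)) ->
  (forall t : R, 0 <= t <= T -> {for t, continuous k'}) -> (forall t, 0 <= t <= T -> k' t <= g t) ->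
  ((k T - k 0)%:E <= \int[lebesgue_measure]_(t in `[0%R, 1%R]) (g t)%:E)%E.
  move=> dk ck kg; have [T00|Tn0] := eqVneq T 0.
    rewrite T00 subrr; apply: integral_ge0 => t; rewrite /= in_itv /= => t01.
    by rewrite lee_fin; exact: g0.
  have Tp : 0 < T by rewrite lt_neqAle eq_sym Tn0.
  have dkc (t : R) : 0 <= t <= T -> {for t, continuous k}.
    move=> tT; apply: differentiable_continuous; apply/derivable1_diffP.
    by have h1 := dk t tT; exact: ex_derive.
  have <- : (\int[lebesgue_measure]_(t in `[0%R, T]) (k' t)%:E = (k T - k 0)%:E)%E.
    rewrite EFinB; apply: continuous_FTC2 => //.
    - apply: continuous_in_subspaceT => t; rewrite inE /= in_itv /=; exact: ck.
    - split.
      + move=> t; rewrite in_itv /= => /andP[t0 tT].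
        by have h1 := dk t ltac:(by rewrite !ltW); exact: ex_derive.
      + by apply: cvg_at_right_filter; apply: dkc; rewrite lexx T0.
      + by apply: cvg_at_left_filter; apply: dkc; rewrite lexx T0.
    - move=> t; rewrite in_itv /= => /andP[t0 tT].
      have h1 := dk t ltac:(by rewrite !ltW).
      by rewrite derive1E; exact: derive_val.
  apply: le_integral_subset.
  - move=> t /=; rewrite !in_itv /= => /andP[-> tT] /=; exact: le_trans tT T1.
  - by move=> t /=; rewrite in_itv /= lee_fin; exact: kg.
  - by move=> t /=; rewrite in_itv /= lee_fin; exact: g0.
have [hp|hn] := leP 0 (h T - h 0).
  rewrite ger0_norm//; apply: (key h h') => // t tT.
  by apply: le_trans (hg t tT); exact: ler_norm.
rewrite ltr0_norm// opprB.
have -> : h 0 - h T = (fun t => - h t) T - (fun t => - h t) 0 by rewrite /= opprK addrC.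
apply: (key (fun t => - h t) (fun t => - h' t)) => t tT.
- by have h1 := dh t tT; apply: is_deriveN.
- by have h1 := ch t tT; apply: cvgN.
- by apply: le_trans (hg t tT); rewrite -normrN; exact: ler_norm.
Qed.

(** Any two-point estimate near [s] constrains the derivative at [s]. With [L] the derivative at
    another point it gives continuity of the derivative; with [L = 0] it bounds the derivative by a
    Lipschitz constant. *)
Lemma sdiff_close V W (f : V -> W) s M L e U : sdiff f s M -> linear L -> nbhs s U ->
  (forall y z, U y -> U z -> `|f y - f z - L (y - z)| <= e * `|y - z|) ->
  forall u, `|M u - L u| <= e * `|u|.
Proof.
move=> [lM _ hM] lL nU hU u; apply/ler_addgt0Pl => e1 e10.
have up : 0 < `|u| + 1 by rewrite ltr_wpDl.
have [U' nU' hU'] := hM (e1 / (`|u| + 1)) ltac:(by rewrite divr_gt0).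
have /nbhs_ballP[r r0 hr] : nbhs s (U `&` U') by exact: filterI.
pose h := r / (2 * (`|u| + 1)); have h0 : 0 < h by rewrite divr_gt0// mulr_gt0.
have [Us Us'] := hr s (ballxx s r0).
have hhu : `|h *: u| < r.
  rewrite normrZ gtr0_norm//.
  apply: (@le_lt_trans _ _ (h * (`|u| + 1))); first by rewrite ler_wpM2l ?lerDl// ltW.
  have -> : h * (`|u| + 1) = r / 2 by rewrite /h; field; rewrite gt_eqF//; lra.
  by rewrite gtr_pMr// invf_lt1// ltr1n.
have [Uh Uh'] := hr (s + h *: u) ltac:(by rewrite -ball_normE /= opprD addrA subrr sub0r normrN).
have es : s + h *: u - s = h *: u by rewrite addrC addKr.
have q1 := hU _ _ Uh Us; have q2 := hU' _ _ Uh' Us'.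
rewrite es (linearZ_fun lL) in q1; rewrite es (linearZ_fun lM) in q2.
have q3 : h * `|M u - L u| <= h * ((e + e1 / (`|u| + 1)) * `|u|).
  rewrite -{1}(gtr0_norm h0) -normrZ scalerBr.
  have -> : h *: M u - h *: L u = (f (s + h *: u) - f s - h *: L u) - (f (s + h *: u) - f s - h *: M u).
    by rewrite opprB [RHS]addrC subrKA.
  apply: le_trans (ler_normB _ _) _; apply: le_trans (lerD q1 q2) _.
  by rewrite normrZ (gtr0_norm h0); rewrite -mulrDl mulrCA.
rewrite ler_pM2l// in q3; apply: le_trans q3 _; rewrite mulrDl addrC lerD2r.
by rewrite mulrAC ler_pdivrMr// ler_wpM2l ?(ltW e10)// lerDl.
Qed.

Lemma sdiff_derive1 n (f : R -> 'rV[R]_n) (s : R) L : sdiff f s L -> derive1 f s = L 1.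
Proof. by move=> /sdiff_diff[df dE]; rewrite derive1E' // dE. Qed.

(** The strict estimate at [t] holds around every nearby [s], so it already controls the derivative
    there. *)
Lemma sdiff_derive1_cont n (f : R -> 'rV[R]_n) (t : R) :
  (\forall s \near t, exists L, sdiff f s L) -> {for t, continuous (derive1 f)}.
Proof.
move=> h; have [L dL] := nbhs_singleton h; have [lL _ hL] := dL.
apply/cvgrPdist_le => e e0; have [U nU hU] := hL e e0.
have nU' := nbhs_interior nU.
near=> s.
have [M dM] : exists L, sdiff f s L by near: s.
rewrite (sdiff_derive1 dL) (sdiff_derive1 dM) distrC.
have nUs : nbhs s U by near: s; exact: nU'.
by have := sdiff_close dM lL nUs hU 1; rewrite normr1 mulr1.
Unshelve. all: by end_near. Qed.

End CurveCalculus.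

(** * Curves read in different charts *)

Section CurvesInCharts.
Context {R : realType} {n : nat} {M : smoothManifoldType R n}.

Lemma sdiff_change_chart (V : normedModType R) (c : V -> M) (t : V) (a b : M) L :
  {for t, continuous c} -> cdom (chart_at a) (c t) -> cdom (chart_at b) (c t) ->
  sdiff (fun s => cmap (chart_at a) (c s)) t L ->
  sdiff (fun s => cmap (chart_at b) (c s)) t
    (fun u => 'd (fun x => cmap (chart_at b) (cinv (chart_at a) x)) (cmap (chart_at a) (c t)) (L u)).
Proof.
move=> cc da db dL.
have h := sdiff_comp dL (smooth_at_sdiff (chart_at_transition a b _ da db)).
apply: sdiff_near h; near=> s; rewrite cmapK//.
by near: s; apply: cc; apply: open_nbhs_nbhs; split => //; exact: cdom_open.
Unshelve. all: by end_near. Qed.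

(** The C^1 condition at [t] is stated in the chart at [c t]; moving to the fixed chart at [b],
    simultaneously for all nearby times, makes the derivative continuous in time. *)
Lemma C1_sdiff_near (c : R -> M) (t : R) (b : M) : {for t, continuous c} ->
  Ck_at 1 (fun s : R^o => cmap (chart_at (c t)) (c s)) t -> cdom (chart_at b) (c t) ->
  \forall s \near t, exists L, sdiff (fun s : R => cmap (chart_at b) (c s)) s L.
Proof.
move=> cc [D [[oD Dt] hD]] db.
have df s : D s -> sdiff (fun s : R => cmap (chart_at (c t)) (c s)) s
    ('d (fun s : R^o => cmap (chart_at (c t)) (c s)) s).
  by move=> Ds; exact: (Ck1_sdiff_R (conj oD Ds) hD).
have [E [[oE Et] hE]] := chart_at_transition (c t) b _ (chart_at_dom (c t)) db.
have n1 : nbhs t (fun s => cdom (chart_at (c t)) (c s)).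
  by apply: cc; exact: chart_nbhs.
have n2 : nbhs t (fun s : R => E (cmap (chart_at (c t)) (c s))).
  by apply: (sdiff_cont (df t Dt)); apply: open_nbhs_nbhs.
have n3 : nbhs t D by apply: open_nbhs_nbhs.
apply: filterS3 (nbhs_interior n1) n2 n3 => s ns Es Ds.
have h := sdiff_comp (df s Ds) (Ck1_sdiff (conj oE Es) (hE 1%N)).
eexists; apply: sdiff_near h.
by apply: filterS ns => s' ds'; rewrite cmapK.
Qed.

End CurvesInCharts.

(** * Comparison of a Riemannian metric with the coordinate norm *)

Section MetricBound.
Context {R : realType}.

Lemma continuous_sum_seq (T : topologicalType) (I : Type) (r : seq I) (F : I -> T -> R) (x : T) :
  (forall i, {for x, continuous (F i)}) -> {for x, continuous (fun u => \sum_(i <- r) F i u)}.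
Proof.
move=> cF; elim: r => [|i r IH].
  have -> : (fun u => \sum_(i <- [::]) F i u) = cst 0 by apply/funext => u; rewrite big_nil.
  exact: cvg_cst.
have -> : (fun u => \sum_(j <- i :: r) F j u) = (fun u => F i u + \sum_(j <- r) F j u).
  by apply/funext => u; rewrite big_cons.
exact: cvgD (cF i) IH.
Qed.

(** The constant is the minimum of [Q] on the unit sphere, positive by compactness and carried to
    all vectors by homogeneity. *)
Lemma posdef_bound n (Q : 'rV[R]_n -> R) : continuous Q ->
  (forall a u, Q (a *: u) = a ^+ 2 * Q u) -> (forall u, u != 0 -> 0 < Q u) ->
  exists2 c, 0 < c & forall u, c * `|u| ^+ 2 <= Q u.
Proof.
move=> cQ hQ pQ.
have Q0 : Q 0 = 0 by have := hQ 0 0; rewrite scaler0 expr0n mul0r.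
pose S := [set u : 'rV[R]_n | `|u| = 1].
have unitS u : u != 0 -> S (`|u|^-1 *: u).
  move=> u0; rewrite /S /= normrZ normfV normr_id mulVf// normr_eq0//.
(* The unit sphere is empty precisely when the space is zero, and then any constant works. *)
have [S0|S0] := pselect (S !=set0); last first.
  exists 1 => // u; have [->|u0] := eqVneq u 0; first by rewrite normr0 expr0n mulr0 Q0.
  by exfalso; apply: S0; exists (`|u|^-1 *: u); exact: unitS.
have cS : compact S.
  apply: bounded_closed_compact.
    by exists 1; split => // x x1 u /= ->; exact: ltW.
  have -> : S = (fun u : 'rV[R]_n => `|u|) @^-1` [set 1] by [].
  apply: closed_comp; last exact: closed_eq.
  by move=> u _; exact: norm_continuous.
have [u0 + hu0] := EVT_min_rV S0 cS (continuous_subspaceT cQ).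
rewrite inE => Su0.
have u00 : u0 != 0 by rewrite -normr_gt0 Su0 ltr01.
exists (Q u0); first exact: pQ.
move=> u; have [->|un0] := eqVneq u 0; first by rewrite normr0 expr0n mulr0 Q0.
have np : 0 < `|u| by rewrite normr_gt0.
have := hu0 (`|u|^-1 *: u) ltac:(by rewrite inE; exact: unitS).
by rewrite hQ exprVn mulrC ler_pdivlMr ?exprn_gt0.
Qed.

Context {n : nat} {M : smoothManifoldType R n}.
Variable g : M -> 'rV[R]_n -> 'rV[R]_n -> R.
Hypothesis rg : riemannian_metric g.

Lemma metric_lin q (v : 'rV[R]_n) : linear (fun u => g q u v : R^o).
Proof. by move=> a u w; have [h _ _ _] := rg; rewrite h. Qed.

Definition qcoef (q0 : M) (i j : 'I_n) (z : 'rV[R]_n) : R :=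
  metric_coeff g q0 (delta_mx 0 i) (delta_mx 0 j) z.

Lemma metric_coeff_sum (q0 : M) u v z :
  metric_coeff g q0 u v z = \sum_i \sum_j u 0 i * (v 0 j * qcoef q0 i j z).
Proof.
rewrite /qcoef /metric_coeff; set q := cinv _ z.
set A := 'd _ z.
have [_ gs _ _] := rg.
have lA : linear (A : 'rV[R]_n -> 'rV[R]_n) by exact: linearP.
have lin1 w : linear (fun u => g q (A u) w : R^o).
  by move=> a x y; rewrite lA metric_lin.
rewrite (linear_rV_sum (lin1 (A v))); apply: eq_bigr => i _.
rewrite -mulr_sumr; congr (_ * _).
rewrite gs (linear_rV_sum (lin1 (A (delta_mx 0 i)))); apply: eq_bigr => j _.
by rewrite gs.
Qed.

(** At the centre this is positive definiteness; the finitely many coefficients being continuous,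
    half of the constant survives nearby. *)
Lemma metric_coeff_local (q0 : M) : exists2 c, 0 < c &
  \forall z \near cmap (chart_at q0) q0, forall u, c * `|u| ^+ 2 <= metric_coeff g q0 u u z.
Proof.
set z0 := cmap (chart_at q0) q0.
have [_ gs gp gsm] := rg.
have cij i j : {for z0, continuous (qcoef q0 i j)}.
  have [D [[oD Dz] hD]] := gsm q0 (delta_mx 0 i) (delta_mx 0 j).
  exact: (hD 0%N z0 Dz).
have dq0 := chart_at_dom q0.
have A0 u : metric_coeff g q0 u u z0 = g q0 u u.
  rewrite /metric_coeff /z0 (cmapK dq0).
  have h : sdiff (fun y => cmap (chart_at q0) (cinv (chart_at q0) y)) z0 (fun u => u).
    apply: sdiff_near (sdiff_id z0).
    by apply: filterS (cmap_nbhs dq0) => z [_ ->].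
  by rewrite (sdiff_diff h).2.
pose Q u := metric_coeff g q0 u u z0.
have [c c0 hc] : exists2 c, 0 < c & forall u, c * `|u| ^+ 2 <= Q u.
  apply: posdef_bound.
  - have -> : Q = fun u => \sum_i \sum_j u 0 i * (u 0 j * qcoef q0 i j z0).
      by apply/funext => u; exact: metric_coeff_sum.
    have cc i : continuous (fun u : 'rV[R]_n => u 0 i) by exact: coord_continuous.
    move=> u; apply: continuous_sum_seq => i; apply: continuous_sum_seq => j.
    have c1 := cc i u; have c2 := cc j u.
    exact: (cvgM c1 (cvgM c2 (cvg_cst _))).
  - move=> a u; rewrite /Q !metric_coeff_sum mulr_sumr; apply: eq_bigr => i _.
    by rewrite mulr_sumr; apply: eq_bigr => j _; rewrite !mxE; ring.
  - by move=> u u0; rewrite /Q A0; exact: gp.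
(* Perturbing the [n * n] coefficients by [e] costs at most [n * n * e], which this choice keeps
   below [c / 2]; the [+ 1] covers [n = 0]. *)
pose e := c / (2 * (n%:R * n%:R + 1)).
have np : 0 < n%:R * n%:R + 1 :> R by rewrite ltr_wpDl// mulr_ge0.
have e0 : 0 < e by rewrite divr_gt0// mulr_gt0.
exists (c / 2); first by rewrite divr_gt0.
have : \forall z \near z0, forall ij : 'I_n * 'I_n, `|qcoef q0 ij.1 ij.2 z - qcoef q0 ij.1 ij.2 z0| <= e.
  apply: (@filter_forall _ _ (fun (ij : 'I_n * 'I_n) z =>
    `|qcoef q0 ij.1 ij.2 z - qcoef q0 ij.1 ij.2 z0| <= e) (nbhs z0) _) => ij.
  exact: continuous_close (cij _ _) e0.
apply: filterS => z hz u.
have h1 : `|metric_coeff g q0 u u z - Q u| <= n%:R * n%:R * e * `|u| ^+ 2.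
  rewrite /Q !metric_coeff_sum -sumrB; apply: le_trans (ler_norm_sum _ _ _) _.
  have -> : n%:R * n%:R * e * `|u| ^+ 2 = \sum_(i < n) (n%:R * e * `|u| ^+ 2).
    by rewrite sumr_const card_ord -!mulrA mulr_natl.
  apply: ler_sum => i _; rewrite -sumrB; apply: le_trans (ler_norm_sum _ _ _) _.
  have -> : n%:R * e * `|u| ^+ 2 = \sum_(j < n) (e * `|u| ^+ 2).
    by rewrite sumr_const card_ord -!mulrA mulr_natl.
  apply: ler_sum => j _; rewrite -!mulrBr !normrM mulrA mulrC.
  apply: ler_pM => //; first exact: (hz (i, j)).
  by rewrite expr2; apply: ler_pM => //; exact: coord_norm_le.
have h2 : n%:R * n%:R * e <= c / 2.
  have -> : c / 2 = (n%:R * n%:R + 1) * e by rewrite /e; field; rewrite gt_eqF.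
  by rewrite ler_wpM2r ?(ltW e0)// lerDl.
have h3 := hc u.
have h4 : n%:R * n%:R * e * `|u| ^+ 2 <= c / 2 * `|u| ^+ 2 by rewrite ler_wpM2r// exprn_ge0.
move: h1; rewrite ler_norml => /andP[h1 _]; move: h1 h3 h4.
set X := metric_coeff _ _ _ _ _; set Y := Q u; set Z := `|u| ^+ 2; clear; lra.
Qed.

End MetricBound.

(** Three charts meet: the velocity is read at [c t], the metric is controlled in the chart at [q0],
    and the derivative is wanted in the chart at [p]. The chart at [q0] links them; [K] is a local
    Lipschitz constant of its transition to [p], hence bounds the differentials of that transition
    nearby. *)
Lemma velocity_bound (R : realType) (n : nat) (M : smoothManifoldType R n)
    (g : M -> 'rV[R]_n -> 'rV[R]_n -> R) (p q0 : M) :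
  riemannian_metric g -> cdom (chart_at p) q0 -> exists2 k, 0 < k &
  \forall q \near q0, forall (c : R -> M) (t : R) L, c t = q -> {for t, continuous c} ->
    sdiff (fun s : R => cmap (chart_at (c t)) (c s)) t L ->
    k * `|derive1 (fun s : R => cmap (chart_at p) (c s)) t|
      <= Num.sqrt (g (c t) (velocity c t) (velocity c t)).
Proof.
move=> rg dp.
have [k k0 hk] := metric_coeff_local rg q0.
have d0 := chart_at_dom q0.
have trs := smooth_at_sdiff (chart_at_transition q0 p _ d0 dp).
have [K K0 [U nU hU]] := sdiff_lip trs.
have c0 := cmap_continuous d0.
exists (Num.sqrt k / K); first by rewrite divr_gt0// sqrtr_gt0.
have n1 := c0 _ (nbhs_interior nU); have n2 := c0 _ hk.
have n3 : nbhs q0 (cdom (chart_at q0)) by exact: chart_nbhs.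
have n4 : nbhs q0 (cdom (chart_at p)).
  by apply: open_nbhs_nbhs; split => //; exact: cdom_open.
near=> q => c t L cq cc dL.
have dq0 : cdom (chart_at q0) (c t) by rewrite cq; near: q.
have dqp : cdom (chart_at p) (c t) by rewrite cq; near: q.
have nUq : nbhs (cmap (chart_at q0) (c t)) U by rewrite cq; near: q.
have hq u : k * `|u| ^+ 2 <= metric_coeff g q0 u u (cmap (chart_at q0) (c t)).
  by rewrite cq; move: u; near: q.
have dL0 := sdiff_change_chart cc (chart_at_dom (c t)) dq0 dL.
set w := derive1 (fun s : R => cmap (chart_at q0) (c s)) t.
have wE := sdiff_derive1 dL0; rewrite -/w in wE.
have dv := sdiff_change_chart cc dq0 (chart_at_dom (c t)) dL0.
have dpp := sdiff_change_chart cc dq0 dqp dL0.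
have vE : velocity c t = 'd (fun x => cmap (chart_at (c t)) (cinv (chart_at q0) x))
    (cmap (chart_at q0) (c t)) w by rewrite /velocity (sdiff_derive1 dv) wE.
have pE : derive1 (fun s : R => cmap (chart_at p) (c s)) t =
    'd (fun x => cmap (chart_at p) (cinv (chart_at q0) x)) (cmap (chart_at q0) (c t)) w.
  by rewrite (sdiff_derive1 dpp) wE.
rewrite pE.
have B : `|'d (fun x => cmap (chart_at p) (cinv (chart_at q0) x)) (cmap (chart_at q0) (c t)) w| <= K * `|w|.
  have trq := smooth_at_sdiff (chart_at_transition q0 p _ dq0 dqp).
  have l0 : linear (fun _ : 'rV[R]_n => 0 : 'rV[R]_n) by move=> a x y; rewrite scaler0 addr0.
  have hU0 y z : U y -> U z -> `|cmap (chart_at p) (cinv (chart_at q0) y) -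
      cmap (chart_at p) (cinv (chart_at q0) z) - 0| <= K * `|y - z|.
    by move=> Uy Uz; rewrite subr0; exact: hU.
  by have := sdiff_close trq l0 nUq hU0 w; rewrite subr0.
apply: le_trans (ler_wpM2l _ B) _; first by rewrite divr_ge0 ?sqrtr_ge0 ?(ltW K0).
rewrite mulrA divfK ?gt_eqF//.
have mE : metric_coeff g q0 w w (cmap (chart_at q0) (c t)) = g (c t) (velocity c t) (velocity c t).
  by rewrite vE /metric_coeff (cmapK dq0).
have := hq w; rewrite mE => h.
have -> : Num.sqrt k * `|w| = Num.sqrt (k * `|w| ^+ 2).
  by rewrite sqrtrM ?(ltW k0)// sqrtr_sqr normr_id.
exact: ler_wsqrtr.
Unshelve. all: by end_near. Qed.

(** * Curves that stay in a coordinate ball or leave it *)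

Section RiemannianLower.
Context {R : realType} {n : nat} {M : smoothManifoldType R n}.
Variables (g : M -> 'rV[R]_n -> 'rV[R]_n -> R) (p : M) (R2 : R).
Hypothesis rg : riemannian_metric g.
Hypothesis hR2 : forall z, `|z - cmap (chart_at p) p| <= R2 ->
  cdom (chart_at p) (cinv (chart_at p) z) /\ cmap (chart_at p) (cinv (chart_at p) z) = z.

Let phi := cmap (chart_at p).
Let psi := cinv (chart_at p).

Definition velocity_bounded (k : R) (q : M) : Prop := forall (c : R -> M) (t : R) L,
  c t = q -> {for t, continuous c} ->
  sdiff (fun s : R => cmap (chart_at (c t)) (c s)) t L ->
  k * `|derive1 (fun s : R => cmap (chart_at p) (c s)) t|
    <= Num.sqrt (g (c t) (velocity c t) (velocity c t)).

Lemma closed_ball_compact : compact [set z | `|z - phi p| <= R2].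
Proof.
apply: bounded_closed_compact.
  exists (`|phi p| + R2); split; first exact: num_real.
  move=> x hx z /= hz; apply: le_trans (ltW hx).
  by rewrite -(subrK (phi p) z) addrC; apply: le_trans (ler_normD _ _) _; rewrite lerD2l.
have -> : [set z | `|z - phi p| <= R2] =
  (fun z : 'rV[R]_n => `|z - phi p|) @^-1` [set x : R | x <= R2] by [].
apply: closed_comp; last exact: closed_le.
move=> z _; apply: continuous_comp; last exact: norm_continuous.
exact: sdiff_cont (sdiffD (sdiff_id z) (sdiff_cst (- phi p) z)).
Qed.

(** A smaller constant is a weaker claim, so local constants become uniform by compactness, phrased
    with the filter of positive reals tending to 0. *)
Lemma velocity_bounded_ball : exists2 k, 0 < k & forall q, cdom (chart_at p) q ->
  `|phi q - phi p| <= R2 -> velocity_bounded k q.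
Proof.
have /compact_near_coveringP cov := closed_ball_compact.
have H := cov R (0 : R)^'+ (fun k z => velocity_bounded k (psi z)) _.
have {}H : \forall k \near (0 : R)^'+, [set z | `|z - phi p| <= R2] `<=`
    (fun z => velocity_bounded k (psi z)).
  apply: H => z /= hz; have [dz ez] := hR2 hz.
  have [k0 k00 hk] := velocity_bound rg dz.
  have cz : {for z, continuous psi} by have := cinv_continuous dz; rewrite ez.
  exists ([set z' | velocity_bounded k0 (psi z')], [set k | k <= k0]).
    split=> /=; first exact: cz.
    by apply: nbhs_right_le.
  move=> [z' k] /= [hz' kk0] c t L ct cc dL.
  by apply: le_trans (hz' c t L ct cc dL); rewrite ler_wpM2r.
have [k [k0 hk]] := filter_ex (filterI (nbhs_right_gt (0 : R)) H).
exists k => // q dq hq; have := hk (phi q) hq.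
by rewrite /psi cmapK.
Qed.

Variable k : R.
Hypothesis k0 : 0 < k.
Hypothesis hk : forall q, cdom (chart_at p) q -> `|phi q - phi p| <= R2 -> velocity_bounded k q.

Lemma curve_length_ge0 c : (0 <= curve_length g c)%E.
Proof. by apply: integral_ge0 => t _; rewrite lee_fin sqrtr_ge0. Qed.

Lemma sdiff_is_derive (f : R -> R) (t : R) L : sdiff f t L -> is_derive t (1 : R) f (L 1).
Proof.
move=> /sdiff_diff[df dE]; apply: DeriveDef; first exact: diff_derivable.
by rewrite deriveE// dE.
Qed.

(** Each coordinate separately is bounded by the length, and the norm is the largest of them. What
    happens after [T] only adds to the length. *)
Lemma curve_length_stay c (T : R) : C1_curve c -> 0 <= T -> T <= 1 ->
  (forall t, 0 <= t <= T -> cdom (chart_at p) (c t) /\ `|phi (c t) - phi p| <= R2) ->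
  ((k * `|phi (c T) - phi (c 0)|)%:E <= curve_length g c)%E.
Proof.
move=> Cc T0 T1 hT.
pose v t := derive1 (fun s : R => cmap (chart_at p) (c s)) t.
have C1t (t : R) : 0 <= t <= T -> {for t, continuous c} /\
    Ck_at 1 (fun s : R^o => cmap (chart_at (c t)) (c s)) t.
  by move=> /andP[t0 tT]; apply: Cc; rewrite in_itv /= t0 (le_trans tT).
have sd (t : R) : 0 <= t <= T -> \forall s \near t, exists L, sdiff (fun s : R => phi (c s)) s L.
  by move=> tT; have [cc hc] := C1t t tT; apply: C1_sdiff_near cc hc _; exact: (hT t tT).1.
have coord i : ((`|k * (phi (c T)) 0 i - k * (phi (c 0)) 0 i|)%:E <= curve_length g c)%E.
  apply: (@derive_integral_le R T (fun t => k * (phi (c t)) 0 i) (fun t => k * (v t) 0 i)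
    (fun t => Num.sqrt (g (c t) (velocity c t) (velocity c t)))) => //.
  - move=> t tT; have [L dL] := nbhs_singleton (sd t tT).
    have dc := sdiff_comp (sdiff_comp dL (sdiff_coord _ i)) (sdiff_mulr_l k _).
    by have := sdiff_is_derive dc; rewrite /v (sdiff_derive1 dL).
  - move=> t tT; have cv := sdiff_derive1_cont (sd t tT).
    apply: cvgM; first exact: cvg_cst.
    apply: (@continuous_comp _ _ _ v (fun w : 'rV[R]_n => w 0 i)); first exact: cv.
    exact: coord_continuous.
  - move=> t tT; rewrite normrM (gtr0_norm k0).
    apply: (@le_trans _ _ (k * `|v t|)); first by rewrite ler_wpM2l ?(ltW k0)// coord_norm_le.
    have [cc [D [[oD Dt] hD]]] := C1t t tT.
    have dd : sdiff (fun s : R => cmap (chart_at (c t)) (c s)) t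
       ('d (fun s : R^o => cmap (chart_at (c t)) (c s)) t) := Ck1_sdiff_R (conj oD Dt) hD.
    by have [h1 h2] := hT t tT; exact: (hk h1 h2 (erefl (c t)) cc dd).
have := curve_length_ge0 c; move: coord; case: (curve_length g c) => [r| |] //; last first.
  by move=> _ _; rewrite leey.
move=> hr; rewrite !lee_fin => r0.
rewrite mulrC -ler_pdivlMr//; apply: rV_norm_le => [|i]; first by rewrite divr_ge0// ltW.
have := hr i; rewrite lee_fin -mulrBr normrM (gtr0_norm k0) => hi.
by rewrite ler_pdivlMr// coordB mulrC.
Qed.

(** If the curve leaves the open ball, stop it at the first exit time [T]: it has stayed in the
    closed ball until then and has reached radius [R2]. *)
Lemma curve_length_alt c : C1_curve c -> cdom (chart_at p) (c 0) -> `|phi (c 0) - phi p| < R2 ->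
  [/\ cdom (chart_at p) (c 1), `|phi (c 1) - phi p| < R2 &
     ((k * `|phi (c 1) - phi (c 0)|)%:E <= curve_length g c)%E] \/
  ((k * (R2 - `|phi (c 0) - phi p|))%:E <= curve_length g c)%E.
Proof.
move=> Cc d0 h0; pose B t := cdom (chart_at p) (c t) /\ `|phi (c t) - phi p| < R2.
have [allB|] := pselect (forall t, 0 <= t <= 1 -> B t).
  left; have [h1 h2] := allB 1 ltac:(by rewrite lexx ler01); split => //.
  apply: curve_length_stay => //.
  by move=> t /allB[h3 h4]; split => //; exact: ltW.
move=> nB; right.
pose E := [set t : R | 0 <= t <= 1 /\ ~ B t].
have [t1 Et1] : exists t, E t.
  apply: contrapT => nE; apply: nB => t t01; apply: contrapT => nBt.
  by apply: nE; exists t.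
have lbE : lbound E 0 by move=> t [/andP[]].
have hlb : has_lbound E by exists 0.
pose T := inf E.
have T0 : 0 <= T by apply: lb_le_inf => //; exists t1.
have T1 : T <= 1 by apply: le_trans (ge_inf hlb Et1) _; case: Et1 => /andP[].
have Blt t : 0 <= t -> t < T -> B t.
  move=> t0 tT; apply: contrapT => nBt.
  have : T <= t by apply: (ge_inf hlb); split => //; rewrite t0 (le_trans (ltW tT)).
  by rewrite leNgt tT.
have ccT : {for T, continuous c} by have [] := Cc T ltac:(by rewrite in_itv /= T0).
(* The ball is open in [M], so the infimum of the exit times is itself an exit time. *)
have nBT : ~ B T.
  move=> [dT hT].
  have nB1 : \forall t \near T, B t.
    apply: filterI; first by apply: ccT; apply: open_nbhs_nbhs; split => //; exact: cdom_open.
    have cT : {for T, continuous (fun t => phi (c t))}.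
      exact: (@continuous_comp _ _ _ c phi) ccT (cmap_continuous dT).
    have e0 : 0 < R2 - `|phi (c T) - phi p| by rewrite subr_gt0.
    have /cvgrPdist_lt/(_ _ e0) := cT; apply: filterS => t; rewrite distrC => ht.
    rewrite -(subrKA (phi (c T))); apply: le_lt_trans (ler_normD _ _) _.
    by rewrite -ltrBrDr.
  have /nbhs_ballP[e e0 he] := nB1.
  have : T + e <= T.
    apply: lb_le_inf; first by exists t1.
    move=> t Et; rewrite leNgt; apply/negP => te; case: (Et) => _; apply; apply: he.
    rewrite -ball_normE /= distrC ger0_norm ?subr_ge0; last exact: (ge_inf hlb).
    by rewrite ltrBlDl.
  by rewrite gerDl leNgt e0.
have Tp : 0 < T.
  rewrite lt_neqAle T0 andbT; apply/eqP => T00; apply: nBT; rewrite -T00; split => //.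
(* A curve might leave the chart domain without its coordinates reaching radius [R2]. This is
   excluded because the closed coordinate ball is compact, hence closed in the Hausdorff space [M],
   and [c T] is a limit of its points. *)
have cS : closed (psi @` [set z | `|z - phi p| <= R2]).
  apply: compact_closed; first exact: mfd_hausdorff.
  apply: continuous_compact; last exact: closed_ball_compact.
  apply: continuous_in_subspaceT => z; rewrite inE /= => hz; have [dz ez] := hR2 hz.
  by have := cinv_continuous dz; rewrite ez.
have [z hz cz] : (psi @` [set z | `|z - phi p| <= R2]) (c T).
  apply: cS => P nP; have /nbhs_ballP[e e0 he] : nbhs T (c @^-1` P) by exact: ccT.
  pose t := Num.max 0 (T - e / 2).
  have t0 : 0 <= t by rewrite le_max lexx.
  have tT : t < T by rewrite gt_max Tp ltrBlDr ltrDl divr_gt0.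
  have te : T - e / 2 <= t by rewrite le_max lexx orbT.
  have [dt ht] := Blt t t0 tT.
  exists (c t); split; last first.
    apply: he; rewrite -ball_normE /= ger0_norm ?subr_ge0 ?(ltW tT)//.
    apply: (@le_lt_trans _ _ (e / 2)); first by rewrite lerBlDl -lerBlDr.
    by rewrite ltr_pdivrMr// ltr_pMr// ltr1n.
  by exists (phi (c t)); [exact: ltW|exact: cmapK].
have [dz ez] := hR2 hz.
have dT : cdom (chart_at p) (c T) by rewrite -cz.
have eT : phi (c T) = z by rewrite -cz.
have hT : R2 <= `|phi (c T) - phi p|.
  by rewrite leNgt; apply/negP => h; apply: nBT.
apply: le_trans (curve_length_stay Cc T0 T1 _).
  rewrite lee_fin ler_wpM2l ?(ltW k0)// lerBlDr; apply: le_trans hT _.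
  by rewrite -(subrKA (phi (c 0))); exact: ler_normD.
move=> t /andP[t0 tT]; move: tT; rewrite le_eqVlt => /orP[/eqP->|tT].
  by split => //; rewrite eT.
by have [h1 h2] := Blt t t0 tT; split => //; exact: ltW.
Qed.

(** The alternative passes from arcs to chains: when an arc leaves the ball, the displacement of the
    earlier arcs makes up for its having started closer to the boundary than [z 0] did. *)
Lemma path_length_alt (z : nat -> M) (c : nat -> R -> M) (m : nat) :
  (forall i, (i < m)%N -> [/\ C1_curve (c i), c i 0 = z i & c i 1 = z i.+1]) ->
  cdom (chart_at p) (z 0%N) -> `|phi (z 0%N) - phi p| < R2 ->
  [/\ cdom (chart_at p) (z m), `|phi (z m) - phi p| < R2 &
     ((k * `|phi (z m) - phi (z 0%N)|)%:E <= \sum_(i < m) curve_length g (c i))%E] \/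
  ((k * (R2 - `|phi (z 0%N) - phi p|))%:E <= \sum_(i < m) curve_length g (c i))%E.
Proof.
move=> + d0 h0; elim: m => [|m IH] h.
  by left; split => //; rewrite subrr normr0 mulr0 big_ord0.
have [|[dm hm lm]|] := IH; first by move=> i im; apply: h; exact: ltnW.
  have [Cm cm0 cm1] := h m (ltnSn m).
  have [||[d1 h1 l1]|l1] := curve_length_alt Cm; rewrite ?cm0//.
    left; rewrite -cm1; split => //; rewrite big_ord_recr /=.
    apply: le_trans (leeD lm l1); rewrite -EFinD lee_fin cm0 -mulrDr ler_wpM2l ?(ltW k0)//.
    by rewrite [leRHS]addrC -(subrKA (phi (z m))); exact: ler_normD.
  right; rewrite big_ord_recr /=; apply: le_trans (leeD lm l1).
  rewrite -EFinD lee_fin cm0 -mulrDr ler_wpM2l ?(ltW k0)//.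
  have : `|phi (z m) - phi p| <= `|phi (z m) - phi (z 0%N)| + `|phi (z 0%N) - phi p|.
    by rewrite -(subrKA (phi (z 0%N))); exact: ler_normD.
  lra.
move=> l1; right; rewrite big_ord_recr /=; apply: le_trans l1 _.
by apply: leeDl; exact: curve_length_ge0.
Qed.

End RiemannianLower.

(** The factor 3 settles the case of a path that leaves: from radius less than [r] to radius [3 * r]
    it covers at least [2 * r], more than the coordinate distance between [x] and [y]. *)
Lemma riemannian_distance_lower (R : realType) (n : nat) (M : smoothManifoldType R n)
    (g : M -> 'rV[R]_n -> 'rV[R]_n -> R) (p : M) (r : R) :
  riemannian_metric g -> 0 < r ->
  (forall z, `|z - cmap (chart_at p) p| <= 3 * r ->
    cdom (chart_at p) (cinv (chart_at p) z) /\ cmap (chart_at p) (cinv (chart_at p) z) = z) ->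
  exists2 k, 0 < k & forall x y,
    cdom (chart_at p) x -> `|cmap (chart_at p) x - cmap (chart_at p) p| < r ->
    cdom (chart_at p) y -> `|cmap (chart_at p) y - cmap (chart_at p) p| < r ->
    ((k * `|cmap (chart_at p) x - cmap (chart_at p) y|)%:E <= riemannian_distance g x y)%E.
Proof.
move=> rg r0 hr; have [k k0 hk] := velocity_bounded_ball rg hr.
exists k => // x y dx hx dy hy; apply: le_ereal_inf_tmp => _ [m [z [c [z0 zm hc ->]]]].
have hx3 : `|cmap (chart_at p) x - cmap (chart_at p) p| < 3 * r by lra.
have [||[_ _]|] := path_length_alt hr k0 hk hc; rewrite ?z0 ?zm//.
  by rewrite distrC.
apply: le_trans; rewrite lee_fin ler_wpM2l ?(ltW k0)//.
have : `|cmap (chart_at p) x - cmap (chart_at p) y| <=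
   `|cmap (chart_at p) x - cmap (chart_at p) p| + `|cmap (chart_at p) p - cmap (chart_at p) y|.
  by rewrite -(subrKA (cmap (chart_at p) p)); exact: ler_normD.
rewrite (distrC (cmap (chart_at p) p)); lra.
Qed.

Theorem theorem1p3 (R : realType) (n : nat) (G : lieGroupType R n)
    (V : R -> {vspace 'rV[R]_n}) (delta : R -> G -> G) (d : G -> G -> R)
    (p : G) :
  simply_connected R G ->
  is_grading G V ->
  is_dilation_family V delta ->
  homogeneous_distance delta d ->
  unit_sphere d p ->
  (linfun (mdiff (left_translation p) 1%g) @: V 1 +
   linfun (mdiff (right_translation p) 1%g) @: V 1 +
   <[delta_bar delta p]>)%VS = fullv ->
  exists U : set G,
    [/\ open_nbhs p U,
        lipschitz_graph_on (unit_sphere d) U &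
        forall g, riemannian_metric g ->
          lipschitz_wrt (riemannian_distance g) (fun q => d 1%g q) U].
Proof.
move=> scG grV dilV homd Sp spanp.
have [K K0 [r r0 hK]] := dnorm_lip_chart scG grV dilV homd Sp spanp.
have [r' r'0 hr'] := chart_ball_image p.
pose R1 := Num.min r (r' / 4).
have R10 : 0 < R1 by rewrite lt_min r0/=; lra.
have R1r : R1 <= r by rewrite ge_min lexx.
have R1r' : R1 <= r' / 4 by rewrite ge_min lexx orbT.
have [U [oU lU hU]] := sphere_graph scG grV dilV homd Sp spanp R10.
(* The neighborhood is fixed before the metric; only the constant [K / k] depends on [g]. *)
exists U; split=> // g rg.
have hz z : `|z - cmap (chart_at p) p| <= 3 * R1 ->
    cdom (chart_at p) (cinv (chart_at p) z) /\
    cmap (chart_at p) (cinv (chart_at p) z) = z.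
  by move=> h; apply: hr'; lra.
have [k k0 hk] := riemannian_distance_lower rg R10 hz.
exists (K / k); split=> [|x y Ux Uy]; first by rewrite divr_ge0 ?ltW.
have [dx hx] := hU x Ux; have [dy hy] := hU y Uy.
have h1 := hK y x dy dx (lt_le_trans hy R1r) (lt_le_trans hx R1r).
have h2 : ((K / k)%:E * (k * `|cmap (chart_at p) x - cmap (chart_at p) y|)%:E <=
           (K / k)%:E * riemannian_distance g x y)%E.
  by apply: lee_wpmul2l; [rewrite lee_fin divr_ge0 ?ltW|exact: hk].
apply: le_trans h2; rewrite -EFinM lee_fin mulrA divfK ?gt_eqF//.
Qed.
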